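(* There exists a constant $C>0$ such that the following is true. Let $B$ be a finite set, let $V$ be a vector space (over $\mathbb{Q}$) of functions from $B$ to $\mathbb{Q}$, let $(\phi_a)_{a\in A}$ be a basis of $V$ (with $A$ a finite index set of size $\dim(V)$), and define $\phi:B\to\mathbb{Q}^A$ by $\phi(b)_a=\phi_a(b)$. Let $0<p<1$, let $(T_b)_{b\in B}$ be independent random variables with $\mathbb{P}[T_b=1]=1-\mathbb{P}[T_b=0]=p$, and let $X:=\sum_{b\in B}T_b\cdot\phi(b)$. Assume that the following conditions hold for some integers $c_2,c_3\ge1$: (1) Boundedness of $V$: $V$ has a $c_2$-bounded integer basis in $\ell_\infty$. (2) Boundedness of $V^\perp$: $V^\perp$ has a $c_3$-bounded integer basis in $\ell_1$. (3) Symmetry: for any $b_1,b_2\in B$ there exists a symmetry $\pi$ of $V$ satisfying $\pi(b_1)=b_2$. If $$\min(p|B|,(1-p)|B|)\ge C\cdot c_2c_3^2\dim(V)^6\log(2c_3\dim(V))^6,$$ then for every $\lambda\in\mathcal{L}(\phi)$, $$\mathbb{P}[X=\lambda]=\frac{\det(\mathcal{L}(\phi))}{(2\pi)^{\frac{\dim(V)}{2}}\sqrt{\det\Sigma[X]}}\left(e^{-\frac12(\lambda-\mathbb{E}[X])^t\Sigma[X]^{-1}(\lambda-\mathbb{E}[X])}+\delta(\lambda)\right)$$ with $$|\delta(\lambda)|\le\frac{C\dim(V)^3(\log(2c_2\dim(V)))^{3/2}}{\sqrt{\min(p|B|,(1-p)|B|)}}.$$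
   Context: Lattice: $\mathcal{L}(\phi):=\{\sum_{b\in B}n_b\phi(b):\ n_b\in\mathbb{Z}\}\subset\mathbb{Q}^A$, and $\det(\mathcal{L}(\phi))$ is its determinant (covolume in $\mathbb{R}^A$). Mean and covariance: $\mathbb{E}[X]=p\sum_{b\in B}\phi(b)$, and $\Sigma[X]=p(1-p)\phi^t\phi$ is the covariance matrix of $X$, where $\phi^t\phi$ is the symmetric positive definite $A\times A$ matrix with entries $(\phi^t\phi)_{a,a'}=\sum_{b\in B}\phi(b)_a\phi(b)_{a'}$. Bounded integer basis: for a subspace $W\subset\mathbb{Q}^B$ and $1\le r\le\infty$, $W$ has a $c$-bounded integer basis in $\ell_r$ if $\mathrm{Span}(\{\gamma\in W\cap\mathbb{Z}^B:\ \|\gamma\|_r\le c\})=W$. Here $\|\gamma\|_1=\sum_{b}|\gamma_b|$ and $\|\gamma\|_\infty=\max_b|\gamma_b|$. Orthogonal complement: $V^\perp:=\{g\in\mathbb{Q}^B:\ \sum_{b\in B}f(b)g(b)=0\ \ \forall f\in V\}$. Symmetry: a symmetry of $V$ is a permutation $\pi$ of $B$ satisfying $f\circ\pi\in V$ for all $f\in V$. *)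

(* Defs.v *)
From HB Require Import structures.
From mathcomp Require Import all_boot all_order all_algebra perm.
From mathcomp Require Import all_classical all_reals all_analysis.

Set Implicit Arguments.
Unset Strict Implicit.
Unset Printing Implicit Defensive.

Local Open Scope classical_set_scope.
Local Open Scope ring_scope.

(* The codomain is [rat^o] rather than [rat] so that the canonical [vectType]
   structure over [rat] is found. *)
Notation ratvec I := {ffun I -> rat^o}.

Definition l1_norm (B : finType) (g : B -> rat) : rat := \sum_b `|g b|.

(* The neutral element 0 only matters for empty [B]. *)
Definition linf_norm (B : finType) (g : B -> rat) : rat :=
  \big[Num.max/0]_b `|g b|.

Definition linear_span (B : finType) (S : set (ratvec B)) : set (ratvec B) :=
  [set f | exists s : seq (ratvec B),
     (forall g, g \in s -> S g) /\ f \in span s].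

Definition bounded_integer_basis (B : finType) (norm : (B -> rat) -> rat)
    (c : nat) (W : set (ratvec B)) : Prop :=
  linear_span
    [set g : ratvec B |
      [/\ W g, forall b, (g b : rat) \is a Num.int & norm g <= c%:R]] = W.

Definition orth_compl (B : finType) (V : {vspace ratvec B}) : set (ratvec B) :=
  [set g : ratvec B | forall f : ratvec B, f \in V -> \sum_b f b * g b = 0].

Definition symmetry (B : finType) (V : {vspace ratvec B}) (s : {perm B}) : Prop :=
  forall f : ratvec B, f \in V -> ([ffun b => f (s b)] : ratvec B) \in V.

Definition eval_at (A B : finType) (phi : A -> ratvec B) (b : B) : ratvec A :=
  [ffun a => phi a b].

Definition lattice (I A : finType) (v : I -> ratvec A) : set (ratvec A) :=
  [set x | exists n : I -> int, x = \sum_i v i *~ n i].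

(* Vectors and square matrices indexed by a finite type [A] are turned into
   MathComp matrices along the enumeration of [A]; the determinant and the
   quadratic form below do not depend on the enumeration. *)
Definition col_of (A : finType) (F : Type) (x : A -> F) : 'cV[F]_#|A| :=
  \col_i x (enum_val i).

Definition mx_of (A : finType) (F : Type) (M : A -> A -> F) : 'M[F]_#|A| :=
  \matrix_(i, j) M (enum_val i) (enum_val j).

(* The covolume of a full-rank lattice [L] is the absolute value of the
   determinant of any Z-basis [beta] of [L], so the choice made by [xget] is
   immaterial; the default value 0 is returned only when [L] is not a full-rank
   lattice. *)
Definition lattice_det (A : finType) (L : set (ratvec A)) : rat :=
  xget 0 [set D : rat | exists beta : A -> ratvec A,
    [/\ free (codom beta), L = lattice beta &
        D = `|\det (mx_of (fun a a' => beta a a' : rat))|]].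

Section Probability.
Context d (Omega : measurableType d) (R : realType) (P : probability Omega R).

Definition mutually_independent (I : finType) (T : I -> {RV P >-> R}) : Prop :=
  forall (J : {set I}) (E : I -> set R),
    (forall i, i \in J -> measurable (E i)) ->
    P [set w | forall i, i \in J -> E i (T i w)] =
    (\prod_(i in J) P (T i @^-1` E i))%E.

Definition random_sum (A B : finType) (phi : A -> ratvec B)
    (T : B -> {RV P >-> R}) (w : Omega) : {ffun A -> R} :=
  [ffun a => \sum_b T b w * ratr (eval_at phi b a)].

Definition mean_vec (A : finType) (X : Omega -> {ffun A -> R}) (a : A) : R :=
  fine 'E_P[fun w => X w a].

Definition cov_mx (A : finType) (X : Omega -> {ffun A -> R}) : 'M[R]_#|A| :=
  mx_of (fun a a' => fine (covariance P (fun w => X w a) (fun w => X w a'))).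

Definition prob_eq (A : finType) (X : Omega -> {ffun A -> R})
    (lambda : ratvec A) : \bar R :=
  P [set w | X w = [ffun a => ratr (lambda a)]].

Definition gauss_exponent (A : finType) (X : Omega -> {ffun A -> R})
    (lambda : ratvec A) : R :=
  let x := col_of (fun a => ratr (lambda a) - mean_vec X a) in
  - (1 / 2) * (x^T *m invmx (cov_mx X) *m x) ord0 ord0.

End Probability.

(* Main.v *)
Require Import Defs.
From HB Require Import structures.
From mathcomp Require Import all_boot all_order all_algebra perm.
From mathcomp Require Import all_classical all_reals all_analysis.
From mathcomp Require Import measurable_realfun complex.
From mathcomp Require Import ring lra zify.

(** A local limit theorem by Fourier inversion, with all error terms explicit.

    In coordinates with respect to a basis of the lattice [L], the vectors [phi b] become integer
    vectors [psi b] that generate [Z^d], with [d = dim V], and the determinant of [L] cancels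
    against the change of basis in the covariance.  What remains ([core_bound]) is to compare the
    probability that the sum of [psi b] over a [p]-random subset equals [lam] with a Gaussian
    density.  Write [<psi b, theta>] for the pairing, [v = p * (1 - p)] and [s = v * #|B|].  The
    probability is the mean over the torus [R^d / Z^d] of the characteristic function of the
    centred sum, and the torus splits into two regions according to the energy, the sum over [b]
    of [<psi b, theta>^2], of the representatives of a point.

    Near the origin, symmetry is used through leverage scores: they sum to [d] and are all equal,
    so [<psi b, theta>^2] is at most [d / #|B|] times the energy ([leverage]).  If the energy is
    below [#|B| / (16 * d^2)], all pairings are therefore small, and a factor by factor Taylor
    expansion to third order gives a Gaussian up to a relative error of order [d^2 / sqrt s]
    ([near_gauss]).

    Away from the origin, the modulus is at most [exp (- v / 2 * D)], where [D] is the sum over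
    [b] of the squared distance of [<psi b, theta>] to the integers.  If these distances are not
    small on average, [D] is large.  Otherwise they are small everywhere ([sup_dist_le_avg]): a
    maximal dissociated family of translates of [theta] under symmetries is short, by a pigeonhole
    argument that rests on the bounded basis of [V]; maximality controls the distance at every
    point by the total distance of the family, and transitivity moves a point where this total is
    at most average to any other point.  Small residues satisfy the short integer relations of the
    configuration exactly, because an integer smaller than 1 is 0; as these relations span the
    orthogonal complement of [V], the residues are themselves the pairings of some [theta'], and
    [theta - theta'] is integral because the [psi b] generate [Z^d] ([residues_lift]).  Hence [D]
    is the energy of a representative of [theta], which is large by assumption.

    The mean over the torus is replaced by the mean over its [N]-torsion points, which is exact
    for large [N]; the Gaussian side becomes a Riemann sum, and [N] tends to infinity
    ([law_gval]).  The limit of the Riemann sum is computed one coordinate at a time with Schur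
    complements ([gsum_cvg]), which reduces it to the Fourier transform of a Gaussian in one
    variable.  The lower bound on [min (p * #|B|, (1 - p) * #|B|)] is what makes the region away
    from the origin contribute at most [1 / sqrt s] in the scale of the peak of the density. *)

Set Implicit Arguments.
Unset Strict Implicit.
Unset Printing Implicit Defensive.

Import Order.TTheory GRing.Theory Num.Theory.
Import numFieldNormedType.Exports.

Local Open Scope classical_set_scope.
Local Open Scope ring_scope.

(** * Distance to the integers and dissociated translates *)

Section DistInt.
Context (R : realType).
Implicit Types x y : R.

Definition rnd x : int := Num.floor (x + 1 / 2).

Definition fpart x : R := x - (rnd x)%:~R.

Definition dZ x : R := `|fpart x|.

Lemma dZ_le_half x : dZ x <= 1 / 2.
Proof.
rewrite /dZ /fpart /rnd; have /andP[] := floor_itv (x + 1 / 2).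
rewrite intrD => h1 h2.
rewrite ler_norml; apply/andP; split; lra.
Qed.

Lemma dZ_ge0 x : 0 <= dZ x.
Proof. exact: normr_ge0. Qed.

Lemma dZ_le x (n : int) : dZ x <= `|x - n%:~R|.
Proof.
have [->|hn] := eqVneq n (rnd x); first by [].
apply: (le_trans (dZ_le_half x)).
have h1 : 1 <= `|(n - rnd x)%:~R : R|.
  by rewrite -intr_norm (ler_int R 1); lia.
have h2 : `|(n - rnd x)%:~R : R| <= `|x - n%:~R| + dZ x.
  rewrite [X in _ <= X]addrC /dZ (_ : (n - rnd x)%:~R = fpart x - (x - n%:~R)); first exact: ler_normB.
  by rewrite /fpart intrB; ring.
have := dZ_le_half x; lra.
Qed.

Lemma dZD x y : dZ (x + y) <= dZ x + dZ y.
Proof.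
apply: le_trans (dZ_le _ (rnd x + rnd y)) _.
rewrite intrD (_ : _ - _ = fpart x + fpart y); first exact: ler_normD.
by rewrite /fpart; ring.
Qed.

Lemma dZN x : dZ (- x) <= dZ x.
Proof.
apply: le_trans (dZ_le _ (- rnd x)) _.
by rewrite intrN -opprD normrN.
Qed.

Lemma dZ0 : dZ 0 = 0.
Proof. by apply/eqP; rewrite eq_le dZ_ge0 andbT; have := dZ_le 0 0; rewrite subrr normr0. Qed.

Lemma dZ_sign x (e : int) : `|e| <= 1 -> dZ (e%:~R * x) <= dZ x.
Proof.
move=> he; have [->|[->|->]] : e = 0 \/ e = 1 \/ e = -1 by lia.
- by rewrite mul0r dZ0 dZ_ge0.
- by rewrite mul1r.
- by rewrite mulN1r dZN.
Qed.

Lemma dZ_sum (I : finType) (P : pred I) (F : I -> R) :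
  dZ (\sum_(i | P i) F i) <= \sum_(i | P i) dZ (F i).
Proof.
elim/big_ind2: _ => //; first by rewrite dZ0.
by move=> a b c e h1 h2; apply: le_trans (dZD _ _) (lerD h1 h2).
Qed.

End DistInt.

Section Dissociation.
Context (R : realType) (B : finType) (d : nat) (psi : B -> 'rV[int]_d).

Definition pairing (b : B) (theta : 'rV[R]_d) : R :=
  \sum_i (psi b 0 i)%:~R * theta 0 i.

Lemma pairingD b u v : pairing b (u + v) = pairing b u + pairing b v.
Proof. by rewrite -big_split; apply: eq_bigr => i _; rewrite mxE mulrDr. Qed.

Lemma pairingZ b a v : pairing b (a *: v) = a * pairing b v.
Proof. by rewrite mulr_sumr; apply: eq_bigr => i _; rewrite mxE mulrCA. Qed.

Lemma pairingN b v : pairing b (- v) = - pairing b v.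
Proof. by rewrite -scaleN1r pairingZ mulN1r. Qed.

Lemma pairing_sum b (I : finType) (P : pred I) (F : I -> 'rV[R]_d) :
  pairing b (\sum_(i | P i) F i) = \sum_(i | P i) pairing b (F i).
Proof.
apply: (big_morph (pairing b)); first exact: pairingD.
by rewrite /pairing big1 // => i _; rewrite mxE mulr0.
Qed.

Context (F : 'M[int]_d) (c2 : nat).
Hypothesis F_nonsing : \det F != 0.
Hypothesis F_bound : forall b j, `|(psi b *m F) 0 j| <= c2%:Z.

Definition basis_coord (theta : 'rV[R]_d) : 'rV[R]_d :=
  theta *m (invmx (map_mx intr F))^T.

Lemma pairing_basis_coord b theta :
  pairing b theta = \sum_j basis_coord theta 0 j * ((psi b *m F) 0 j)%:~R.
Proof.
have uF : map_mx (intr : int -> R) F \in unitmx.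
  by rewrite unitmxE det_map_mx unitfE intr_eq0.
have -> : pairing b theta = (theta *m (map_mx intr (psi b))^T) 0 0.
  by rewrite mxE; apply: eq_bigr => i _; rewrite !mxE mulrC.
have -> : \sum_j basis_coord theta 0 j * ((psi b *m F) 0 j)%:~R
   = (basis_coord theta *m (map_mx intr (psi b *m F))^T) 0 0.
  by rewrite [RHS]mxE; apply: eq_bigr => i _; rewrite !mxE.
rewrite map_mxM trmx_mul /basis_coord.
set X := (invmx _)^T; set Y := (map_mx _ F)^T; set Z := _^T.
have XY : X *m Y = 1%:M by rewrite -trmx_mul mulmxV // trmx1.
by rewrite mulmxA -(mulmxA theta) XY mulmx1.
Qed.

(** Dissociated sets in the sense of additive combinatorics, up to the tolerance [sigma]. *)
Definition dissociated (sigma : R) (us : seq 'rV[R]_d) :=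
  forall eps : nat -> int, (forall i, `|eps i| <= 1) ->
  (forall b, dZ (pairing b (\sum_(i < size us) (eps i)%:~R *: us`_i)) <= sigma) ->
  forall i, (i < size us)%N -> eps i = 0.

(** Pigeonhole: cut the torus of coordinates in the basis [F] into [M ^ d] boxes of side [1
    / M]. Two subset sums in one box would differ by a combination with coefficients in {-1,
    0, 1} whose pairings are close to integers, because the matrix of pairings in this basis
    is integral and bounded by [c2]. *)
Lemma dissociated_size (M : nat) us : (0 < M)%N ->
  dissociated (d%:R * c2%:R / M%:R) us -> (2 ^ size us <= M ^ d)%N.
Proof.
move=> M0 dis; set k := size us.
pose sum (S : {set 'I_k}) := \sum_(i in S) us`_i.
have box_lt (x : R) : (absz (Num.floor (M%:R * (x - (Num.floor x)%:~R))) < M)%N.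
  set y := x - _; have /andP[h1 h2] := floor_itv x.
  have y0 : 0 <= y by rewrite /y; lra.
  have y1 : y < 1 by rewrite /y; rewrite intrD in h2; lra.
  have f0 : (0 <= Num.floor (M%:R * y)) by rewrite floor_ge0 mulr_ge0.
  have : Num.floor (M%:R * y) < M%:Z.
    rewrite -(ltr_int R); apply: le_lt_trans (floor_le _) _.
    by rewrite -[X in _ < X]mulr1 ltr_pM2l // ltr0n.
  lia.
pose box (S : {set 'I_k}) : {ffun 'I_d -> 'I_M} :=
  [ffun j => Ordinal (box_lt (basis_coord (sum S) 0 j))].
suff box_inj : injective box.
  have := leq_card box box_inj.
  by rewrite card_ffun !card_ord -cardsT -powersetT card_powerset cardsT card_ord.
move=> S S' eqb.
have close j : exists n : int, `|basis_coord (sum S) 0 j - basis_coord (sum S') 0 j - n%:~R| <= M%:R^-1.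
  have /(congr1 val) /= := congr1 (fun f : {ffun 'I_d -> 'I_M} => f j) eqb.
  rewrite !ffunE /=; set x := basis_coord _ _ _; set y := basis_coord _ _ _ => e.
  exists (Num.floor x - Num.floor y).
  have /andP[h1 h2] := floor_itv x; have /andP[h3 h4] := floor_itv y.
  have x0 : (0 <= Num.floor (M%:R * (x - (Num.floor x)%:~R))) by rewrite floor_ge0 mulr_ge0 // subr_ge0.
  have y0 : (0 <= Num.floor (M%:R * (y - (Num.floor y)%:~R))) by rewrite floor_ge0 mulr_ge0 // subr_ge0.
  have {}e : Num.floor (M%:R * (x - (Num.floor x)%:~R)) = Num.floor (M%:R * (y - (Num.floor y)%:~R)) by lia.
  have MR : 0 < M%:R :> R by rewrite ltr0n.
  have /andP[h5 h6] := floor_itv (M%:R * (x - (Num.floor x)%:~R)).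
  have /andP[h7 h8] := floor_itv (M%:R * (y - (Num.floor y)%:~R)).
  rewrite e in h5 h6; rewrite intrD in h6 h8.
  rewrite -[X in _ <= X]mulr1 ler_pdivlMl // -[X in X * _](gtr0_norm MR) -normrM intrB ler_norml.
  apply/andP; split; lra.
have [n nP] := choice close.
(* The two subset sums differ by the combination with coefficients [eps]; if the subsets
   differ, it contradicts dissociation. *)
pose eps (i : nat) : int := match insub i with Some i' => (i' \in S)%:Z - (i' \in S')%:Z | None => 0 end.
have epsE (i : 'I_k) : eps i = (i \in S)%:Z - (i \in S')%:Z.
  by rewrite /eps valK.
have eps1 i : `|eps i| <= 1.
  by rewrite /eps; case: insubP => [i' _ _|_] //; case: (_ \in S); case: (_ \in S').
have sumeps : \sum_(i < k) (eps i)%:~R *: us`_i = sum S - sum S'.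
  rewrite /sum [X in X - _]big_mkcond [X in _ - X]big_mkcond -sumrB.
  apply: eq_bigr => i _; rewrite epsE intrB scalerBl.
  by case: (i \in S); case: (i \in S'); rewrite /= ?scale1r ?scale0r.
have zero := dis eps eps1 _.
apply/setP => i.
have : eps i = 0.
  apply: zero => // b.
  rewrite sumeps pairingD pairingN !pairing_basis_coord -sumrB.
  apply: le_trans (dZ_le _ (\sum_j n j * (psi b *m F) 0 j)) _.
  rewrite (raddf_sum (intmul 1%R)) /= -sumrB.
  apply: le_trans (ler_norm_sum _ _ _) _.
  apply: (@le_trans _ _ (\sum_(j < d) c2%:R / M%:R)); last first.
    by rewrite sumr_const card_ord -mulrA [X in _ <= X]mulr_natl.
  apply: ler_sum => j _.
  rewrite intrM -!mulrBl normrM mulrC ler_pM //.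
  by have := F_bound b j; rewrite -(ler_int R) intr_norm.
rewrite epsE; by case: (i \in S); case: (i \in S').
Qed.

Context (theta : 'rV[R]_d).

Definition translate (u : 'rV[R]_d) :=
  exists s : {perm B}, forall b, pairing b u = pairing (s b) theta.

(** Greedy choice. A translate that cannot be added to a dissociated family is, up to sign
    and up to a combination of the family with coefficients in {-1, 0, 1}, within [sigma] of
    the integers at every point, so that the family controls it everywhere. *)
Lemma dissociated_extend (sigma : R) (n : nat) :
  (exists us, [/\ (size us < n)%N, forall u, u \in us -> translate u &
     forall u, translate u -> forall b,
       dZ (pairing b u) <= sigma + \sum_(i < size us) dZ (pairing b us`_i)]) \/
  (exists us, [/\ size us = n, forall u, u \in us -> translate u & dissociated sigma us]).
Proof.
elim: n => [|n [[us [h1 h2 h3]]|[us [h1 h2 h3]]]].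
- by right; exists [::]; split.
- by left; exists us; split => //; apply: ltnW.
have [[u [tu hu]]|no] := pselect (exists u, translate u /\ dissociated sigma (u :: us)).
  right; exists (u :: us); split => //=; first by rewrite h1.
  by move=> v; rewrite inE => /orP[/eqP -> //|]; exact: h2.
left; exists us; split => //; first by rewrite h1.
move=> u tu b.
have [//|bad] := leP (dZ (pairing b u)) (sigma + \sum_(i < size us) dZ (pairing b us`_i)).
case: no; exists u; split => // eps eps1 small.
(* If [eps 0] is 1 or -1, the relation [small] bounds [u] by the family, against [bad]. *)
have e0 : eps 0%N = 0.
  apply/eqP; apply: contraT => ne0.
  suff : dZ (pairing b u) <= sigma + \sum_(i < size us) dZ (pairing b us`_i) by rewrite leNgt bad.
  have := small b; rewrite /= big_ord_recl /= => sm.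
  set w := \sum_(i < size us) (eps (bump 0 i))%:~R *: us`_i.
  have -> : u = (eps 0%N)%:~R *: (((eps 0%N)%:~R *: u + w) - w).
    rewrite addrK scalerA -intrM.
    have -> : eps 0%N * eps 0%N = 1 by have := eps1 0%N; nia.
    by rewrite scale1r.
  rewrite pairingZ; apply: le_trans (dZ_sign _ (eps1 _)) _.
  rewrite pairingD; apply: le_trans (dZD _ _) (lerD sm _).
  rewrite pairingN; apply: le_trans (dZN _) _; rewrite pairing_sum.
  apply: le_trans (dZ_sum _ _) _; apply: ler_sum => i _.
  by rewrite pairingZ dZ_sign.
have r := h3 (fun i => eps i.+1) (fun i => eps1 _) _.
case=> [//|i]; rewrite ltnS; apply: r => b'.
have := small b'; rewrite /= big_ord_recl /= e0 scale0r add0r; exact.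
Qed.

Hypothesis trans : forall b1 b2 : B, exists u, exists2 s : {perm B},
  (forall b, pairing b u = pairing (s b) theta) & s b1 = b2.

(** The greedy family has fewer than [k] members, and each of them has the same total
    distance as [theta]. So at some point [b0] the family contributes at most [k] times the
    average; a symmetry moves [b0] to [b]. *)
Lemma sup_dist_le_avg (M k : nat) (b : B) : (0 < M)%N -> (M ^ d < 2 ^ k)%N ->
  dZ (pairing b theta) <=
    d%:R * c2%:R / M%:R + k%:R * ((\sum_b dZ (pairing b theta)) / #|B|%:R).
Proof.
move=> M0 Mk; set sigma := d%:R * c2%:R / M%:R.
have B0 : 0 < #|B|%:R :> R by rewrite ltr0n; apply/card_gt0P; exists b.
set avg := _ / #|B|%:R.
have tot0 : 0 <= \sum_b dZ (pairing b theta) by apply: sumr_ge0 => i _; apply: dZ_ge0.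
case: (dissociated_extend sigma k) => [[us [usk ust usP]]|[us [usk _ dis]]]; last first.
  by have := dissociated_size M0 dis; rewrite usk leqNgt Mk.
have tot : \sum_b (\sum_(i < size us) dZ (pairing b us`_i)) <= k%:R * avg * #|B|%:R.
  rewrite exchange_big /=.
  apply: (@le_trans _ _ (\sum_(i < size us) \sum_b dZ (pairing b theta))).
    apply: ler_sum => i _.
    have [s hs] := ust us`_i (mem_nth 0 (ltn_ord i)).
    rewrite [X in _ <= X](reindex_inj (@perm_inj _ s)) /=.
    by apply: ler_sum => b' _; rewrite hs.
  rewrite sumr_const card_ord -mulrA divfK ?gt_eqF // -[X in X <= _]mulr_natl.
  by apply: ler_wpM2r => //; rewrite ler_nat ltnW.
have [b0 hb0] : exists b0, \sum_(i < size us) dZ (pairing b0 us`_i) <= k%:R * avg.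
  apply/existsP; apply: contraT; rewrite negb_exists => /forallP no.
  suff : k%:R * avg * #|B|%:R < \sum_b (\sum_(i < size us) dZ (pairing b us`_i)) by rewrite ltNge tot.
  have -> : k%:R * avg * #|B|%:R = \sum_(b : B) k%:R * avg by rewrite sumr_const mulr_natr.
  apply: ltr_sum; first by apply/hasP; exists b => //; rewrite mem_index_enum.
  by move=> i _; have := no i; rewrite -ltNge.
have [u [s us_ sb0]] := trans b0 b.
rewrite -sb0 -us_.
apply: le_trans (usP u _ b0) (lerD (lexx _) hb0).
by exists s.
Qed.

End Dissociation.

(** * Comparison by derivatives and integrals over the line *)

Section Calculus.
Context (R : realType).
Implicit Types (f g : R -> R) (u v x y : R).

Lemma derive_within f df u v : (forall x, x \in `[u, v] -> is_derive x 1 f (df x)) ->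
  {within `[u, v], continuous f}.
Proof.
move=> hf; apply: derivable_within_continuous => x hx.
by case: (hf x hx).
Qed.

Lemma derive_itvW f df u v : (forall x, x \in `[u, v] -> is_derive x 1 f (df x)) ->
  forall x, x \in `]u, v[ -> is_derive x 1 f (df x).
Proof. by move=> hf x hx; apply: hf; apply: subset_itv_oo_cc. Qed.

Lemma le_derive f df u v : u <= v ->
  (forall x, x \in `[u, v] -> is_derive x 1 f (df x)) ->
  (forall x, x \in `[u, v] -> 0 <= df x) -> f u <= f v.
Proof.
move=> uv hf h0.
have [c hc e] := MVT_segment uv (derive_itvW hf) (derive_within hf).
by rewrite -subr_ge0 e mulr_ge0 ?h0 // subr_ge0.
Qed.

(** The Taylor estimates below for the sine, the cosine and the exponential rest on it, with
    [g] the bound on the remainder. *)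
Lemma cmp_derive f df g dg u v : u <= v ->
  (forall x, x \in `[u, v] -> is_derive x 1 f (df x)) ->
  (forall x, x \in `[u, v] -> is_derive x 1 g (dg x)) ->
  (forall x, x \in `[u, v] -> `|df x| <= dg x) -> `|f v - f u| <= g v - g u.
Proof.
move=> uv hf hg h.
have h1 : (g - f) u <= (g - f) v.
  apply: (@le_derive (g - f) (dg - df)) => // x hx.
    by have := hf x hx; have := hg x hx => ? ?; apply: is_deriveB.
  by have := h x hx; rewrite ler_norml !fctE => /andP[]; lra.
have h2 : (g + f) u <= (g + f) v.
  apply: (@le_derive (g + f) (dg + df)) => // x hx.
    by have := hf x hx; have := hg x hx => ? ?; apply: is_deriveD.
  by have := h x hx; rewrite ler_norml !fctE => /andP[]; lra.
move: h1 h2; rewrite !fctE => h1 h2.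
by rewrite ler_norml; apply/andP; split; lra.
Qed.

(** Gives the derivative of an integral depending on a parameter from a bound on the
    second-order remainder, without exchanging a limit and an integral. *)
Lemma is_derive_quad f a l K : (forall h, `|f (a + h) - f a - h * l| <= K * h ^+ 2) ->
  is_derive a 1 f l.
Proof.
move=> hK.
suff c : (fun h => h^-1 *: ((f \o shift a) (h *: (1 : R)) - f a)) h @[h --> 0^'] --> l.
  apply: DeriveDef; first by apply/cvg_ex; exists l.
  by apply/cvg_lim.
have K0 : 0 <= K by have := hK 1; rewrite expr1n mulr1; apply: le_trans.
apply/cvgrPdist_le => e e0; near=> h.
have h0 : h != 0 by near: h; exact: nbhs_dnbhs_neq.
rewrite /= scaler1 (addrC h a) /GRing.scale /=.
have -> : l - h^-1 * (f (a + h) - f a) = - (h^-1 * (f (a + h) - f a - h * l)).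
  by field.
rewrite normrN normrM normfV ler_pdivrMl ?normr_gt0 //.
apply: le_trans (hK h) _.
rewrite -(real_normK (num_real h)) expr2 mulrCA ler_wpM2l //.
have : `|h| <= e / (K + 1).
  by near: h; apply: dnbhs0_le; rewrite divr_gt0 // ltr_wpDl.
rewrite ler_pdivlMr ?ltr_wpDl // => hh.
by apply: le_trans hh; rewrite mulrC ler_wpM2l // lerDl.
Unshelve. all: by end_near. Qed.

Lemma cos_quad x y : `|cos (x + y) - cos x + y * sin x| <= y ^+ 2.
Proof.
wlog y0 : x y / 0 <= y.
  move=> hw; have [|yn] := leP 0 y; first exact: hw.
  have := hw (- x) (- y); rewrite -opprD !cosN sinN mulrNN sqrrN; apply.
  by rewrite oppr_ge0 ltW.
have sin_lip z : 0 <= z -> `|sin (x + z) - sin x| <= z.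
  move=> z0; have := @cmp_derive (fun t => sin (x + t)) (fun t => cos (x + t)) id (cst 1) 0 z z0.
  rewrite addr0 subr0; apply => [t _|t _].
  - by apply: is_derive_eq; rewrite /GRing.scale /= ?mulr1; ring.
  - by rewrite ler_norml cos_geN1 cos_le1.
have := @cmp_derive (fun t => cos (x + t) + t * sin x) (fun t => sin x - sin (x + t))
   (fun t => t ^+ 2) (fun t => 2 * t) 0 y y0.
rewrite addr0 mul0r addr0 expr0n /= subr0 (_ : _ - cos x = cos (x + y) - cos x + y * sin x); last by ring.
apply => [t _|t _|t].
- by apply: is_derive_eq; rewrite /GRing.scale /=; ring.
- by apply: is_derive_eq; rewrite /GRing.scale /=; ring.
- rewrite in_itv /= => /andP[t0 _]; rewrite distrC; apply: le_trans (sin_lip t t0) _; lra.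
Qed.

End Calculus.

Section ImproperIntegral.
Context (R : realType).
Implicit Types (f g h Phi : R -> R) (u v w x y K : R).

(** Integral over the line, presented by a primitive with limits at both ends. The
    comparison with Riemann sums works with the primitive, and linearity, monotonicity and
    integration by parts are immediate. *)
Definition has_int g v := exists Phi (a b : R),
  [/\ forall x, is_derive x 1 Phi (g x), Phi x @[x --> +oo] --> a,
      Phi x @[x --> -oo] --> b & v = a - b].

Lemma cvg_cstM (T : Type) (F : set_system T) {FF : Filter F} (k a : R) (f : T -> R) :
  f x @[x --> F] --> a -> k * f x @[x --> F] --> k * a.
Proof. by move=> fa; apply: cvgM => //; exact: cvg_cst. Qed.

Lemma has_intD g h v w : has_int g v -> has_int h w -> has_int (fun x => g x + h x) (v + w).
Proof.
move=> [P [a [b [h1 h2 h3 ->]]]] [P' [a' [b' [h1' h2' h3' ->]]]].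
exists (fun x => P x + P' x), (a + a'), (b + b'); split.
- by move=> x; have := h1 x; have := h1' x => ? ?; apply: is_deriveD.
- exact: cvgD.
- exact: cvgD.
- by ring.
Qed.

Lemma has_intZ k g v : has_int g v -> has_int (fun x => k * g x) (k * v).
Proof.
move=> [P [a [b [h1 h2 h3 ->]]]].
exists (fun x => k * P x), (k * a), (k * b); split.
- by move=> x; have := h1 x => ?; apply: is_derive_eq.
- exact: cvg_cstM.
- exact: cvg_cstM.
- by ring.
Qed.

Lemma has_int_eq g h v w : g =1 h -> v = w -> has_int g v -> has_int h w.
Proof. by move=> /funext -> ->. Qed.

Lemma has_int_ge0 g v : has_int g v -> (forall x, 0 <= g x) -> 0 <= v.
Proof.
move=> [P [a [b [h1 h2 h3 ->]]]] g0.
have mono x y : x <= y -> P x <= P y.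
  by move=> xy; apply: (@le_derive _ P g).
rewrite subr_ge0; apply: (@le_trans _ _ (P 0)).
  apply: (cvgr_to_le h3); near=> x; apply: mono.
  by near: x; apply: nbhs_ninfty_le.
apply: (cvgr_to_ge h2); near=> x; apply: mono.
by near: x; apply: nbhs_pinfty_ge.
Unshelve. all: by end_near. Qed.

Lemma has_int_le g h v w : has_int g v -> has_int h w -> (forall x, `|g x| <= h x) ->
  `|v| <= w.
Proof.
move=> hg hh gh.
have h1 : 0 <= w + v.
  apply: (has_int_ge0 (has_intD hh hg)) => x.
  by have := gh x; rewrite ler_norml => /andP[]; lra.
have h2 : 0 <= w + -1 * v.
  apply: (has_int_ge0 (has_intD hh (has_intZ (-1) hg))) => x.
  by have := gh x; rewrite ler_norml => /andP[]; lra.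
by rewrite ler_norml; apply/andP; split; lra.
Qed.

Lemma has_int_unique g v w : has_int g v -> has_int g w -> v = w.
Proof.
move=> h1 h2; apply/eqP; rewrite -subr_eq0 -normr_le0.
have h0 : has_int (fun=> 0) 0.
  exists (cst 0), 0, 0; split; [|exact: cvg_cst|exact: cvg_cst|by rewrite subr0].
  by move=> x; apply: is_derive_cst.
apply: (has_int_le _ h0 (g := fun=> 0)); last by move=> x; rewrite normr0.
apply: has_int_eq (has_intD h1 (has_intZ (-1) h2)) => [x|]; by ring.
Qed.

Lemma has_int_scale s g v : 0 < s -> has_int g v -> has_int (fun x => g (s * x)) (v / s).
Proof.
move=> s0 [P [a [b [h1 h2 h3 ->]]]].
exists (fun x => s^-1 * P (s * x)), (s^-1 * a), (s^-1 * b); split.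
- move=> x; have := h1 (s * x) => ?.
  have : is_derive x 1 (P \o (fun x => s * x)) (g (s * x) *: s).
    by apply: is_derive1_comp; apply: is_derive_eq; rewrite /GRing.scale /=; ring.
  move=> ?; apply: is_derive_eq.
  by rewrite /GRing.scale /=; field; rewrite gt_eqF.
- by apply: cvg_cstM; apply: cvg_comp h2; apply: gt0_cvgMry.
- apply: cvg_cstM; apply: cvg_comp h3; exact: gt0_cvgMrNy.
- by field; rewrite gt_eqF.
Qed.

Lemma atan_bounds x : `|atan x| <= 2.
Proof.
have := atan_ltpi2 x; have := atan_gtNpi2 x; have := pihalf_lt2 R.
by rewrite ler_norml => ? ? ?; apply/andP; split; lra.
Qed.

Lemma dominated_primitive_le g Phi K u v : (forall x, is_derive x 1 Phi (g x)) ->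
  (forall x, `|g x| <= K / (1 + x ^+ 2)) -> u <= v ->
  `|Phi v - Phi u| <= K * (atan v - atan u).
Proof.
move=> dP gK uv; rewrite mulrBr.
by apply: (@cmp_derive _ Phi g (fun x => K * atan x) (fun x => K / (1 + x ^+ 2))).
Qed.

Lemma dominated_primitive_tail g Phi K u v : (forall x, is_derive x 1 Phi (g x)) ->
  (forall x, `|g x| <= K / (1 + x ^+ 2)) -> 0 < u -> u <= v ->
  `|Phi v - Phi u| <= K / u.
Proof.
move=> dP gK u0 uv.
have K0 : 0 <= K by have := gK 0; rewrite expr0n addr0 divr1; apply: le_trans.
have := @cmp_derive _ Phi g (fun x => - K * x^-1) (fun x => K / x ^+ 2) u v uv.
move=> /(_ (fun x _ => dP x)) h.
apply: le_trans (h _ _) _.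
- move=> x; rewrite in_itv /= => /andP[ux _].
  have x0 : x != 0 by rewrite gt_eqF // (lt_le_trans u0).
  have ? := is_deriveV x0 (is_derive_id x (1:R)).
  by apply: is_derive_eq; rewrite /GRing.scale /=; field.
- move=> x; rewrite in_itv /= => /andP[ux _].
  have x0 : 0 < x by rewrite (lt_le_trans u0).
  apply: le_trans (gK x) _; rewrite ler_wpM2l // lef_pV2 ?posrE ?exprn_gt0 //.
    by rewrite lerDr.
  by rewrite ltr_wpDr // sqr_ge0.
- have : 0 <= K / v by rewrite divr_ge0 // ltW // (lt_le_trans u0).
  by rewrite !mulNr opprK; lra.
Qed.

(** The primitive plus [K * atan] is nondecreasing and bounded, hence has a limit; so has
    the primitive. *)
Lemma dominated_has_int g K : (forall x, `|g x| <= K / (1 + x ^+ 2)) ->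
  (exists Phi, forall x, is_derive x 1 Phi (g x)) -> exists v, has_int g v.
Proof.
move=> gK [P dP].
have K0 : 0 <= K by have := gK 0; rewrite expr0n addr0 divr1; apply: le_trans.
have half (Q q : R -> R) : (forall x, is_derive x 1 Q (q x)) ->
    (forall x, `|q x| <= K / (1 + x ^+ 2)) -> exists a : R, Q x @[x --> +oo] --> a.
  move=> dQ qK.
  have nd : nondecreasing_fun (fun x => Q x + K * atan x).
    move=> x y xy; have := dominated_primitive_le dQ qK xy.
    by rewrite ler_norml => /andP[]; lra.
  have ub : has_ubound (range (fun x => Q x + K * atan x)).
    exists (Q 0 + K * 4 + K * 2) => _ [x _ <-].
    have a1 := atan_bounds x; have := dominated_primitive_le dQ qK (lexx 0).
    have hK : K * atan x <= K * 2 by rewrite ler_wpM2l //; move: a1; rewrite ler_norml => /andP[].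
    have [x0|x0] := leP 0 x.
      have := dominated_primitive_le dQ qK x0; rewrite ler_norml => /andP[_].
      by rewrite atan0 subr0; lra.
    have := dominated_primitive_le dQ qK (ltW x0); rewrite ler_norml => /andP[+ _].
    rewrite atan0 sub0r => h.
    have : K * - atan x <= K * 2 by rewrite ler_wpM2l //; move: a1; rewrite ler_norml => /andP[]; lra.
    lra.
  have c1 := nondecreasing_cvgr nd ub.
  move: c1; set S := sup _ => c1; exists (S - K * (pi / 2)); clearbody S.
  have -> : Q = (fun x => (Q x + K * atan x) - K * atan x) by apply/funext => x; rewrite addrK.
  apply: cvgB; first exact: c1.
  by apply: cvg_cstM; apply: cvgy_atan.
have [a ha] := half P g dP gK.
have [b hb] : exists b : R, - P (- x) @[x --> +oo] --> b.
  apply: (half (fun x => - P (- x)) (fun x => g (- x))) => x; last by have := gK (- x); rewrite sqrrN.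
  have := dP (- x) => ?.
  have : is_derive x 1 (P \o -%R) (g (- x) *: - 1).
    by apply: is_derive1_comp.
  by move=> ?; apply: is_derive_eq; rewrite /GRing.scale /=; ring.
exists (a - - b), P, a, (- b); split => //.
have : P (- x) @[x --> +oo] --> - b.
  have -> : (fun x => P (- x)) = (fun x => - - P (- x)) by apply/funext => x; rewrite opprK.
  exact: cvgN hb.
by move=> h; apply/cvgNy_compNP.
Unshelve. all: by end_near. Qed.

End ImproperIntegral.

(** * The Fourier transform of a Gaussian on the line *)

Section GaussianIntegral.
Context (R : realType).
Implicit Types (x u v K b c alpha beta : R).

(** The phase [c] makes one function cover the cosine and the sine transform, and the phases
    left by completing the square in one coordinate. *)
Definition wave alpha beta c u := expR (- (alpha * u ^+ 2)) * cos (beta * u + c).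

Lemma gauss_decay alpha u : 0 < alpha ->
  expR (- (alpha * u ^+ 2)) * (1 + u ^+ 2) ^+ 2 <= 2 + 4 / alpha ^+ 2.
Proof.
move=> a0; rewrite expRN mulrC ler_pdivrMr ?expR_gt0 //.
have au0 : 0 <= alpha * u ^+ 2 by rewrite mulr_ge0 ?sqr_ge0 // ltW.
have := expR_ge1Dxn 1 au0.
rewrite (_ : (2`!)%:R = 2) // => h.
have b0 : 0 <= 2 + 4 / alpha ^+ 2 by rewrite addr_ge0 // divr_ge0 // sqr_ge0.
apply: le_trans (ler_wpM2l b0 h).
have -> : (2 + 4 / alpha ^+ 2) * (1 + (alpha * u ^+ 2) ^+ 2 / 2) =
  2 + 4 / alpha ^+ 2 + alpha ^+ 2 * u ^+ 4 + 2 * u ^+ 4.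
  by field; rewrite gt_eqF.
have h1 : 0 <= 4 / alpha ^+ 2 by rewrite divr_ge0 // sqr_ge0.
have h2 : 0 <= alpha ^+ 2 * u ^+ 4 by rewrite mulr_ge0 // ?sqr_ge0 // -[4%N]/(2 * 2)%N exprM sqr_ge0.
have h3 : 0 <= (u ^+ 2 - 1) ^+ 2 by rewrite sqr_ge0.
nra.
Qed.

(** One constant for which [K / (1 + u ^+ 2)], with primitive [K * atan], dominates both
    [wave] and its derivative. *)
Definition wave_bound alpha beta := (1 + 2 * alpha + `|beta|) * (2 + 4 / alpha ^+ 2).

Lemma wave_bound_ge0 alpha beta : 0 < alpha -> 0 <= wave_bound alpha beta.
Proof.
move=> a0; rewrite mulr_ge0 // !addr_ge0 //; first by rewrite mulr_ge0 // ltW.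
by rewrite divr_ge0 // sqr_ge0.
Qed.

Lemma expR_dom alpha beta (P : R) u : 0 < alpha ->
  `|P| <= (1 + 2 * alpha + `|beta|) * (1 + u ^+ 2) ->
  `|expR (- (alpha * u ^+ 2)) * P| <= wave_bound alpha beta / (1 + u ^+ 2).
Proof.
move=> a0 hP; have u1 : 0 < 1 + u ^+ 2 by rewrite ltr_wpDr // sqr_ge0.
rewrite ler_pdivlMr // normrM (ger0_norm (expR_ge0 _)).
have := gauss_decay u a0; set E := expR _ => hE.
have E0 : 0 <= E by apply: expR_ge0.
apply: (@le_trans _ _ (E * ((1 + 2 * alpha + `|beta|) * (1 + u ^+ 2)) * (1 + u ^+ 2))).
  by rewrite ler_pM2r // ler_wpM2l.
rewrite /wave_bound.
have k0 : 0 <= 1 + 2 * alpha + `|beta| by rewrite !addr_ge0 // mulr_ge0 // ltW.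
rewrite (_ : _ * _ * _ = (1 + 2 * alpha + `|beta|) * (E * (1 + u ^+ 2) ^+ 2)); last by ring.
by rewrite ler_wpM2l.
Qed.

Lemma cos_le1n x : `|cos x| <= 1. Proof. by rewrite ler_norml cos_geN1 cos_le1. Qed.
Lemma sin_le1n x : `|sin x| <= 1. Proof. by rewrite ler_norml sin_geN1 sin_le1. Qed.

Lemma wave_dom alpha beta c u : 0 < alpha ->
  `|wave alpha beta c u| <= wave_bound alpha beta / (1 + u ^+ 2).
Proof.
move=> a0; apply: expR_dom => //; apply: le_trans (cos_le1n _) _.
have := sqr_ge0 u; have := normr_ge0 beta; nra.
Qed.

Definition dwave alpha beta c u := expR (- (alpha * u ^+ 2)) *
  (- (2 * alpha * u) * cos (beta * u + c) - beta * sin (beta * u + c)).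

Lemma is_derive_gauss alpha x :
  is_derive x 1 (fun u => expR (- (alpha * u ^+ 2))) (expR (- (alpha * x ^+ 2)) * - (2 * alpha * x)).
Proof.
have h : is_derive x 1 (fun u => - (alpha * u ^+ 2)) (- (2 * alpha * x)).
  by apply: is_derive_eq; rewrite /GRing.scale /=; ring.
exact: (is_derive1_comp (is_derive_expR _) h).
Qed.

Lemma is_derive_cosl beta c x :
  is_derive x 1 (fun u => cos (beta * u + c)) (- sin (beta * x + c) * beta).
Proof.
have h : is_derive x 1 (fun u => beta * u + c) beta.
  by apply: is_derive_eq; rewrite /GRing.scale /=; ring.
exact: (is_derive1_comp (is_derive_cos _) h).
Qed.

Lemma is_derive_sinl beta c x :
  is_derive x 1 (fun u => sin (beta * u + c)) (cos (beta * x + c) * beta).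
Proof.
have h : is_derive x 1 (fun u => beta * u + c) beta.
  by apply: is_derive_eq; rewrite /GRing.scale /=; ring.
exact: (is_derive1_comp (is_derive_sin _) h).
Qed.

Lemma is_derive_wave alpha beta c x : is_derive x 1 (wave alpha beta c) (dwave alpha beta c x).
Proof.
have h1 := is_derive_gauss alpha x; have h2 := is_derive_cosl beta c x.
apply: (is_derive_eq (is_deriveM h1 h2)).
by rewrite /dwave /GRing.scale /=; ring.
Qed.

Lemma dwave_dom alpha beta c u : 0 < alpha ->
  `|dwave alpha beta c u| <= wave_bound alpha beta / (1 + u ^+ 2).
Proof.
move=> a0; apply: expR_dom => //; apply: le_trans (ler_normB _ _) _.
rewrite !normrM normrN !normrM (ger0_norm (ltW a0)) (@ger0_norm _ 2) //.
have hu : `|u| <= 1 + u ^+ 2.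
  by rewrite -(real_normK (num_real u)); have := sqr_ge0 (`|u| - 1); nra.
apply: (@le_trans _ _ (2 * alpha * `|u| + `|beta|)).
  apply: lerD; first by rewrite -[X in _ <= X]mulr1 ler_wpM2l ?cos_le1n // !mulr_ge0 // ltW.
  by rewrite -[X in _ <= X]mulr1 ler_wpM2l ?sin_le1n.
have := sqr_ge0 u; have := normr_ge0 beta => h1 h2.
have : 0 <= alpha * (1 + u ^+ 2 - `|u|) by rewrite mulr_ge0 ?subr_ge0 // ltW.
have : 0 <= `|beta| * u ^+ 2 by rewrite mulr_ge0.
nra.
Qed.

Lemma wave_primitive beta c : exists Phi, forall x, is_derive x 1 Phi (wave 1 beta c x).
Proof.
have cw : continuous (wave 1 beta c : R -> R).
  move=> x; apply: differentiable_continuous; apply/derivable1_diffP.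
  by have [] := is_derive_wave 1 beta c x.
have intw : lebesgue_measure.-integrable [set: R] (EFin \o wave 1 beta c).
  apply: (le_integrable measurableT _ _ integrableT_gauss).
    by apply/measurable_EFinP; apply: continuous_measurable_fun.
  move=> x _ /=; rewrite lee_fin /wave mul1r normrM /gauss_fun.
  by rewrite -[X in _ <= X]mulr1 ler_wpM2l ?cos_le1n.
exists (fun x => \int[lebesgue_measure]_(t in `]-oo, x]) wave 1 beta c t) => x.
have iu : lebesgue_measure.-integrable [set` `]-oo, (x + 1)%R]] (EFin \o wave 1 beta c).
  by apply: integrableS intw.
have x1 : x < x + 1 by rewrite ltrDl.
have [h1 h2] := @continuous_FTC1 _ _ -oo%O x (x + 1) x1 iu (ltNyr _) (cw x).
by apply: (DeriveDef h1); rewrite -derive1E.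
Qed.

(** The half-line integral determines one limit of the primitive [Q], and the symmetry of
    [Q] about its value at 0 the other. *)
Lemma has_int_gauss : has_int (wave 1 0 0) (Num.sqrt pi : R).
Proof.
have [P dP] := wave_primitive 0 0.
have dP' x : is_derive x 1 P (gauss_fun x).
  by have := dP x; rewrite /wave mul0r add0r cos0 mulr1 mul1r.
have [v hv] := dominated_has_int (fun u => wave_dom 0 0 u ltr01) (ex_intro _ P dP).
apply: has_int_eq (hv) => //.
have [Q [a [b [h1 h2 h3 e]]]] := hv.
have h1' x : is_derive x 1 Q (gauss_fun x).
  by have := h1 x; rewrite /wave mul0r add0r cos0 mulr1 mul1r.
have cQ : continuous Q.
  move=> x; apply: differentiable_continuous; apply/derivable1_diffP.
  by have [] := h1 x.
have e1 : a - Q 0 = Num.sqrt pi / 2.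
  have := @ge0_continuous_FTC2y R gauss_fun Q 0 a.
  rewrite integral0y_gauss -EFinD => h; apply/esym; apply: EFin_inj; apply: h.
  - by move=> x _; apply: gauss_fun_ge0.
  - by apply: continuous_subspaceT; apply: continuous_gauss_fun.
  - by [].
  - by move=> x _; have [] := h1 x.
  - by apply: cvg_at_right_filter; apply: cQ.
  - by move=> x _; rewrite derive1E; case: (h1' x).
have symQ x : Q (- x) = 2 * Q 0 - Q x.
  have d0 (y : R) : is_derive y 1 (fun t => Q (- t) + Q t) (0:R).
    have hy := h1' y; have hNy := h1' (- y).
    have hc : is_derive y 1 (Q \o -%R) (gauss_fun (- y) *: - 1) by apply: is_derive1_comp.
    apply: (is_derive_eq (is_deriveD hc hy)).
    by rewrite /GRing.scale /= /gauss_fun sqrrN; ring.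
  have := is_derive_0_is_cst x 0 d0; rewrite oppr0; lra.
have e2 : b = 2 * Q 0 - a.
  have c1 : (Q \o -%R) x @[x --> +oo] --> b by apply/cvgNy_compNP.
  have c2 : (Q \o -%R) x @[x --> +oo] --> 2 * Q 0 - a.
    have -> : Q \o -%R = (fun x => 2 * Q 0 - Q x) by apply/funext => x; exact: symQ.
    by apply: cvgB => //; exact: cvg_cst.
  exact: cvg_unique c1 c2.
rewrite e e2; lra.
Qed.

End GaussianIntegral.

Section GaussianFourier.
Context (R : realType).
Implicit Types (x u v K b c alpha beta : R).

Lemma has_int_opp (g : R -> R) v : has_int g v -> has_int (fun x => g (- x)) v.
Proof.
move=> [P [a [b [h1 h2 h3 ->]]]].
exists (fun x => - P (- x)), (- b), (- a); split.
- move=> x; have hx := h1 (- x).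
  have hc : is_derive x 1 (P \o -%R) (g (- x) *: - 1) by apply: is_derive1_comp.
  apply: (is_derive_eq (is_deriveN hc)); by rewrite /GRing.scale /=; ring.
- by apply: cvgN; apply/cvgNy_compNP.
- by apply: cvgN; apply/cvgy_compNP.
- by ring.
Qed.

(** The boundary terms of an integration by parts vanish. *)
Lemma has_int_derivative (D dD : R -> R) K : (forall x, is_derive x 1 D (dD x)) ->
  (forall x, `|D x| <= K / (1 + x ^+ 2)) -> has_int dD 0.
Proof.
move=> hD hK; exists D, 0, 0; split => //; last by rewrite subr0.
- apply/cvgrPdist_le => e e0; near=> x.
  rewrite sub0r normrN; apply: le_trans (hK x) _.
  have x0 : 1 <= x by near: x; apply: nbhs_pinfty_ge; exact: num_real.
  have xK : K / e <= x by near: x; apply: nbhs_pinfty_ge; exact: num_real.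
  rewrite ler_pdivrMr ?ltr_wpDr ?sqr_ge0 //.
  move: xK; rewrite ler_pdivrMr // => xK.
  have : 0 <= e * (1 + x * (x - 1)) by apply: mulr_ge0; [exact: ltW | nra].
  by lra.
- apply/cvgrPdist_le => e e0; near=> x.
  rewrite sub0r normrN; apply: le_trans (hK x) _.
  have x0 : x <= - 1 by near: x; apply: nbhs_ninfty_le; exact: num_real.
  have xK : x <= - (K / e) by near: x; apply: nbhs_ninfty_le; exact: num_real.
  rewrite ler_pdivrMr ?ltr_wpDr ?sqr_ge0 //.
  move: xK; rewrite lerNr ler_pdivrMr // => xK.
  have : 0 <= e * (1 + x * (x + 1)) by apply: mulr_ge0; [exact: ltW | nra].
  by lra.
Unshelve. all: by end_near. Qed.

Lemma has_int_second_moment : has_int (fun u => u ^+ 2 * expR (- (1 * u ^+ 2))) (Num.sqrt pi / 2 : R).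
Proof.
have d0 : has_int (fun u : R => expR (- (1 * u ^+ 2)) * (1 - 2 * u ^+ 2)) 0.
  apply: (@has_int_derivative (fun u => u * expR (- (1 * u ^+ 2))) _ (wave_bound 1 0)).
    move=> x; have h := is_derive_gauss 1 x.
    by apply: (is_derive_eq (is_deriveM (is_derive_id x 1) h)); rewrite /GRing.scale /=; ring.
  move=> x; rewrite mulrC; apply: expR_dom => //; rewrite normr0 addr0.
  by rewrite -(real_normK (num_real x)); have := sqr_ge0 (`|x| - 1); nra.
apply: has_int_eq (has_intZ (1 / 2) (has_intD (has_int_gauss R) (has_intZ (-1) d0))) => [x|].
  by rewrite /wave mul0r add0r cos0; field.
by field.
Qed.

Lemma has_int_sin_moment beta v : has_int (wave 1 beta 0) v ->
  has_int (fun u => u * expR (- (1 * u ^+ 2)) * sin (beta * u)) (beta / 2 * v).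
Proof.
move=> hv.
have d0 : has_int (fun u : R => expR (- (1 * u ^+ 2)) *
     (beta * cos (beta * u + 0) - 2 * u * sin (beta * u + 0))) 0.
  apply: (@has_int_derivative (fun u => expR (- (1 * u ^+ 2)) * sin (beta * u + 0)) _ (wave_bound 1 beta)).
    move=> x; have h := is_derive_gauss 1 x; have h' := is_derive_sinl beta 0 x.
    by apply: (is_derive_eq (is_deriveM h h')); rewrite /GRing.scale /=; ring.
  move=> x; apply: expR_dom => //; apply: le_trans (sin_le1n _) _.
  by have := sqr_ge0 x; have := normr_ge0 beta; nra.
apply: has_int_eq (has_intD (has_intZ (beta / 2) hv) (has_intZ (- 1 / 2) d0)) => [x|].
  by rewrite /wave addr0; field.
by ring.
Qed.

(** Euler's differential equation: the transform [I] satisfies [I' = - (beta / 2) * I]. The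
    remainder in [is_derive_quad] is a second moment, by [cos_quad]. *)
Lemma has_int_cos beta : has_int (wave 1 beta 0) (Num.sqrt pi * expR (- (beta ^+ 2 / 4))).
Proof.
have exI (b : R) : exists v : R, has_int (wave 1 b 0) v.
  by apply: dominated_has_int (fun u => wave_dom b 0 u ltr01) (wave_primitive b 0).
have [I hI] := choice exI.
have dI (b : R) : is_derive b 1 I (- (b / 2 * I b)).
  apply: (@is_derive_quad _ I b _ (Num.sqrt pi / 2)) => h.
  have hl := has_intD (has_intD (hI (b + h)) (has_intZ (-1) (hI b)))
     (has_intZ h (has_int_sin_moment (hI b))).
  have hr := has_intZ (h ^+ 2) has_int_second_moment.
  have := has_int_le hl hr; rewrite mulrN opprK mulN1r [h ^+ 2 * _]mulrC; apply => u.
  rewrite /wave !addr0 mulrDl.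
  have hc := cos_quad (b * u) (h * u); set E := expR _.
  have E0 : 0 <= E by apply: expR_ge0.
  rewrite (_ : _ + _ + _ = E * (cos (b * u + h * u) - cos (b * u) + h * u * sin (b * u))); last by ring.
  rewrite normrM (ger0_norm E0).
  rewrite (_ : h ^+ 2 * _ = E * ((h * u) ^+ 2)); last by ring.
  by rewrite ler_wpM2l.
have d0 (b : R) : is_derive b 1 (fun t => I t * expR (t ^+ 2 / 4)) (0 : R).
  have hb := dI b.
  have he : is_derive b 1 (fun t : R => expR (t ^+ 2 / 4)) (expR (b ^+ 2 / 4) *: (b / 2)).
    have h4 : is_derive b 1 (fun t : R => t ^+ 2 / 4) (b / 2).
      by apply: is_derive_eq; rewrite /GRing.scale /=; field.
    exact: (is_derive1_comp (is_derive_expR _) h4).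
  by apply: (is_derive_eq (is_deriveM hb he)); rewrite /GRing.scale /=; ring.
have := is_derive_0_is_cst beta 0 d0.
rewrite expr0n mul0r expR0 mulr1 => e.
have I0 : I 0 = Num.sqrt pi.
  exact: has_int_unique (hI 0) (has_int_gauss R).
rewrite -I0 -e expRN -mulrA divff ?mulr1 ?gt_eqF ?expR_gt0 //.
Qed.

Lemma has_int_odd_wave beta : has_int (wave 1 beta (- (pi / 2))) (0 : R).
Proof.
have [v hv] := dominated_has_int (fun u => wave_dom beta (- (pi / 2)) u ltr01) (wave_primitive beta (- (pi / 2))).
have hN : has_int (wave 1 beta (- (pi / 2))) (- v).
  apply: has_int_eq (has_intZ (-1) (has_int_opp hv)) => [x|]; last by ring.
  rewrite /wave !cosBpihalf sqrrN mulrN sinN; by ring.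
by have e := has_int_unique hv hN; have <- : v = 0 by lra.
Qed.

Definition wave_value alpha beta := Num.sqrt (pi / alpha) * expR (- (beta ^+ 2 / (4 * alpha))).

Lemma has_int_wave alpha beta c : 0 < alpha ->
  has_int (wave alpha beta c) (cos c * wave_value alpha beta).
Proof.
move=> a0; set s := Num.sqrt alpha.
have s0 : 0 < s by rewrite sqrtr_gt0.
have s2 : s ^+ 2 = alpha by rewrite sqr_sqrtr // ltW.
have h1 := has_int_scale s0 (has_int_cos (beta / s)).
have h2 := has_int_scale s0 (has_int_odd_wave (beta / s)).
apply: has_int_eq (has_intD (has_intZ (cos c) h1) (has_intZ (- sin c) h2)) => [x|].
  have bs : beta / s * (s * x) = beta * x by field; rewrite gt_eqF.
  rewrite /wave exprMn s2 !mul1r addr0 cosBpihalf bs cosD; by ring.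
rewrite mul0r mulr0 addr0 /wave_value; congr (_ * _).
rewrite sqrtrM ?pi_ge0 // sqrtrV ?ltW // -/s mulrAC; congr (_ * expR (- _)).
by rewrite -s2; field; rewrite gt_eqF.
Qed.

End GaussianFourier.

(** * Riemann sums over the line *)

Section RiemannSum.
Context (R : realType) (g dg : R -> R) (K : R).
Hypothesis g_derive : forall x : R, is_derive x 1 g (dg x).
Hypothesis g_dom : forall x, `|g x| <= K / (1 + x ^+ 2).
Hypothesis dg_dom : forall x, `|dg x| <= K / (1 + x ^+ 2).

Let K_ge0 : 0 <= K.
Proof. by have := g_dom 0; rewrite expr0n addr0 divr1; apply: le_trans. Qed.

(** Weighting by [1 / (1 + u ^+ 2)] bounds the error of a step by an increment of the
    arctangent, so that the errors of any number of steps telescope to [O(h)]. *)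
Lemma riemann_step (Phi : R -> R) u h : (forall x : R, is_derive x 1 Phi (g x)) ->
  0 <= h -> h <= 1 ->
  `|h * g u - (Phi (u + h) - Phi u)| <= 3 * K * h * (atan (u + h) - atan u).
Proof.
move=> dP h0 h1; have uh : u <= u + h by rewrite lerDl.
have [xi /andP[]] := MVT_segment uh (fun x _ => dP x) (derive_within (fun x _ => dP x)).
rewrite !bnd_simp => x1 x2 ->.
have [zeta /andP[]] := MVT_segment x1 (fun x _ => g_derive x) (derive_within (fun x _ => g_derive x)).
rewrite !bnd_simp => z1 z2 e.
have [om /andP[]] := MVT_segment uh (fun x _ => is_derive1_atan x) (derive_within (fun x _ => is_derive1_atan x)).
rewrite !bnd_simp => o1 o2 ->.
have -> : h * g u - g xi * (u + h - u) = - (h * (g xi - g u)) by ring.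
rewrite e normrN !normrM (ger0_norm h0) (@ger0_norm _ (xi - u)); last by rewrite subr_ge0.
have -> : u + h - u = h by ring.
have z0 : 0 < 1 + zeta ^+ 2 by rewrite ltr_wpDr // sqr_ge0.
have o0 : 0 < 1 + om ^+ 2 by rewrite ltr_wpDr // sqr_ge0.
(* The mean value points [zeta] and [om] are within 1 of each other, so the weights there
   differ by a factor at most 3. *)
have key : K / (1 + zeta ^+ 2) <= 3 * K / (1 + om ^+ 2).
  rewrite ler_pdivrMr // mulrAC ler_pdivlMr // [3 * K]mulrC -!mulrA ler_wpM2l //.
  have d1 : `|om - zeta| <= 1 by rewrite ler_norml; apply/andP; split; lra.
  have : (om - zeta) ^+ 2 <= 1 by rewrite -(real_normK (num_real _)) expr_le1.
  have := sqr_ge0 (om - 2 * zeta); nra.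
rewrite (_ : 3 * K * h * _ = h * (3 * K / (1 + om ^+ 2) * h)); last by ring.
rewrite ler_wpM2l // ler_pM ?subr_ge0 //.
  by apply: le_trans (dg_dom _) key.
lra.
Qed.

Lemma riemann_steps (Phi : R -> R) u h n : (forall x : R, is_derive x 1 Phi (g x)) ->
  0 <= h -> h <= 1 ->
  `|h * (\sum_(i < n) g (u + i%:R * h)) - (Phi (u + n%:R * h) - Phi u)| <=
     3 * K * h * (atan (u + n%:R * h) - atan u).
Proof.
move=> dP h0 h1; elim: n => [|n IH].
  by rewrite big_ord0 mul0r addr0 !subrr mulr0 subr0 normr0 mulr0.
rewrite big_ord_recr /= mulrDr.
have e : u + n.+1%:R * h = (u + n%:R * h) + h by rewrite -natr1; ring.
have := riemann_step (u + n%:R * h) dP h0 h1; rewrite -e => st.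
set A := _ + _ - _.
have -> : A = h * (\sum_(i < n) g (u + i%:R * h)) - (Phi (u + n%:R * h) - Phi u)
   + (h * g (u + n%:R * h) - (Phi (u + n.+1%:R * h) - Phi (u + n%:R * h))).
  by rewrite /A; ring.
apply: le_trans (ler_normD _ _) _; apply: le_trans (lerD IH st) _.
by rewrite -mulrDr ler_wpM2l ?mulr_ge0 //; lra.
Qed.

Lemma primitive_tail (q Phi : R -> R) a u : (forall x : R, is_derive x 1 Phi (q x)) ->
  (forall x, `|q x| <= K / (1 + x ^+ 2)) ->
  Phi x @[x --> +oo] --> (a : R) -> 0 < u -> `|a - Phi u| <= K / u.
Proof.
move=> dP qK Pa u0.
have c : `|Phi x - Phi u| @[x --> +oo] --> `|a - Phi u|.
  by apply: cvg_norm; apply: cvgB => //; exact: cvg_cst.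
apply: (cvgr_to_le c); near=> x; apply: dominated_primitive_tail => //.
Unshelve. all: by end_near. Qed.

Lemma primitive_var (Phi : R -> R) u w : (forall x : R, is_derive x 1 Phi (g x)) ->
  `|Phi w - Phi u| <= 4 * K.
Proof.
move=> dP; wlog uw : u w / u <= w.
  by move=> hw; have [/hw//|/ltW/hw] := leP u w; rewrite distrC.
apply: le_trans (dominated_primitive_le dP g_dom uw) _.
rewrite mulrC ler_wpM2r //; have := atan_bounds u; have := atan_bounds w.
by rewrite !ler_norml => /andP[_ ?] /andP[? _]; lra.
Qed.

(** The error is linear in the shift [s], so that it can be summed against a Gaussian
    weight. If [`|s|] is at most [N / 2], the missing tails start beyond [N / 2]; otherwise
    the right-hand side already exceeds the trivial bound on both terms. *)
Lemma riemann_line v s (N : nat) : has_int g v -> (0 < N)%N ->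
  `|N%:R^-1 * (\sum_(i < (2 * N ^ 2).+1) g ((i%:R - (N ^ 2)%:R) / N%:R + s)) - v|
    <= 48 * K * (1 + `|s|) / N%:R.
Proof.
move=> [Phi [a [b [dP h2 h3 ->]]]] N0.
have NR : 0 < N%:R :> R by rewrite ltr0n.
have N1 : 1 <= N%:R :> R by rewrite ler1n.
set h := N%:R^-1; have h0 : 0 < h by rewrite invr_gt0.
have h1 : h <= 1 by rewrite invf_le1.
have hN : h * N%:R = 1 by rewrite mulVf // gt_eqF.
set u := - N%:R + s; set e := u + (2 * N ^ 2).+1%:R * h.
have eE : e = N%:R + h + s.
  rewrite /e /u -natr1 natrM natrX (_ : (_ + 1) * h = 2 * N%:R * (h * N%:R) + h); last by ring.
  by rewrite hN; ring.
have -> : \sum_(i < (2 * N ^ 2).+1) g ((i%:R - (N ^ 2)%:R) * h + s) =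
     \sum_(i < (2 * N ^ 2).+1) g (u + i%:R * h).
  apply: eq_bigr => i _; congr g.
  rewrite natrX (_ : _ + s = i%:R * h - N%:R * (h * N%:R) + s); last by ring.
  by rewrite hN /u; ring.
have st := riemann_steps u (2 * N ^ 2).+1 dP (ltW h0) h1.
rewrite -/e in st.
have {}st : `|h * (\sum_(i < (2 * N ^ 2).+1) g (u + i%:R * h)) - (Phi e - Phi u)| <= 12 * K * h.
  apply: le_trans st _; rewrite (_ : 12 * K * h = 3 * K * h * 4); last by ring.
  apply: ler_wpM2l; first by rewrite !mulr_ge0 // ltW.
  have := atan_bounds u; have := atan_bounds e.
  by rewrite !ler_norml => /andP[_ ?] /andP[? _]; lra.
set S := h * _ in st *.
have Ka w : 0 < w -> `|a - Phi w| <= K / w by move=> w0; exact: (primitive_tail dP g_dom h2).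
have Kb w : 0 < w -> `|b - Phi (- w)| <= K / w.
  move=> w0; rewrite -normrN opprB addrC.
  have d' (x : R) : is_derive x 1 (fun x => - Phi (- x)) (g (- x)).
    have hx := dP (- x).
    have hc : is_derive x 1 (Phi \o -%R) (g (- x) *: - 1) by apply: is_derive1_comp.
    by apply: (is_derive_eq (is_deriveN hc)); rewrite /GRing.scale /=; ring.
  have := @primitive_tail (fun x => g (- x)) (fun x => - Phi (- x)) (- b) w d'.
  rewrite opprK; apply => //.
    by move=> x; have := g_dom (- x); rewrite sqrrN.
  by apply: cvgN; apply/cvgNy_compNP.
have K48 : 0 <= 48 * K by rewrite mulr_ge0.
have [sN|sN] := leP `|s| (N%:R / 2).
  have /andP[s1 s2] : (- (N%:R / 2) <= s <= N%:R / 2) by rewrite -ler_norml.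
  have e0 : N%:R / 2 <= e by rewrite eE; lra.
  have u0 : N%:R / 2 <= - u by rewrite /u; lra.
  have Kh w : N%:R / 2 <= w -> K / w <= 2 * K * h.
    move=> hw; rewrite (_ : 2 * K * h = K * (N%:R / 2)^-1); last by rewrite /h; field; rewrite gt_eqF.
    by rewrite ler_wpM2l // lef_pV2 ?posrE //; lra.
  have t1 := le_trans (Ka e ltac:(lra)) (Kh _ e0).
  have t2 := le_trans (Kb (- u) ltac:(lra)) (Kh _ u0).
  rewrite opprK in t2.
  have -> : S - (a - b) = (S - (Phi e - Phi u)) + (b - Phi u) - (a - Phi e) by ring.
  apply: le_trans (ler_normB _ _) _; apply: le_trans (lerD (ler_normD _ _) (lexx _)) _.
  apply: (@le_trans _ _ (16 * K * h)); first by lra.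
  apply: ler_wpM2r; first exact: ltW.
  apply: (@le_trans _ _ (48 * K)); first by rewrite ler_wpM2r // ler_nat.
  by rewrite ler_peMr // lerDl.
have va : `|a - Phi 0| <= 4 * K.
  have c : `|Phi x - Phi 0| @[x --> +oo] --> `|a - Phi 0|.
    by apply: cvg_norm; apply: cvgB => //; exact: cvg_cst.
  by apply: (cvgr_to_le c); apply: nearW => x; apply: primitive_var.
have vb : `|b - Phi 0| <= 4 * K.
  have c : `|Phi x - Phi 0| @[x --> -oo] --> `|b - Phi 0|.
    by apply: cvg_norm; apply: cvgB => //; exact: cvg_cst.
  by apply: (cvgr_to_le c); apply: nearW => x; apply: primitive_var.
have ve := primitive_var u e dP.
have -> : S - (a - b) = (S - (Phi e - Phi u)) + (Phi e - Phi u) - (a - Phi 0) + (b - Phi 0) by ring.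
have Kh12 : 12 * K * h <= 12 * K by rewrite ler_piMr // mulr_ge0.
apply: (@le_trans _ _ (24 * K)).
  apply: le_trans (ler_normD _ _) _; apply: le_trans (lerD (ler_normB _ _) (lexx _)) _.
  by have := ler_normD (S - (Phi e - Phi u)) (Phi e - Phi u); lra.
rewrite ler_pdivlMr // (_ : 48 * K * (1 + `|s|) = 24 * K * (2 * (1 + `|s|))); last by ring.
by apply: ler_wpM2l; [exact: mulr_ge0 | lra].
Unshelve. all: by end_near. Qed.

End RiemannSum.

(** * Quadratic forms and Schur complements *)

Section QuadraticForms.
Context (R : realType).

Definition dot n (x y : 'rV[R]_n) : R := (x *m y^T) 0 0.

Definition qf n (S : 'M[R]_n) (y : 'rV[R]_n) : R := dot (y *m S) y.

Definition posdef n (S : 'M[R]_n) := S^T = S /\ forall y : 'rV[R]_n, y != 0 -> 0 < qf S y.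

Lemma dotE n (x y : 'rV[R]_n) : dot x y = \sum_i x 0 i * y 0 i.
Proof. by rewrite /dot mxE; apply: eq_bigr => i _; rewrite mxE. Qed.

Lemma dotC n (x y : 'rV[R]_n) : dot x y = dot y x.
Proof. by rewrite !dotE; apply: eq_bigr => i _; rewrite mulrC. Qed.

Lemma dotDl n (x y z : 'rV[R]_n) : dot (x + y) z = dot x z + dot y z.
Proof. by rewrite /dot mulmxDl mxE. Qed.

Lemma dotDr n (x y z : 'rV[R]_n) : dot z (x + y) = dot z x + dot z y.
Proof. by rewrite dotC dotDl !(dotC z). Qed.

Lemma dotZl n k (x y : 'rV[R]_n) : dot (k *: x) y = k * dot x y.
Proof. by rewrite /dot -scalemxAl mxE. Qed.

Lemma dotZr n k (x y : 'rV[R]_n) : dot x (k *: y) = k * dot x y.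
Proof. by rewrite dotC dotZl dotC. Qed.

Lemma dot_mulmx n (x y : 'rV[R]_n) (S : 'M[R]_n) : dot (x *m S) y = dot x (y *m S^T).
Proof. by rewrite /dot trmx_mul trmxK mulmxA. Qed.

Lemma dot0l n (y : 'rV[R]_n) : dot 0 y = 0.
Proof. by rewrite /dot mul0mx mxE. Qed.

Lemma qf0 n (S : 'M[R]_n) : qf S 0 = 0.
Proof. by rewrite /qf mul0mx dot0l. Qed.

Lemma qfZ n k (S : 'M[R]_n) y : qf (k *: S) y = k * qf S y.
Proof. by rewrite /qf -scalemxAr dotZl. Qed.

Lemma posdef_ge0 n (S : 'M[R]_n) y : posdef S -> 0 <= qf S y.
Proof.
move=> [_ h]; have [->|/h/ltW//] := eqVneq y 0; by rewrite qf0.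
Qed.

Lemma posdefZ n k (S : 'M[R]_n) : 0 < k -> posdef S -> posdef (k *: S).
Proof.
move=> k0 [h1 h2]; split; first by rewrite linearZ /= h1.
by move=> y /h2 ?; rewrite qfZ mulr_gt0.
Qed.

Lemma posdef_unit n (S : 'M[R]_n) : posdef S -> S \in unitmx.
Proof.
move=> [_ h]; rewrite unitmxE unitfE; apply/negP => /det0P [v v0 vS].
by have := h v v0; rewrite /qf vS dot0l ltxx.
Qed.

Lemma qf_invE n (S : 'M[R]_n) x z : S \in unitmx -> z *m S = x ->
  qf (invmx S) x = dot z x.
Proof. by move=> uS <-; rewrite /qf mulmxK. Qed.

(** The quadratic polynomial [l |-> qf S (y - l *: (b *m invmx S))] is nonnegative at its
    minimum. *)
Lemma posdef_cauchy n (S : 'M[R]_n) (b y : 'rV[R]_n) : posdef S ->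
  dot b y ^+ 2 <= qf (invmx S) b * qf S y.
Proof.
move=> pS; have uS := posdef_unit pS; have [symS _] := pS.
pose w := b *m invmx S.
have wS : w *m S = b by rewrite mulmxKV.
have qw : qf (invmx S) b = qf S w by rewrite (qf_invE uS wS) /qf wS dotC.
have by_ : dot b y = dot (w *m S) y by rewrite wS.
have quad (l : R) : 0 <= qf S y - 2 * l * dot b y + l ^+ 2 * qf S w.
  have := posdef_ge0 (y + (- l) *: w) pS; rewrite /qf mulmxDl -scalemxAl wS.
  rewrite !dotDl !dotDr !dotZl !dotZr.
  have -> : dot (y *m S) w = dot b y by rewrite dot_mulmx symS wS dotC.
  by move=> h; apply: le_trans h _; rewrite le_eqVlt; apply/orP; left; apply/eqP; ring.
rewrite qw; have [w0|w0] := eqVneq w 0.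
  by rewrite by_ w0 mul0mx dot0l qf0 mul0r expr0n.
have q0 : 0 < qf S w by case: pS => _; apply.
have := quad (dot b y / qf S w); set t := dot b y; set q := qf S w in q0 *.
rewrite (_ : _ + _ = qf S y - t ^+ 2 / q); last by field; rewrite gt_eqF.
by rewrite subr_ge0 ler_pdivrMr // mulrC.
Qed.

Section Schur.
Context (n : nat) (S : 'M[R]_(1 + n)).
Hypothesis pS : posdef S.

Definition schur_a : R := S 0 0.
Definition schur_b : 'rV[R]_n := ursubmx S.
Definition schur_c : 'M[R]_n := drsubmx S - schur_a^-1 *: (schur_b^T *m schur_b).

Let S_block : S = block_mx (schur_a%:M) schur_b schur_b^T (drsubmx S).
Proof.
rewrite -{1}[S]submxK; congr block_mx.
  by apply/matrixP => i j; rewrite !ord1 !mxE lshift0 mulr1n.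
by have [h _] := pS; rewrite /schur_b trmx_ursub h.
Qed.

Lemma dot_row_mx m (p q : 'rV[R]_m) (y z : 'rV[R]_n) :
  dot (row_mx p y) (row_mx q z) = dot p q + dot y z.
Proof. by rewrite /dot tr_row_mx mul_row_col mxE. Qed.

Lemma dot11 (p q : 'rV[R]_1) : dot p q = p 0 0 * q 0 0.
Proof. by rewrite dotE big_ord1. Qed.

Lemma mul_row_S (t : R) (y : 'rV[R]_n) : row_mx t%:M y *m S =
  row_mx (t * schur_a + dot y schur_b)%:M (t *: schur_b + y *m drsubmx S).
Proof.
rewrite {1}S_block mul_row_block !mul_scalar_mx; congr row_mx.
apply/matrixP => i j; rewrite !ord1 [RHS]mxE mulr1n /dot mxE; congr (_ + _).
by rewrite !mxE mulr1n.
Qed.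

Lemma schur_qf0 (t : R) (y : 'rV[R]_n) :
  qf S (row_mx t%:M y) = schur_a * t ^+ 2 + 2 * t * dot schur_b y + dot (y *m drsubmx S) y.
Proof.
rewrite /qf mul_row_S dot_row_mx dot11 !mxE !mulr1n dotDl dotZl (dotC y).
by ring.
Qed.

Lemma schur_a_gt0 : 0 < schur_a.
Proof.
have [_ h] := pS; have := h (row_mx 1%:M 0); rewrite schur_qf0 expr1n !mulr1 mul0mx dot0l addr0.
rewrite [dot _ 0]dotC dot0l mulr0 addr0; apply.
apply/eqP; rewrite -(row_mx0 _ 1 1 n) => /eq_row_mx [] /matrixP /(_ 0 0).
by rewrite !mxE => /eqP; rewrite oner_eq0.
Qed.

(** Completing the square in the first coordinate. *)
Lemma schur_qf (t : R) (y : 'rV[R]_n) :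
  qf S (row_mx t%:M y) = schur_a * (t + dot schur_b y / schur_a) ^+ 2 + qf schur_c y.
Proof.
rewrite schur_qf0 /qf /schur_c mulmxBr dotDl -scaleN1r dotZl -scalemxAr dotZl.
have -> : dot (y *m (schur_b^T *m schur_b)) y = dot schur_b y ^+ 2.
  rewrite mulmxA (_ : y *m schur_b^T = (dot y schur_b)%:M) ?mul_scalar_mx ?dotZl ?(dotC y) -?expr2 //.
  by apply/matrixP => i j; rewrite !ord1 [RHS]mxE mulr1n dotC.
by field; rewrite gt_eqF // schur_a_gt0.
Qed.

Lemma schur_posdef : posdef schur_c.
Proof.
split.
  have [h _] := pS; rewrite /schur_c linearB /= linearZ /= trmx_mul trmxK trmx_drsub h //.
move=> y y0; have := schur_qf (- (dot schur_b y / schur_a)) y.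
rewrite addNr expr0n mulr0 add0r => <-; have [_] := pS; apply.
by apply: contra_neq y0; rewrite -(row_mx0 _ 1 1 n) => /eq_row_mx [].
Qed.

Lemma schur_det : \det S = schur_a * \det schur_c.
Proof.
have a0 : schur_a != 0 by rewrite gt_eqF // schur_a_gt0.
pose W : 'M[R]_(1 + n) := block_mx 1%:M (- schur_a^-1 *: schur_b) 0 1%:M.
have dW : \det W = 1 by rewrite det_ublock !det1 mulr1.
have SW : S *m W = block_mx schur_a%:M 0 schur_b^T schur_c.
  rewrite {1}S_block mulmx_block !mulmx1 !mulmx0 !addr0; congr block_mx.
    by rewrite mul_scalar_mx scalerA mulrN divff // scaleN1r addNr.
  by rewrite -scalemxAr /schur_c scaleNr addrC.
by rewrite -[LHS]mulr1 -dW -det_mulmx SW det_lblock det_scalar expr1.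
Qed.

Lemma schur_qf_inv (x0 : R) (x : 'rV[R]_n) :
  qf (invmx S) (row_mx x0%:M x) =
  x0 ^+ 2 / schur_a + qf (invmx schur_c) (x - (x0 / schur_a) *: schur_b).
Proof.
have a0 : schur_a != 0 by rewrite gt_eqF // schur_a_gt0.
set x2 := x - _; set z := x2 *m invmx schur_c.
have zc : z *m schur_c = x2 by rewrite mulmxKV // posdef_unit //; exact: schur_posdef.
set z0 := (x0 - dot z schur_b) / schur_a.
rewrite (@qf_invE _ S _ (row_mx z0%:M z)); last 2 first.
- exact: posdef_unit.
- rewrite mul_row_S; congr row_mx; first by rewrite /z0 divfK // subrK.
  have -> : drsubmx S = schur_c + schur_a^-1 *: (schur_b^T *m schur_b) by rewrite subrK.
  rewrite mulmxDr zc -scalemxAr mulmxA (_ : z *m schur_b^T = (dot z schur_b)%:M).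
    rewrite mul_scalar_mx scalerA /x2 /z0; apply/matrixP => i j; rewrite !mxE.
    by field.
  by apply/matrixP => i j; rewrite !ord1 [RHS]mxE mulr1n.
rewrite (@qf_invE _ schur_c _ z) //; last by apply: posdef_unit; exact: schur_posdef.
rewrite dot_row_mx dot11 !mxE !mulr1n /x2 dotDr -scaleNr dotZr /z0.
by field.
Qed.

End Schur.
End QuadraticForms.

(** * Gaussian sums in several variables *)

Section GaussianSums.
Context (R : realType).

(** Points of spacing [1 / N] that fill the cube of half-side [N]. *)
Definition grid (N d : nat) (k : 'rV['I_(2 * N ^ 2).+1]_d) : 'rV[R]_d :=
  \row_i (((k 0 i)%:R - (N ^ 2)%:R) / N%:R).

Definition gsum d (S : 'M[R]_d) (x : 'rV[R]_d) (N : nat) : R :=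
  (N%:R ^+ d)^-1 * \sum_(k : 'rV['I_(2 * N ^ 2).+1]_d)
     expR (- (2 * pi ^+ 2 * qf S (grid k))) * cos (2 * pi * dot x (grid k)).

(** The Gaussian density of covariance [S] at [x]. *)
Definition gval d (S : 'M[R]_d) (x : 'rV[R]_d) : R :=
  (Num.sqrt ((2 * pi) ^+ d * \det S))^-1 * expR (- (qf (invmx S) x / 2)).

Lemma sum_row_mx (I : finType) d (F : 'rV[I]_(1 + d) -> R) :
  \sum_k F k = \sum_(k' : 'rV[I]_d) \sum_(i : I) F (row_mx (const_mx i) k').
Proof.
rewrite pair_big /=.
rewrite (reindex (fun p : 'rV[I]_d * I => row_mx (const_mx p.2 : 'rV_1) p.1)) //=.
exists (fun k : 'rV[I]_(1 + d) => (rsubmx k, lsubmx k 0 0)) => [[k i] _|k _] /=.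
  by rewrite row_mxKr row_mxKl mxE.
rewrite -[RHS]hsubmxK; congr row_mx.
by apply/matrixP => i j; rewrite !ord1 mxE.
Qed.

Lemma grid_row_mx N d (i : 'I_(2 * N ^ 2).+1) (k : 'rV['I_(2 * N ^ 2).+1]_d) :
  grid (row_mx (const_mx i) k) = row_mx ((i%:R - (N ^ 2)%:R) / N%:R)%:M (grid k).
Proof.
apply/rowP => j; rewrite !mxE; case: splitP => j' e.
  by rewrite !mxE ord1 mulr1n.
by rewrite !mxE.
Qed.

Lemma gval_schur d (S : 'M[R]_(1 + d)) (x0 : R) (x : 'rV[R]_d) : posdef S ->
  gval S (row_mx x0%:M x) = wave_value (2 * pi ^+ 2 * schur_a S) (2 * pi * x0) *
    gval (schur_c S) (x - (x0 / schur_a S) *: schur_b S).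
Proof.
move=> pS; have a0 := schur_a_gt0 pS; have p0 := pi_gt0 R.
rewrite /gval schur_qf_inv // schur_det // /wave_value.
set q := qf _ _; set D := \det _; set a := schur_a S in a0 *.
have -> : (2 * pi) ^+ (1 + d) * (a * D) = (2 * pi * a) * ((2 * pi) ^+ d * D) by rewrite exprS; ring.
have p2a : 0 <= 2 * pi * a by rewrite !mulr_ge0 // ltW.
rewrite sqrtrM // invfM.
have -> : pi / (2 * pi ^+ 2 * a) = (2 * pi * a)^-1.
  by rewrite (_ : 2 * pi ^+ 2 * a = pi * (2 * pi * a)); [rewrite invfM mulrA divff ?mul1r ?gt_eqF | ring].
rewrite sqrtrV // -!mulrA; congr (_ * _).
rewrite [RHS]mulrCA; congr (_ * _); rewrite -expRD; congr expR.
move: (pi : R) p0 => P p0; have pn : P != 0 by rewrite gt_eqF.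
have an : a != 0 by rewrite gt_eqF.
by field; rewrite an pn.
Qed.

Lemma gsum_schur d (S : 'M[R]_(1 + d)) (x0 : R) (x : 'rV[R]_d) N : posdef S ->
  gsum S (row_mx x0%:M x) N =
  (N%:R ^+ d)^-1 * \sum_(k : 'rV['I_(2 * N ^ 2).+1]_d)
     expR (- (2 * pi ^+ 2 * qf (schur_c S) (grid k))) *
     (N%:R^-1 * \sum_(i < (2 * N ^ 2).+1)
        wave (2 * pi ^+ 2 * schur_a S) (2 * pi * x0)
          (2 * pi * dot (x - (x0 / schur_a S) *: schur_b S) (grid k))
          ((i%:R - (N ^ 2)%:R) / N%:R + dot (schur_b S) (grid k) / schur_a S)).
Proof.
move=> pS; have a0 : schur_a S != 0 by rewrite gt_eqF // schur_a_gt0.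
rewrite /gsum sum_row_mx exprD expr1 invfM (mulrC N%:R^-1) -[LHS]mulrA; congr (_ * _).
rewrite mulr_sumr; apply: eq_bigr => k _; rewrite !mulr_sumr.
apply: eq_bigr => i _; rewrite grid_row_mx schur_qf // /wave.
set t := (_ - _) / _; set y := grid k; set b := schur_b S; set a := schur_a S in a0 *.
rewrite dot_row_mx dot11 !mxE !mulr1n dotDl -(scaleNr (x0 / a) b) dotZl.
rewrite mulrDr opprD expRD.
have -> : 2 * pi * x0 * (t + dot b y / a) + 2 * pi * (dot x y + - (x0 / a) * dot b y) =
   2 * pi * (x0 * t + dot x y) by move: (pi : R) => P; field.
by rewrite !mulrA; ring.
Qed.

Lemma wave_sum (alpha beta c s : R) (N : nat) : 0 < alpha -> (0 < N)%N ->
  `|N%:R^-1 * (\sum_(i < (2 * N ^ 2).+1) wave alpha beta c ((i%:R - (N ^ 2)%:R) / N%:R + s))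
     - cos c * wave_value alpha beta| <= 48 * wave_bound alpha beta * (1 + `|s|) / N%:R.
Proof.
move=> a0 N0; apply: (@riemann_line _ _ (dwave alpha beta c)) => //.
- by move=> x; apply: is_derive_wave.
- by move=> x; apply: wave_dom.
- by move=> x; apply: dwave_dom.
- exact: has_int_wave.
Qed.

Lemma gsum_base (S : 'M[R]_0) (x : 'rV[R]_0) N : gsum S x N = gval S x.
Proof.
have q0 (T : 'M[R]_0) (y : 'rV[R]_0) : qf T y = 0 by rewrite /qf dotE big_ord0.
rewrite /gsum /gval !expr0 invr1 mul1r (eq_bigr (fun=> 1)) => [|k _].
  by rewrite sumr_const card_mx muln0 expn0 q0 det_mx00 mulr1 sqrtr1 invr1 mul1r mul0r oppr0 expR0.
by rewrite q0 mulr0 oppr0 expR0 dotE big_ord0 mulr0 cos0 mulr1.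
Qed.

Lemma row_splitP d (x : 'rV[R]_(1 + d)) : exists x0 x', x = row_mx x0%:M x'.
Proof.
exists (x 0 0), (rsubmx x); rewrite -[LHS]hsubmxK; congr row_mx.
by apply/matrixP => i j; rewrite !ord1 !mxE lshift0 mulr1n.
Qed.

(** Induction on the dimension. For fixed remaining coordinates [y], the sum over the first
    coordinate is one-dimensional, up to a shift proportional to [dot b y] with [b] the
    off-diagonal block. The error of [riemann_line] is linear in this shift, which is
    absorbed by half of the Gaussian weight of [y]. *)
Lemma gsum_cvg d (S : 'M[R]_d) (x : 'rV[R]_d) : posdef S -> gsum S x N @[N --> \oo] --> gval S x.
Proof.
elim: d S x => [|d IH] S x pS.
  rewrite (_ : gsum S x = fun=> gval S x); first exact: cvg_cst.
  by apply/funext => N; apply: gsum_base.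
have [x0 [{}x ->]] := row_splitP (x : 'rV_(1 + d)).
have pC := @schur_posdef R d S pS.
have a0 := @schur_a_gt0 R d S pS.
rewrite (@gval_schur d S) //.
set C := schur_c _ in pC *; set b := schur_b _; set a := schur_a _ in a0 *.
set x2 := x - _.
set alpha := 2 * pi ^+ 2 * a; set beta := 2 * pi * x0.
have al0 : 0 < alpha by rewrite !mulr_gt0 ?exprn_gt0 ?pi_gt0.
have pC2 : posdef ((1 / 2) *: C) by apply: posdefZ.
pose K1 := qf (invmx C) b / a ^+ 2.
have K10 : 0 <= K1.
  rewrite divr_ge0 ?sqr_ge0 // (@qf_invE _ _ C b (b *m invmx C)) ?posdef_unit //.
    have -> : dot (b *m invmx C) b = qf C (b *m invmx C).
      by rewrite /qf mulmxKV ?posdef_unit // dotC.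
    exact: posdef_ge0.
  by rewrite mulmxKV ?posdef_unit.
(* Cauchy-Schwarz bounds the shift by the quadratic form, and the exponential dominates it. *)
have shift y : 1 + `|dot b y / a| <= (2 + K1) * expR (pi ^+ 2 * qf C y).
  have q0 := posdef_ge0 y pC; have cs := posdef_cauchy b y pC.
  set s := dot b y / a.
  have s2 : s ^+ 2 <= K1 * qf C y.
    by rewrite /s /K1 expr_div_n [X in _ <= X]mulrAC ler_wpM2r // invr_ge0 sqr_ge0.
  have s1 : `|s| <= 1 + s ^+ 2 by rewrite -(real_normK (num_real s)); have := sqr_ge0 (`|s| - 1); nra.
  have pi1 : 1 <= (pi : R) ^+ 2 by rewrite expr_ge1 // (le_trans _ (pi_ge2 R)) // ler1n.
  have e1 : 1 + qf C y <= expR (pi ^+ 2 * qf C y).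
    apply: le_trans (expR_ge1Dx _) _; rewrite ler_expR; nra.
  have : (2 + K1) * (1 + qf C y) <= (2 + K1) * expR (pi ^+ 2 * qf C y).
    by rewrite ler_wpM2l // addr_ge0.
  nra.
have fac (i A w B : R) : i * A - w * (i * B) = i * (A - w * B) by ring.
have err N : (0 < N)%N -> `|gsum S (row_mx x0%:M x) N - wave_value alpha beta * gsum C x2 N| <=
   48 * wave_bound alpha beta * (2 + K1) / N%:R * gsum ((1 / 2) *: C) 0 N.
  move=> N0; rewrite (@gsum_schur d S) // /gsum fac normrM.
  have Nd : 0 <= (N%:R ^+ d)^-1 :> R by rewrite invr_ge0 exprn_ge0.
  rewrite (ger0_norm Nd) [X in _ <= X]mulrCA; apply: ler_wpM2l => //.
  rewrite !mulr_sumr -sumrB; apply: le_trans (ler_norm_sum _ _ _) _.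
  apply: ler_sum => k _; set y := grid k.
  rewrite fac normrM (ger0_norm (expR_ge0 _)).
  rewrite -/C -/b -/a -/alpha -/beta -/x2 [wave_value _ _ * _]mulrC.
  have := wave_sum beta (2 * pi * dot x2 y) (dot b y / a) al0 N0.
  move=> /(ler_wpM2l (expR_ge0 (- (2 * pi ^+ 2 * qf C y)))) h; apply: le_trans h _.
  rewrite dot0l mulr0 cos0 mulr1 qfZ.
  have w0 : 0 <= 48 * wave_bound alpha beta / N%:R by rewrite divr_ge0 // mulr_ge0 // wave_bound_ge0.
  rewrite [X in X <= _](_ : _ = (48 * wave_bound alpha beta / N%:R) *
     (expR (- (2 * pi ^+ 2 * qf C y)) * (1 + `|dot b y / a|))); last by ring.
  rewrite [X in _ <= X](_ : _ = (48 * wave_bound alpha beta / N%:R) *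
     (expR (- (2 * pi ^+ 2 * qf C y)) * ((2 + K1) * expR (pi ^+ 2 * qf C y)))).
    by apply: ler_wpM2l => //; apply: ler_wpM2l; [exact: expR_ge0 | exact: shift].
  rewrite (_ : - (2 * pi ^+ 2 * (1 / 2 * qf C y)) = - (2 * pi ^+ 2 * qf C y) + pi ^+ 2 * qf C y).
    by rewrite expRD; ring.
  by move: (pi : R) => P; field.
have c1 := IH C x2 pC; have c2 := IH _ 0 pC2.
have c3 : (fun N : nat => N%:R^-1 : R) N @[N --> \oo] --> (0 : R).
  by rewrite -cvg_shiftS; exact: cvg_harmonic.
set Kc := 48 * wave_bound alpha beta * (2 + K1) in err.
have c4 : Kc / N%:R * gsum ((1 / 2) *: C) 0 N @[N --> \oo] --> (0 : R).
  have h : Kc / N%:R * gsum ((1 / 2) *: C) 0 N @[N --> \oo] --> Kc * 0 * gval ((1 / 2) *: C) 0.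
    by apply: cvgM => //; apply: cvgM => //; exact: cvg_cst.
  by move: h; rewrite mulr0 mul0r.
pose D N := gsum S (row_mx x0%:M x) N - wave_value alpha beta * gsum C x2 N.
have c5 : D N @[N --> \oo] --> (0 : R).
  apply/cvgr0Pnorm_le => e e0; near=> N.
  apply: (@le_trans _ _ (Kc / N%:R * gsum ((1 / 2) *: C) 0 N)).
    by apply: err; near: N; exact: nbhs_infty_gt.
  apply: le_trans (ler_norm _) _.
  by near: N; apply: cvgr0_norm_le => //.
have -> : gsum S (row_mx x0%:M x) = (fun N => D N + wave_value alpha beta * gsum C x2 N).
  by apply/funext => N; rewrite /D subrK.
have h : D N + wave_value alpha beta * gsum C x2 N @[N --> \oo] --> 0 + wave_value alpha beta * gval C x2.
  by apply: cvgD => //; apply: cvgM => //; exact: cvg_cst.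
by move: h; rewrite add0r.
Unshelve. all: by end_near. Qed.

End GaussianSums.

(** * The characteristic function of a Bernoulli step *)

Import ComplexField.Normc.
Local Open Scope complex_scope.

Section CharacteristicFunction.
Context (R : realType).
Implicit Types (x y u p : R).

Lemma sin_taylor1 u : 0 <= u -> `|sin u| <= u.
Proof.
move=> u0; have := @cmp_derive R sin cos id (cst 1) 0 u u0.
rewrite sin0 !subr0; apply => // x _; by rewrite ler_norml cos_geN1 cos_le1.
Qed.

Lemma cos_taylor2 u : 0 <= u -> `|1 - cos u| <= u ^+ 2 / 2.
Proof.
move=> u0; have := @cmp_derive R (fun t => - cos t) sin (fun t => t ^+ 2 / 2) id 0 u u0.
rewrite cos0 expr0n mul0r subr0 opprK addrC; apply => x.
- by move=> _; apply: is_derive_eq; rewrite /GRing.scale /=; field.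
- by move=> _; apply: is_derive_eq; rewrite /GRing.scale /=; field.
- by rewrite in_itv /= => /andP[x0 _]; apply: sin_taylor1.
Qed.

Lemma sin_taylor3 u : 0 <= u -> `|u - sin u| <= u ^+ 3 / 6.
Proof.
move=> u0; have := @cmp_derive R (fun t => t - sin t) (fun t => 1 - cos t) (fun t => t ^+ 3 / 6)
  (fun t => t ^+ 2 / 2) 0 u u0.
rewrite sin0 expr0n mul0r !subr0; apply => x.
- by move=> _; apply: is_derive_eq; rewrite /GRing.scale /=; field.
- by rewrite in_itv /= => /andP[x0 _]; apply: cos_taylor2.
Qed.

Lemma cos_taylor4 u : `|cos u - 1 + u ^+ 2 / 2| <= u ^+ 4 / 24.
Proof.
wlog u0 : u / 0 <= u.
  move=> h; have [|un] := leP 0 u; first exact: h.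
  by have := h (- u); rewrite cosN sqrrN -[4%N]/(2 * 2)%N !exprM sqrrN; apply; rewrite oppr_ge0 ltW.
have := @cmp_derive R (fun t => cos t - 1 + t ^+ 2 / 2) (fun t => t - sin t) (fun t => t ^+ 4 / 24)
  (fun t => t ^+ 3 / 6) 0 u u0.
rewrite cos0 !expr0n !mul0r !subr0 subrr addr0 subr0; apply => x.
- by move=> _; apply: is_derive_eq; rewrite /GRing.scale /=; field.
- by move=> _; apply: is_derive_eq; rewrite /GRing.scale /=; field.
- by rewrite in_itv /= => /andP[x0 _]; apply: sin_taylor3.
Qed.

Lemma sin_taylor3n u : `|sin u - u| <= `|u| ^+ 3 / 6.
Proof.
have [u0|u0] := leP 0 u; first by rewrite (ger0_norm u0) distrC; apply: sin_taylor3.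
have := @sin_taylor3 (- u); rewrite oppr_ge0 (ltW u0) sinN (ltr0_norm u0) opprK.
by rewrite addrC; apply.
Qed.

Lemma cos_le_quartic u : cos u <= 1 - u ^+ 2 / 2 + u ^+ 4 / 24.
Proof. by have := cos_taylor4 u; rewrite ler_norml => /andP[_]; lra. Qed.

(** Half-angle formula, and [sin u >= u / 3] for [0 <= u <= 2]. *)
Lemma one_sub_cos_ge y : `|y| <= pi -> y ^+ 2 / 18 <= 1 - cos y.
Proof.
move=> yp; pose u := `|y| / 2.
have u0 : 0 <= u by rewrite divr_ge0.
have u2 : u <= 2 by rewrite /u; have := pihalf_lt2 R; lra.
have s1 : u / 3 <= sin u.
  have := sin_taylor3 u0; rewrite ler_norml => /andP[_ h].
  have : u * u ^+ 2 <= u * 4 by rewrite ler_wpM2l //; nra.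
  by rewrite -exprS; lra.
have -> : cos y = 1 - 2 * sin u ^+ 2.
  have -> : cos y = cos (u + u) by rewrite /u -splitr; case: (ger0P y) => _ //; rewrite cosN.
  rewrite cosD -!expr2; have := cos2Dsin2 u; lra.
have -> : y ^+ 2 = (2 * u) ^+ 2.
  by rewrite -(real_normK (num_real y)) /u; congr (_ ^+ 2); field.
have : (u / 3) ^+ 2 <= sin u ^+ 2 by rewrite ler_pXn2r // nnegrE; lra.
nra.
Qed.

Definition cis y : R[i] := (cos y) +i* (sin y).

(** The characteristic function of a Bernoulli variable. *)
Definition step_cf p y : R[i] := (1 - p)%:C + p%:C * cis y.

Lemma cisD x y : cis (x + y) = cis x * cis y.
Proof. by rewrite /cis cosD sinD; simpc; congr (_ +i* _); ring. Qed.

Lemma cis0 : cis 0 = 1. Proof. by rewrite /cis cos0 sin0. Qed.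

Lemma normc_real x : normc x%:C = `|x|.
Proof. by rewrite /normc /= expr0n addr0 sqrtr_sqr. Qed.

Lemma normc_cis y : normc (cis y) = 1.
Proof. by rewrite /normc /cis /= cos2Dsin2 sqrtr1. Qed.

Lemma normc_prod (I : finType) (P : pred I) (F : I -> R[i]) :
  normc (\prod_(i | P i) F i) = \prod_(i | P i) normc (F i).
Proof. by elim/big_rec2: _ => [|i a b _ <-]; rewrite ?normc1 ?normcM. Qed.

Lemma normc_sum (I : finType) (P : pred I) (F : I -> R[i]) :
  normc (\sum_(i | P i) F i) <= \sum_(i | P i) normc (F i).
Proof.
elim/big_ind2: _ => // [|a b c e h1 h2]; first by rewrite normc0.
exact: le_trans (le_normcD _ _) (lerD h1 h2).
Qed.

Lemma normc_le_abs x y : normc (x +i* y) <= `|x| + `|y|.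
Proof.
rewrite /normc /= -[X in _ <= X]ger0_norm ?addr_ge0 // -sqrtr_sqr ler_sqrt ?sqr_ge0 //.
rewrite sqrrD (real_normK (num_real x)) (real_normK (num_real y)).
have : 0 <= `|x| * `|y| by rewrite mulr_ge0.
lra.
Qed.

Lemma normc_step_cf2 p y : normc (step_cf p y) ^+ 2 = 1 - 2 * (p * (1 - p)) * (1 - cos y).
Proof.
rewrite /step_cf /cis; simpc; rewrite /normc /= sqr_sqrtr ?addr_ge0 ?sqr_ge0 //.
rewrite exprMn.
have -> : sin y ^+ 2 = 1 - cos y ^+ 2 by rewrite -(cos2Dsin2 y) addrC addKr.
ring.
Qed.

Lemma normc_ge0 (z : R[i]) : 0 <= normc z.
Proof. by case: z => a b; rewrite /normc sqrtr_ge0. Qed.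

Lemma normc_step_cf_le p y m : 0 <= p <= 1 -> m <= 1 - cos y ->
  normc (step_cf p y) <= expR (- (p * (1 - p) * m)).
Proof.
move=> /andP[p0 p1] hm; have pq : 0 <= p * (1 - p) by rewrite mulr_ge0 ?subr_ge0.
rewrite -(@ler_pXn2r _ 2) ?nnegrE ?normc_ge0 ?expR_ge0 // normc_step_cf2 -expRM_natl.
apply: le_trans (expR_ge1Dx _); nra.
Qed.

Lemma normc_step_cf_near p y k : 0 <= p <= 1 -> y ^+ 2 / 12 <= k ->
  normc (step_cf p y) <= expR (- (p * (1 - p) * ((1 - k) * (y ^+ 2 / 2)))).
Proof.
move=> p01 hk; apply: normc_step_cf_le => //.
have := cos_le_quartic y.
have : y ^+ 2 / 12 * y ^+ 2 <= k * y ^+ 2 by rewrite ler_wpM2r // sqr_ge0.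
have -> : y ^+ 2 / 12 * y ^+ 2 = y ^+ 4 / 12 by rewrite mulrAC -exprD.
lra.
Qed.

End CharacteristicFunction.

Section CharacteristicFunctionProduct.
Context (R : realType).
Implicit Types (x y u p : R).

Lemma cis_2pi_int (n : int) : cis (2 * pi * n%:~R) = 1 :> R[i].
Proof.
have nat (k : nat) : cis (2 * pi * k%:R) = 1 :> R[i].
  elim: k => [|k IH]; first by rewrite mulr0 cis0.
  rewrite -(natr1 k) mulrDr cisD IH mul1r mulr1 /cis mulr_natl cos2pi sin2pi //.
case: n => k; first exact: nat.
rewrite NegzE intrN mulrN -[LHS]mulr1 -[X in _ * X](nat k.+1) -cisD.
by rewrite -pmulrn addNr cis0.
Qed.

Lemma step_cf_frac p t : step_cf p (2 * pi * t) = step_cf p (2 * pi * fpart t).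
Proof.
have -> : 2 * pi * fpart t = 2 * pi * t + 2 * pi * (- rnd t)%:~R by rewrite /fpart intrN; ring.
by rewrite /step_cf cisD cis_2pi_int mulr1.
Qed.

Lemma normc_step_cf_far p t : 0 <= p <= 1 ->
  normc (step_cf p (2 * pi * t)) <= expR (- (p * (1 - p) / 2 * dZ t ^+ 2)).
Proof.
move=> p01; rewrite step_cf_frac.
have p0 := pi_gt0 R; have p2 := pi_ge2 R.
have pp : 0 <= 2 * (pi : R) by lra.
have := @normc_step_cf_le R p (2 * pi * fpart t) (dZ t ^+ 2 / 2) p01.
rewrite (_ : p * (1 - p) * (dZ t ^+ 2 / 2) = p * (1 - p) / 2 * dZ t ^+ 2); last by ring.
apply; apply: le_trans (one_sub_cos_ge _).
  rewrite -(real_normK (num_real (2 * pi * fpart t))) normrM -/(dZ t) (ger0_norm pp).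
  rewrite exprMn ler_pdivlMr // mulrAC ler_pdivrMr //.
  have : 2 ^+ 2 <= (pi : R) ^+ 2 by rewrite ler_pXn2r // nnegrE ?ltW.
  have := sqr_ge0 (dZ t); set q := dZ t ^+ 2; rewrite exprMn; nra.
rewrite normrM -/(dZ t) (ger0_norm pp).
have := dZ_le_half t; nra.
Qed.

Lemma normc_prod_far (B : finType) p (t : B -> R) : 0 <= p <= 1 ->
  normc (\prod_b step_cf p (2 * pi * t b)) <= expR (- (p * (1 - p) / 2 * \sum_b dZ (t b) ^+ 2)).
Proof.
move=> p01; rewrite normc_prod mulr_sumr -sumrN expR_sum.
by apply: ler_prod => b _; rewrite normc_ge0 normc_step_cf_far.
Qed.

Lemma expR_quad x : 0 <= x -> `|expR (- x) - 1 + x| <= x ^+ 2 / 2.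
Proof.
move=> x0.
have lin (s : R) : 0 <= s -> `|1 - expR (- s)| <= s.
  move=> s0; have e1 : expR (- s) <= 1 by rewrite -expR0 ler_expR oppr_le0.
  by rewrite ger0_norm ?subr_ge0 //; have := expR_ge1Dx (- s); lra.
have dexp (s : R) : is_derive s 1 (fun t => expR (- t)) (- expR (- s)).
  have h : is_derive s 1 (fun t : R => - t) (-1) by apply: is_derive_eq.
  by apply: (is_derive_eq (is_derive1_comp (is_derive_expR _) h)); rewrite /GRing.scale /=; ring.
have := @cmp_derive R (fun t => expR (- t) - 1 + t) (fun t => 1 - expR (- t)) (fun t => t ^+ 2 / 2)
  id 0 x x0.
rewrite oppr0 expR0 expr0n mul0r !subr0 subrr addr0 subr0; apply => t.
- by move=> _; have h := dexp t; apply: is_derive_eq; rewrite /GRing.scale /=; ring.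
- by move=> _; apply: is_derive_eq; rewrite /GRing.scale /=; field.
- by rewrite in_itv /= => /andP[t0 _]; apply: lin.
Qed.

Lemma cis_taylor u : `|u| <= 2 ->
  exists z : R[i], cis u = 1 + u *i - (u ^+ 2 / 2)%:C + z /\ normc z <= `|u| ^+ 3 / 4.
Proof.
move=> u2; exists ((cos u - 1 + u ^+ 2 / 2) +i* (sin u - u)); split.
  by rewrite /cis; simpc; congr (_ +i* _); ring.
apply: le_trans (normc_le_abs _ _) _.
have h1 := cos_taylor4 u; have h2 := sin_taylor3n u.
have : u ^+ 4 <= 2 * `|u| ^+ 3.
  rewrite -[4%N]/(2 * 2)%N exprM -(real_normK (num_real u)) -exprM [(2 * 2)%N]/= exprS.
  by rewrite ler_wpM2r // exprn_ge0.
lra.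
Qed.

(** The linear terms of the expansions of the two phases cancel after centring, and the
    quadratic ones add up to the variance. *)
Lemma step_cf_gauss p y : 0 <= p <= 1 -> `|y| <= 2 ->
  normc (step_cf p y * cis (- (p * y)) - (expR (- (p * (1 - p) * (y ^+ 2 / 2))))%:C)
    <= p * (1 - p) * `|y| ^+ 3 / 2.
Proof.
move=> /andP[p0 p1] y2; set q := 1 - p.
have q0 : 0 <= q by rewrite subr_ge0.
have -> : step_cf p y * cis (- (p * y)) = q%:C * cis (- (p * y)) + p%:C * cis (q * y).
  rewrite /step_cf mulrDl -mulrA -cisD; congr (_ + _ * cis _); rewrite /q; ring.
have n1 : `|- (p * y)| = p * `|y| by rewrite normrN normrM ger0_norm.
have n2 : `|q * y| = q * `|y| by rewrite normrM ger0_norm.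
have y0 := normr_ge0 y.
have [|z1 [-> hz1]] := @cis_taylor (- (p * y)); first by rewrite n1; nra.
have [|z2 [-> hz2]] := @cis_taylor (q * y); first by rewrite n2 /q; nra.
set e := expR _.
pose r := 1 - p * q * (y ^+ 2 / 2) - e.
have -> : q%:C * (1 + (- (p * y)) *i - ((- (p * y)) ^+ 2 / 2)%:C + z1) +
          p%:C * (1 + (q * y) *i - ((q * y) ^+ 2 / 2)%:C + z2) - e%:C =
          q%:C * z1 + p%:C * z2 + r%:C.
  case: z1 hz1 => a1 b1 _; case: z2 hz2 => a2 b2 _.
  by simpc; rewrite /r /q; congr (_ +i* _); field.
apply: le_trans (le_normcD _ _) _; rewrite normc_real.
have h1 : normc (q%:C * z1 + p%:C * z2) <= q * (p * `|y|) ^+ 3 / 4 + p * (q * `|y|) ^+ 3 / 4.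
  apply: le_trans (le_normcD _ _) _; rewrite !normcM !normc_real (ger0_norm p0) (ger0_norm q0) -(mulrA q) -(mulrA p).
  rewrite n1 in hz1; rewrite n2 in hz2. apply: lerD; apply: ler_wpM2l => //.
have pq0 : 0 <= p * q by exact: mulr_ge0.
have pq4 : p * q <= 1 / 4 by rewrite /q; have := sqr_ge0 (p - 1 / 2); nra.
have h2 : `|r| <= (p * q * (y ^+ 2 / 2)) ^+ 2 / 2.
  have := @expR_quad (p * q * (y ^+ 2 / 2)); rewrite -/e.
  rewrite mulr_ge0 // ?divr_ge0 ?sqr_ge0 // => /(_ isT).
  by rewrite -normrN (_ : - (_ - 1 + _) = r) //; rewrite /r; ring.
have yy : y ^+ 2 = `|y| ^+ 2 by rewrite real_normK // num_real.
move: h1 h2; rewrite yy; move: (`|y|) y0 y2 => Y Y0 Y2 h1 h2.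
have Y3 : 0 <= Y ^+ 3 by rewrite exprn_ge0.
have h3 : q * (p * Y) ^+ 3 / 4 + p * (q * Y) ^+ 3 / 4 <= p * q * Y ^+ 3 / 4.
  have -> : q * (p * Y) ^+ 3 / 4 + p * (q * Y) ^+ 3 / 4 = (p * q * Y ^+ 3 / 4) * (1 - 2 * (p * q)).
    by rewrite /q; field.
  by rewrite ler_piMr ?divr_ge0 ?mulr_ge0 //; lra.
have h4 : (p * q * (Y ^+ 2 / 2)) ^+ 2 / 2 <= p * q * Y ^+ 3 / 4.
  have -> : (p * q * (Y ^+ 2 / 2)) ^+ 2 / 2 = (p * q * Y ^+ 3 / 4) * (p * q * Y / 2) by field.
  by rewrite ler_piMr ?divr_ge0 ?mulr_ge0 //; nra.
lra.
Qed.

Lemma prod_diff_le (I : finType) (z w : I -> R[i]) :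
  (forall i, normc (z i) <= 1) -> (forall i, normc (w i) <= 1) ->
  normc (\prod_i z i - \prod_i w i) <= \sum_i normc (z i - w i).
Proof.
move=> hz hw.
suff [] : normc (\prod_i z i - \prod_i w i) <= \sum_i normc (z i - w i) /\
  normc (\prod_i w i) <= 1 by [].
elim/big_rec3: _ => [|i a b c _ [h1 h2]]; first by rewrite subrr normc0 normc1.
split; last by rewrite normcM mulr_ile1 ?normc_ge0.
have -> : z i * c - w i * b = z i * (c - b) + (z i - w i) * b by ring.
apply: le_trans (le_normcD _ _) _; rewrite addrC !normcM; apply: lerD.
  by rewrite ler_piMr ?normc_ge0.
by apply: le_trans h1; rewrite ler_piMl ?normc_ge0.
Qed.

Lemma prod_realc (I : finType) (F : I -> R) :
  \prod_i (F i)%:C = (\prod_i F i)%:C.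
Proof. by elim/big_rec2: _ => [//|i a b _ ->]; rewrite -rmorphM. Qed.

(** Multiplying the factors by [expR (m b)], with [m b] the fraction [1 - k] of the Gaussian
    exponent, keeps their moduli at most 1, so that the telescoping bound on a difference of
    products applies and the Gaussian decay is not lost. The fraction [k] of the exponent
    given up dominates the quartic term of the cosine. *)
Lemma cf_near_gauss (B : finType) p k (y : B -> R) : 0 <= p <= 1 -> 0 <= k <= 1 ->
  (forall b, `|y b| <= 2) -> (forall b, y b ^+ 2 / 12 <= k) ->
  normc (\prod_b (step_cf p (y b) * cis (- (p * y b)))
     - (expR (- (p * (1 - p) * \sum_b (y b ^+ 2 / 2))))%:C) <=
  p * (1 - p) * (\sum_b `|y b| ^+ 3) * expR (- ((1 - k) * (p * (1 - p) * \sum_b (y b ^+ 2 / 2)))).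
Proof.
move=> p01 /andP[k0 k1] y2 yk; set v := p * (1 - p).
have /andP[p0 p1] := p01.
have v0 : 0 <= v by rewrite mulr_ge0 // subr_ge0.
have v4 : v <= 1 / 4 by rewrite /v; have := sqr_ge0 (p - 1 / 2); nra.
pose m b := (1 - k) * (v * (y b ^+ 2 / 2)).
have ys b : 0 <= y b ^+ 2 / 2 by rewrite divr_ge0 ?sqr_ge0.
have m0 b : 0 <= m b by apply: mulr_ge0; [rewrite subr_ge0 | exact: mulr_ge0].
have m1 b : expR (m b) <= 2.
  have hm : m b <= 1 / 2.
    have : y b ^+ 2 <= 2 ^+ 2.
      by rewrite -(real_normK (num_real (y b))) ler_pXn2r ?nnegrE.
    have := sqr_ge0 (y b); rewrite /m => h1 h2.
    have : v * (y b ^+ 2 / 2) <= 1 / 4 * 2 by rewrite ler_pM // ?divr_ge0 //; lra.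
    have : 0 <= v * (y b ^+ 2 / 2) by rewrite mulr_ge0 // divr_ge0.
    nra.
  have := expR_ge1Dx (- m b); rewrite expRN => h.
  have e0 := expR_gt0 (m b).
  have : (1 - m b) * expR (m b) <= 1.
    by rewrite -[X in _ <= X](mulVf (lt0r_neq0 e0)) ler_pM2r.
  nra.
pose z b := step_cf p (y b) * cis (- (p * y b)) * (expR (m b))%:C.
pose w b := (expR (- (v * (y b ^+ 2 / 2))))%:C * (expR (m b))%:C.
have inv : (expR (\sum_b m b))%:C * (expR (- \sum_b m b))%:C = 1 :> R[i].
  by rewrite -rmorphM /= -expRD addrN expR0.
have Ez : \prod_b (step_cf p (y b) * cis (- (p * y b))) = (\prod_b z b) * (expR (- \sum_b m b))%:C.
  rewrite /z [X in _ = X * _]big_split /= prod_realc -expR_sum -[RHS]mulrA [X in _ = _ * X]inv mulr1 //.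
have Ew : (expR (- (v * \sum_b (y b ^+ 2 / 2))))%:C = (\prod_b w b) * (expR (- \sum_b m b))%:C.
  rewrite /w [X in _ = X * _]big_split /= !prod_realc -!expR_sum -[RHS]mulrA [X in _ = _ * X]inv mulr1.
  by rewrite sumrN mulr_sumr.
rewrite Ez Ew -mulrBl normcM normc_real (ger0_norm (expR_ge0 _)).
have -> : \sum_b m b = (1 - k) * (v * \sum_b (y b ^+ 2 / 2)) by rewrite /m -!mulr_sumr.
apply: ler_wpM2r; first exact: expR_ge0.
have me b : expR (- m b) * expR (m b) = 1 by rewrite -expRD addNr expR0.
apply: le_trans (prod_diff_le _ _) _ => [b|b|].
- rewrite /z !normcM normc_cis mulr1 normc_real (ger0_norm (expR_ge0 _)).
  apply: (@le_trans _ _ (expR (- m b) * expR (m b))); last by rewrite me.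
  apply: ler_wpM2r; first exact: expR_ge0.
  have -> : m b = p * (1 - p) * ((1 - k) * (y b ^+ 2 / 2)) by rewrite /m /v; ring.
  by apply: normc_step_cf_near.
- rewrite /w normcM !normc_real !(ger0_norm (expR_ge0 _)).
  apply: (@le_trans _ _ (expR (- m b) * expR (m b))); last by rewrite me.
  apply: ler_wpM2r; first exact: expR_ge0.
  rewrite ler_expR lerN2 /m; apply: ler_piMl; first exact: mulr_ge0.
  by rewrite gerBl.
rewrite mulr_sumr; apply: ler_sum => b _.
rewrite /z /w -mulrBl normcM normc_real (ger0_norm (expR_ge0 _)).
rewrite [X in _ <= X](_ : _ = (v * `|y b| ^+ 3 / 2) * 2); last by field.
by apply: ler_pM; rewrite ?normc_ge0 ?expR_ge0 //; apply: step_cf_gauss.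
Qed.

End CharacteristicFunctionProduct.

(** * Transitive configurations of integer vectors *)

Section Configuration.
Context (R : realType) (B : finType) (d : nat) (psi : B -> 'rV[int]_d).

Definition rpsi (b : B) : 'rV[R]_d := map_mx intr (psi b).

Definition energy (theta : 'rV[R]_d) : R := \sum_b pairing psi b theta ^+ 2.

Definition gram : 'M[R]_d := \sum_b (rpsi b)^T *m rpsi b.

Definition generating := forall i : 'I_d, exists c : B -> int,
  \sum_b c b *: psi b = delta_mx 0 i.

(** What the argument uses of the symmetries of the space of functions [b |-> <psi b,
    theta>]; the permutation may depend on [theta]. *)
Definition point_transitive := forall (theta : 'rV[R]_d) (b1 b2 : B),
  exists u, exists2 s : {perm B},
  (forall b, pairing psi b u = pairing psi (s b) theta) & s b1 = b2.

Lemma pairing_dot b theta : pairing psi b theta = dot (rpsi b) theta.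
Proof. by rewrite dotE; apply: eq_bigr => i _; rewrite mxE. Qed.

Lemma energy_ge0 theta : 0 <= energy theta.
Proof. by apply: sumr_ge0 => b _; apply: sqr_ge0. Qed.

Lemma qf_gram theta : qf gram theta = energy theta.
Proof.
rewrite /qf /gram mulmx_sumr /dot mulmx_suml summxE; apply: eq_bigr => b _.
rewrite mulmxA -mulmxA [LHS]mxE big_ord1 pairing_dot expr2; congr (_ * _).
by rewrite dotC.
Qed.

Lemma gram_sym : gram^T = gram.
Proof.
rewrite /gram raddf_sum; apply: eq_bigr => b _ /=.
by rewrite trmx_mul trmxK.
Qed.

Section Gen.
Hypothesis gen : generating.

(** Integer coefficients are what later turns integral corrections of the pairings into
    integral corrections of [theta]. *)
Lemma coord_pairing : exists c : 'I_d -> B -> int, forall (theta : 'rV[R]_d) i,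
  theta 0 i = \sum_b (c i b)%:~R * pairing psi b theta.
Proof.
have [c hc] := choice gen; exists c => theta i.
have : \sum_b (c i b)%:~R * pairing psi b theta = dot (map_mx intr (\sum_b c i b *: psi b)) theta.
  rewrite map_mx_sum.
  rewrite (big_morph (fun x => dot x theta) (fun x y => dotDl x y theta) (dot0l theta)).
  by apply: eq_bigr => b _; rewrite map_mxZ dotZl pairing_dot.
rewrite hc => ->; rewrite dotE (bigD1 i) //= big1 => [|j ji].
  by rewrite !mxE !eqxx mul1r addr0.
by rewrite !mxE eqxx (negPf ji) mul0r.
Qed.

Lemma pairing_inj (theta : 'rV[R]_d) : (forall b, pairing psi b theta = 0) -> theta = 0.
Proof.
have [c hc] := coord_pairing => h; apply/rowP => i; rewrite hc big1 ?mxE // => b _.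
by rewrite h mulr0.
Qed.

Lemma gram_posdef : posdef gram.
Proof.
split; first exact: gram_sym.
move=> y y0; rewrite qf_gram lt_def energy_ge0 andbT; apply: contra_neq y0 => e.
apply: pairing_inj => b; apply/eqP; rewrite -sqrf_eq0.
by move/eqP: e; rewrite psumr_eq0 => [/allP/(_ b)|? _]; [rewrite mem_index_enum => /(_ isT) | exact: sqr_ge0].
Qed.

Hypothesis tr : point_transitive.

Lemma energy_perm (u : 'rV[R]_d) (s : {perm B}) (theta : 'rV[R]_d) : (forall b, pairing psi b u = pairing psi (s b) theta) ->
  energy u = energy theta.
Proof.
move=> h; rewrite /energy [RHS](reindex_inj (@perm_inj _ s)) /=.
by apply: eq_bigr => b _; rewrite h.
Qed.

(** The leverage score [h b = qf (invmx gram) (rpsi b)] is the maximum of [<psi b, theta>^2]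
    over vectors [theta] of energy at most 1. By transitivity all the scores are equal, and
    they sum to the trace of the identity. *)
Lemma leverage theta b : #|B|%:R * pairing psi b theta ^+ 2 <= d%:R * energy theta.
Proof.
have pG := gram_posdef; have uG := posdef_unit pG.
pose h b := qf (invmx gram) (rpsi b).
have cs b' (th : 'rV[R]_d) : pairing psi b' th ^+ 2 <= h b' * energy th.
  by rewrite pairing_dot -qf_gram; apply: posdef_cauchy.
have ext b' : exists th, pairing psi b' th = h b' /\ energy th = h b'.
  exists (rpsi b' *m invmx gram).
  have wG : rpsi b' *m invmx gram *m gram = rpsi b' by rewrite mulmxKV.
  rewrite -qf_gram /h (qf_invE uG wG) pairing_dot /qf wG; split => //; exact: dotC.
have hle b1 b2 : h b2 <= h b1.
  have [th [e1 e2]] := ext b2; have [u [s us sb]] := tr th b1 b2.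
  have := cs b1 u; rewrite us sb (energy_perm us) e1 e2 expr2.
  have h0 : 0 <= h b2 by rewrite -e2 energy_ge0.
  have [->|n0] := eqVneq (h b2) 0; last by rewrite ler_pM2r // lt_def n0.
  by have [th1 [_ <-]] := ext b1 => _; apply: energy_ge0.
have hsum : \sum_b h b = d%:R.
  have -> : d%:R = \tr (gram *m invmx gram) by rewrite mulmxV // mxtrace1.
  rewrite /gram mulmx_suml raddf_sum; apply: eq_bigr => b' _ /=.
  by rewrite -mulmxA mxtrace_mulC /h /qf /dot -mulmxA /mxtrace big_ord1 mulmxA.
have hb : #|B|%:R * h b <= d%:R.
  rewrite -hsum mulr_natl -sumr_const; apply: ler_sum => i _; exact: hle.
apply: le_trans (ler_wpM2r (energy_ge0 theta) hb).
by rewrite -mulrA ler_wpM2l.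
Qed.

Context (F : 'M[int]_d) (c2 c3 k : nat).
Hypothesis F_nonsing : \det F != 0.
Hypothesis F_bound : forall b j, `|(psi b *m F) 0 j| <= c2%:Z.
Hypothesis dual : forall r : B -> R,
  (forall g : B -> int, \sum_b `|g b| <= c3%:Z -> \sum_b g b *: psi b = 0 ->
     \sum_b (g b)%:~R * r b = 0) ->
  exists theta, forall b, r b = pairing psi b theta.
Hypothesis d_gt0 : (0 < d)%N.
Hypothesis c2_gt0 : (0 < c2)%N.
Hypothesis c3_gt0 : (0 < c3)%N.
Hypothesis k_gt0 : (0 < k)%N.
Hypothesis k_large : ((4 * d * c2 * c3) ^ d < 2 ^ k)%N.

Lemma relation_pairing (g : B -> int) (theta : 'rV[R]_d) : \sum_b g b *: psi b = 0 ->
  \sum_b (g b)%:~R * pairing psi b theta = 0.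
Proof.
move=> /(congr1 (map_mx (intr : int -> R))); rewrite map_mx_sum map_mx0 => h.
transitivity (dot (\sum_b map_mx (intr : int -> R) (g b *: psi b)) theta); last by rewrite h dot0l.
rewrite (big_morph (fun x => dot x theta) (fun x y => dotDl x y theta) (dot0l theta)).
by apply: eq_bigr => b _; rewrite map_mxZ dotZl pairing_dot.
Qed.

(** With [M = 4 * d * c2 * c3], the bound [sup_dist_le_avg] is at most [1 / (4 * c3) + 1 /
    (4 * c3)], so a relation of length at most [c3] between the residues has an integral
    value of modulus less than 1. The relations between the [psi b] therefore hold between
    the residues, which are the pairings of some vector. *)
Lemma residues_lift (theta : 'rV[R]_d) :
  \sum_b dZ (pairing psi b theta) < #|B|%:R / (4 * c3%:R * k%:R) ->
  exists z : 'rV[int]_d, forall b,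
    pairing psi b (theta - map_mx intr z) = fpart (pairing psi b theta).
Proof.
move=> small.
have B0 : 0 < #|B|%:R :> R.
  rewrite lt_def ler0n andbT; apply: contraTneq small => ->; rewrite mul0r -leNgt.
  by apply: sumr_ge0 => b _; apply: dZ_ge0.
have c3R : 0 < c3%:R :> R by rewrite ltr0n.
have kR : 0 < k%:R :> R by rewrite ltr0n.
have dR : 0 < d%:R :> R by rewrite ltr0n.
have c2R : 0 < c2%:R :> R by rewrite ltr0n.
have sup b : dZ (pairing psi b theta) <= 1 / (2 * c3%:R).
  have M0 : (0 < 4 * d * c2 * c3)%N by rewrite !muln_gt0 d_gt0 c2_gt0 c3_gt0.
  apply: le_trans (sup_dist_le_avg F_nonsing F_bound _ b M0 k_large) _; first exact: tr.
  rewrite !natrM (_ : d%:R * c2%:R / (4 * d%:R * c2%:R * c3%:R) = 1 / (4 * c3%:R)); last first.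
    by field; rewrite !gt_eqF.
  have : k%:R * ((\sum_b0 dZ (pairing psi b0 theta)) / #|B|%:R) <= 1 / (4 * c3%:R).
    rewrite mulrA ler_pdivrMr // -ler_pdivlMl //.
    by apply: le_trans (ltW small) _; rewrite le_eqVlt; apply/orP; left; apply/eqP; field; rewrite !gt_eqF.
  have -> : 1 / (2 * c3%:R) = 1 / (4 * c3%:R) + 1 / (4 * c3%:R) :> R by field; rewrite gt_eqF.
  by move=> h; apply: lerD.
have [th hth] : exists th, forall b, fpart (pairing psi b theta) = pairing psi b th.
  apply: dual => g g1 g0.
  pose n := - \sum_b g b * rnd (pairing psi b theta).
  have e : \sum_b (g b)%:~R * fpart (pairing psi b theta) = n%:~R.
    transitivity (\sum_b (g b)%:~R * pairing psi b theta - \sum_b (g b * rnd (pairing psi b theta))%:~R).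
      by rewrite -sumrB; apply: eq_bigr => b _; rewrite intrM /fpart; ring.
    by rewrite (relation_pairing theta g0) sub0r /n intrN (raddf_sum (intmul 1%R)).
  have : `|n%:~R : R| < 1.
    rewrite -e; apply: le_lt_trans (ler_norm_sum _ _ _) _.
    apply: (@le_lt_trans _ _ (\sum_b `|(g b)%:~R : R| * (1 / (2 * c3%:R)))).
      by apply: ler_sum => b _; rewrite normrM ler_wpM2l // -/(dZ _) sup.
    rewrite -mulr_suml mulrA mulr1 ltr_pdivrMr ?mulr_gt0 // mul1r.
    apply: (@le_lt_trans _ _ c3%:R); last by rewrite -natrM ltr_nat; lia.
    move: g1; rewrite -(ler_int R) (raddf_sum (intmul 1%R)) /= => g1.
    by apply: le_trans g1; apply: ler_sum => b _; rewrite intr_norm.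
  rewrite e -intr_norm (ltr_int R _ 1) => n1.
  by have -> : n = 0 by lia.
have [c hc] := coord_pairing.
exists (\row_i \sum_b c i b * rnd (pairing psi b theta)) => b.
rewrite hth; congr pairing; apply/rowP => i.
rewrite !mxE !hc (raddf_sum (intmul 1%R)) /= -sumrB; apply: eq_bigr => b' _.
by rewrite -hth /fpart intrM; ring.
Qed.

End Gen.
End Configuration.

(** * Fourier inversion on the torsion points of the torus *)

Section FourierInversion.
Context (R : realType).

Lemma dotNl n (x y : 'rV[R]_n) : dot (- x) y = - dot x y.
Proof. by rewrite -scaleN1r dotZl mulN1r. Qed.

Lemma cis_fpart (x : R) : cis (2 * pi * x) = cis (2 * pi * fpart x).
Proof.
have -> : 2 * pi * fpart x = 2 * pi * x + 2 * pi * (- rnd x)%:~R by rewrite /fpart intrN; ring.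
by rewrite cisD cis_2pi_int mulr1.
Qed.

Lemma cis_eq1 (x : R) : cis (2 * pi * x) = 1 -> x = (rnd x)%:~R.
Proof.
rewrite cis_fpart => -[c _].
have p2 := pi_ge2 R; have pp : 0 <= 2 * (pi : R) by lra.
have := @one_sub_cos_ge R (2 * pi * fpart x); rewrite c subrr.
rewrite normrM (ger0_norm pp) => h.
have {}h : (2 * pi * fpart x) ^+ 2 / 18 <= 0.
  by apply: h; have := dZ_le_half x; rewrite /dZ; nra.
have : (2 * pi * fpart x) ^+ 2 <= 0 by lra.
rewrite exprn_even_le0 //= !mulf_eq0 pnatr_eq0 /= gt_eqF ?pi_gt0 //= => /eqP e.
by rewrite -[LHS](subrK (rnd x)%:~R) -/(fpart x) e add0r.
Qed.

Lemma cisX (x : R) k : cis x ^+ k = cis (x * k%:R).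
Proof.
elim: k => [|k IH]; first by rewrite mulr0 cis0.
by rewrite exprS IH -cisD -(natr1 k) mulrDr mulr1 addrC.
Qed.

Lemma cis_sum (I : finType) (F : I -> R) : cis (\sum_i F i) = \prod_i cis (F i).
Proof. by elim/big_rec2: _ => [|i a b _ <-]; rewrite ?cis0 ?cisD. Qed.

(** Orthogonality of characters: a geometric sum over roots of unity. *)
Lemma root_sum (N : nat) (n : int) : (0 < N)%N -> `|n| < N%:Z ->
  \sum_(k < N) cis (2 * pi * (n%:~R * (k%:R / N%:R)) : R) = if n == 0 then N%:R else 0.
Proof.
move=> N0 nN; have NR : N%:R != 0 :> R by rewrite pnatr_eq0 -lt0n.
case: eqP => [->|/eqP n0].
  under eq_bigr do rewrite mul0r mulr0 cis0.
  by rewrite sumr_const card_ord.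
set w := cis (2 * pi * (n%:~R / N%:R)) : R[i].
have -> : \sum_(k < N) cis (2 * pi * (n%:~R * (k%:R / N%:R))) = \sum_(k < N) w ^+ k.
  by apply: eq_bigr => k _; rewrite cisX; congr cis; ring.
have w1 : w != 1.
  apply/eqP => /cis_eq1 /(congr1 (fun x => x * N%:R)); rewrite divfK // => e.
  have {}e : n = rnd (n%:~R / N%:R : R) * N%:Z.
    by apply/eqP; rewrite -(eqr_int R) intrM {1}e.
  have : N%:Z <= `|n|.
    rewrite e normrM; set m := rnd _ in e *.
    have m0 : m != 0 by apply: contra_neq n0 => m0; rewrite e m0 mul0r.
    by rewrite -[X in X <= _]mul1r ler_pM //; lia.
  by rewrite leNgt nN.
have wN : w ^+ N = 1.
  by rewrite cisX -[RHS](cis_2pi_int R n); congr cis; field.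
apply/eqP; have := subrX1 w N; rewrite wN subrr => /esym /eqP.
by rewrite mulf_eq0 subr_eq0 (negPf w1).
Qed.

Context (d : nat).

Definition tpt (N : nat) (k : {ffun 'I_d -> 'I_N}) : 'rV[R]_d := \row_i ((k i)%:R / N%:R).

Lemma torus_sum (N : nat) (n : 'rV[int]_d) : (0 < N)%N -> (forall i, `|n 0 i| < N%:Z) ->
  \sum_(k : {ffun 'I_d -> 'I_N}) cis (2 * pi * dot (map_mx intr n) (tpt k))
    = if n == 0 then (N ^ d)%:R else 0.
Proof.
move=> N0 nN.
have -> : \sum_(k : {ffun 'I_d -> 'I_N}) cis (2 * pi * dot (map_mx intr n) (tpt k)) =
   \sum_(k : {ffun 'I_d -> 'I_N}) \prod_i cis (2 * pi * ((n 0 i)%:~R * ((k i)%:R / N%:R)) : R).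
  apply: eq_bigr => k _; rewrite -cis_sum; congr cis.
  by rewrite dotE mulr_sumr; apply: eq_bigr => i _; rewrite !mxE.
rewrite -(bigA_distr_bigA (fun i (j : 'I_N) => cis (2 * pi * ((n 0 i)%:~R * (j%:R / N%:R)) : R))) /=.
under eq_bigr do rewrite root_sum //.
case: eqP => [->|/eqP n0].
  under eq_bigr do rewrite mxE eqxx.
  by rewrite prodr_const card_ord natrX.
have [i ni] : exists i, n 0 i != 0.
  apply/existsP; apply: contraNT n0; rewrite negb_exists => /forallP h.
  by apply/eqP/rowP => i; rewrite mxE; apply/eqP; rewrite -[_ == _]negbK h.
by rewrite (bigD1 i) //= (negPf ni) mul0r.
Qed.

Context (B : finType) (psi : B -> 'rV[int]_d) (p : R) (lam : 'rV[int]_d).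

Definition wt (J : {set B}) : R := \prod_b (if b \in J then p else 1 - p).

(** The probability that the sum of [psi] over a [p]-random subset of [B] is [lam]. *)
Definition law : R := \sum_(J : {set B}) wt J * (\sum_(b in J) psi b == lam)%:R.

(** Includes the phase of [lam], so that its mean over the torus is [law]. *)
Definition cf (theta : 'rV[R]_d) : R[i] :=
  (\prod_b step_cf p (2 * pi * pairing psi b theta)) *
  cis (- (2 * pi * dot (map_mx intr lam) theta)).

Lemma cf_sum theta : cf theta =
  \sum_(J : {set B}) (wt J)%:C * cis (2 * pi * dot (map_mx intr (\sum_(b in J) psi b - lam)) theta).
Proof.
rewrite /cf; under eq_bigr do rewrite /step_cf addrC.
rewrite bigA_distr mulr_suml; apply: eq_bigr => J _.
have -> : \prod_b (if b \in J then p%:C * cis (2 * pi * pairing psi b theta) else (1 - p)%:C) =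
   (wt J)%:C * cis (\sum_b (if b \in J then 2 * pi * pairing psi b theta else 0)).
  rewrite /wt -prod_realc cis_sum -big_split /=; apply: eq_bigr => b _.
  by case: (b \in J); rewrite ?cis0 ?mulr1.
rewrite -mulrA -cisD; congr (_ * cis _).
rewrite -big_mkcond /= map_mxB map_mx_sum dotDl dotNl mulrBr; congr (_ - _).
rewrite (big_morph (fun x => dot x theta) (fun x y => dotDl x y theta) (dot0l theta)).
by rewrite mulr_sumr; apply: eq_bigr => b _; rewrite pairing_dot.
Qed.

(** Exact for every [N] exceeding all coordinates of [psi (J) - lam]: no value other than
    [lam] is then congruent to [lam] modulo [N]. *)
Lemma fourier_inversion (N : nat) : (0 < N)%N ->
  (forall (J : {set B}) i, `|(\sum_(b in J) psi b - lam) 0 i| < N%:Z) ->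
  law%:C * (N ^ d)%:R = \sum_(k : {ffun 'I_d -> 'I_N}) cf (tpt k).
Proof.
move=> N0 small; under eq_bigr do rewrite cf_sum.
rewrite exchange_big /= /law (raddf_sum (real_complex R)) /= mulr_suml.
apply: eq_bigr => J _; rewrite -mulr_sumr torus_sum // subr_eq0 rmorphM /= -mulrA.
congr (_ * _); case: eqP => _; last by rewrite mul0r.
by rewrite mul1r.
Qed.

End FourierInversion.

(** * The characteristic function compared with a Gaussian one *)

Section NearOrigin.
Context (R : realType) (B : finType) (d : nat) (psi : B -> 'rV[int]_d) (p : R) (lam : 'rV[int]_d).
Hypothesis gen : generating psi.
Hypothesis tr : point_transitive R psi.
Hypothesis d_gt0 : (0 < d)%N.
Hypothesis p01 : 0 < p < 1.

Definition var1 : R := p * (1 - p).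
Definition sigma2 : R := var1 * #|B|%:R.
Definition cov_psi : 'M[R]_d := var1 *: gram R psi.
Definition mean_psi : 'rV[R]_d := p *: \sum_b rpsi R psi b.
Definition offset : 'rV[R]_d := map_mx intr lam - mean_psi.
(** The largest order of energy for which [leverage] keeps every angle [2 * pi * <psi b,
    theta>] bounded by 2 and the quartic terms below the fraction of the exponent given up
    in [slack]. *)
Definition radius2 : R := #|B|%:R / (16 * d%:R ^+ 2).
Definition err0 : R := 1024 * d%:R ^+ 2 / Num.sqrt sigma2.
Definition gauss_cf (theta : 'rV[R]_d) : R[i] :=
  (expR (- (2 * pi ^+ 2 * qf cov_psi theta)))%:C * cis (- (2 * pi * dot offset theta)).
(** Scaling the covariance by this factor costs its determinant a factor [slack ^+ d >= 1 /
    2]. *)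
Definition slack : R := 1 - 1 / (2 * d%:R).

Lemma var1_gt0 : 0 < var1.
Proof. by have /andP[p0 p1] := p01; rewrite mulr_gt0 // subr_gt0. Qed.

Lemma sigma2_ge0 : 0 <= sigma2.
Proof. by rewrite mulr_ge0 // ltW // var1_gt0. Qed.

Lemma qf_cov theta : qf cov_psi theta = var1 * energy psi theta.
Proof. by rewrite qfZ qf_gram. Qed.

Let dR : 0 < d%:R :> R. Proof. by rewrite ltr0n. Qed.

Lemma pairing_small theta b : energy psi theta < radius2 ->
  pairing psi b theta ^+ 2 <= 1 / (16 * d%:R).
Proof.
move=> small.
have B0 : 0 < #|B|%:R :> R by rewrite ltr0n; apply/card_gt0P; exists b.
have := leverage gen tr theta b; rewrite -ler_pdivlMl // => h; apply: le_trans h _.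
rewrite ler_pdivrMl //.
have -> : #|B|%:R * (1 / (16 * d%:R)) = d%:R * radius2 by rewrite /radius2; field; rewrite gt_eqF.
by rewrite ler_wpM2l // ltW.
Qed.

(** Absorbs the polynomial growth of the cubic error into the Gaussian weight. *)
Lemma w_sqrt_le (w : R) : 0 <= w -> w * Num.sqrt w <= 2 * expR w.
Proof.
move=> w0.
have s0 := sqrtr_ge0 w; have s2 : Num.sqrt w ^+ 2 = w by rewrite sqr_sqrtr.
have h1 := expR_ge1Dx w; have := expR_ge1Dxn 1 w0; rewrite (_ : (2`!)%:R = 2) // => h2.
have h3 : Num.sqrt w <= w / 4 + 1 by have := sqr_ge0 (Num.sqrt w / 2 - 1); nra.
have : w * Num.sqrt w <= w * (w / 4 + 1) by rewrite ler_wpM2l.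
nra.
Qed.

Lemma err0_ge0 : 0 <= err0.
Proof.
by apply: divr_ge0; [apply: mulr_ge0; [exact: ler0n | exact: sqr_ge0] | exact: sqrtr_ge0].
Qed.

(** By [leverage] the sum of cubes in [cf_near_gauss], weighted by [p * (1 - p)], is at most
    [w ^ (3 / 2) / sqrt sigma2] up to a factor of order [d ^+ 2], where [w = qf cov_psi
    theta / d]; the polynomial factor is then traded against part of the exponent, between
    [1 - 1 / (3 * d)] and [slack]. *)
Lemma near_gauss theta : energy psi theta < radius2 ->
  normc (cf psi p lam theta - gauss_cf theta) <=
    err0 * expR (- (2 * pi ^+ 2 * qf (slack *: cov_psi) theta)).
Proof.
move=> small; have /andP[p0 p1] := p01.
have B0 : 0 < #|B|%:R :> R.
  rewrite lt_def ler0n andbT; apply: contraTneq small; rewrite /radius2 => ->.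
  by rewrite mul0r -leNgt energy_ge0.
have v0 := var1_gt0; have s0 : 0 < sigma2 by rewrite mulr_gt0.
have pi0 := pi_gt0 R; have pi2 := pi_ge2 R.
have pi4 : (pi : R) <= 4 by have := pihalf_lt2 R; lra.
have pisq1 : 4 <= (pi : R) ^+ 2 by nra.
have pisq2 : (pi : R) ^+ 2 <= 16 by nra.
pose y b := 2 * pi * pairing psi b theta.
set q := qf cov_psi theta.
have qE : q = var1 * energy psi theta by apply: qf_cov.
have q0 : 0 <= q by rewrite qE mulr_ge0 ?energy_ge0 // ltW.
have -> : cf psi p lam theta = (\prod_b (step_cf p (y b) * cis (- (p * y b)))) *
    cis (- (2 * pi * dot offset theta)).
  rewrite big_split /= -[RHS]mulrA -cis_sum -cisD /cf; congr (_ * cis _).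
  rewrite /offset dotDl dotNl /mean_psi dotZl sumrN -mulr_sumr -mulr_sumr.
  rewrite (big_morph (fun x => dot x theta) (fun x y => dotDl x y theta) (dot0l theta)).
  have -> : \sum_b dot (rpsi R psi b) theta = \sum_b pairing psi b theta.
    by apply: eq_bigr => b _; rewrite pairing_dot.
  by ring.
rewrite /gauss_cf -mulrBl normcM normc_cis mulr1.
have ysq : \sum_b (y b ^+ 2 / 2) = 2 * pi ^+ 2 * energy psi theta.
  by rewrite /energy mulr_sumr; apply: eq_bigr => b _; rewrite /y; field.
have p01' : 0 <= p <= 1 by rewrite !ltW.
have ps b := pairing_small b small.
have inv_d : 1 / (16 * d%:R) <= 1 / 16 :> R.
  by rewrite !div1r lef_pV2 ?posrE ?mulr_gt0 // ler_peMr // ler1n.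
have y2 b : `|y b| <= 2.
  rewrite -(@ler_pXn2r _ 2) ?nnegrE // real_normK ?num_real // /y !exprMn.
  have h1 := ps b; have h2 := sqr_ge0 (pairing psi b theta); nra.
have yk b : y b ^+ 2 / 12 <= 1 / (3 * d%:R).
  have -> : 1 / (3 * d%:R) = 64 * (1 / (16 * d%:R)) / 12 :> R by field; rewrite gt_eqF.
  rewrite ler_wpM2r // /y !exprMn.
  apply: le_trans (ler_wpM2l _ (ps b)); last by [].
  by rewrite ler_wpM2r ?sqr_ge0 //; nra.
have k01 : 0 <= (1 / (3 * d%:R) : R) <= 1.
  have d3 : 0 < 3 * d%:R :> R by rewrite mulr_gt0.
  apply/andP; split; first by rewrite divr_ge0 // ltW.
  by rewrite ler_pdivrMr // mul1r -natrM ler1n muln_gt0 d_gt0.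
have := cf_near_gauss p01' k01 y2 yk; rewrite -/var1 ysq.
have -> : var1 * (2 * pi ^+ 2 * energy psi theta) = 2 * pi ^+ 2 * q by rewrite qE; ring.
move=> h; apply: le_trans h _.
pose w := q / d%:R.
have w0 : 0 <= w by rewrite divr_ge0 // ltW.
pose Y := 8 * d%:R * Num.sqrt w / Num.sqrt sigma2.
have ss : 0 < Num.sqrt sigma2 by rewrite sqrtr_gt0.
have Y0 : 0 <= Y by rewrite divr_ge0 ?mulr_ge0 ?sqrtr_ge0 // ltW.
have yY b : `|y b| <= Y.
  rewrite -(@ler_pXn2r _ 2) ?nnegrE // real_normK ?num_real //.
  have -> : Y ^+ 2 = 64 * (d%:R * energy psi theta / #|B|%:R).
    rewrite /Y !exprMn exprVn !sqr_sqrtr ?(ltW s0) // /w qE /sigma2.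
    by field; rewrite !gt_eqF.
  rewrite /y !exprMn; apply: ler_pM; [by nra | exact: sqr_ge0 | by nra | ].
  by rewrite ler_pdivlMr // mulrC; apply: leverage.
(* One factor of each cube is bounded by [Y]; the remaining squares add up to the energy. *)
have cube : var1 * \sum_b `|y b| ^+ 3 <= err0 * expR w.
  have h1 : \sum_b `|y b| ^+ 3 <= Y * (64 * energy psi theta).
    rewrite /energy !mulr_sumr; apply: ler_sum => b _; rewrite exprS.
    apply: ler_pM => //.
    by rewrite real_normK ?num_real // /y !exprMn ler_wpM2r ?sqr_ge0 //; nra.
  apply: (@le_trans _ _ (512 * d%:R ^+ 2 / Num.sqrt sigma2 * (w * Num.sqrt w))).
    apply: le_trans (ler_wpM2l (ltW v0) h1) _.
    rewrite le_eqVlt; apply/orP; left; apply/eqP; rewrite /Y /w qE.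
    by field; rewrite !gt_eqF.
  have -> : err0 * expR w = 512 * d%:R ^+ 2 / Num.sqrt sigma2 * (2 * expR w) by rewrite /err0; ring.
  apply: ler_wpM2l; last exact: w_sqrt_le.
  by apply: divr_ge0; [apply: mulr_ge0; [exact: ler0n | exact: sqr_ge0] | exact: sqrtr_ge0].
apply: (@le_trans _ _ (err0 * expR w * expR (- ((1 - 1 / (3 * d%:R)) * (2 * pi ^+ 2 * q))))).
  by rewrite ler_wpM2r ?expR_ge0.
rewrite -mulrA -expRD; apply: ler_wpM2l; first exact: err0_ge0.
rewrite ler_expR qfZ -/q /slack /w.
have -> : - (2 * pi ^+ 2 * ((1 - 1 / (2 * d%:R)) * q)) =
   q / d%:R * (pi ^+ 2 / 3 - 1) + (q / d%:R + - ((1 - 1 / (3 * d%:R)) * (2 * pi ^+ 2 * q))).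
  by move: (pi : R) => P; field; rewrite gt_eqF.
rewrite lerDr mulr_ge0 //; lra.
Qed.

(** In this range the exponent given up in [slack] is at least of order [sigma2 / d ^+ 3],
    which makes the Gaussian itself an error term. *)
Lemma far_gauss theta : d%:R ^+ 2 <= sigma2 -> radius2 <= energy psi theta ->
  normc (gauss_cf theta) <= err0 * expR (- (2 * pi ^+ 2 * qf (slack *: cov_psi) theta)).
Proof.
move=> hd big.
have s0 : 0 < sigma2 by apply: lt_le_trans hd; rewrite exprn_gt0.
rewrite /gauss_cf normcM normc_cis mulr1 normc_real (ger0_norm (expR_ge0 _)) qfZ.
set q := qf cov_psi theta.
have hq : sigma2 / (16 * d%:R ^+ 2) <= q.
  by rewrite /q qf_cov /sigma2 -mulrA ler_wpM2l // ltW // var1_gt0.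
have pi2 := pi_ge2 R; have pisq1 : 4 <= (pi : R) ^+ 2 by nra.
have -> : - (2 * pi ^+ 2 * q) = - (pi ^+ 2 * q / d%:R) + - (2 * pi ^+ 2 * (slack * q)).
  by rewrite /slack; move: (pi : R) => P; field; rewrite gt_eqF.
rewrite expRD ler_wpM2r ?expR_ge0 // expRN.
have q0 : 0 <= q by rewrite /q qf_cov mulr_ge0 ?energy_ge0 // ltW // var1_gt0.
have d16 : 0 < 16 * d%:R ^+ 2 :> R by rewrite mulr_gt0 // exprn_gt0.
have d4 : 0 < 4 * d%:R ^+ 3 :> R by rewrite mulr_gt0 // exprn_gt0.
set x := pi ^+ 2 * q / d%:R.
have hx : sigma2 / (4 * d%:R ^+ 3) <= x.
  rewrite /x (_ : sigma2 / (4 * d%:R ^+ 3) = 4 * (sigma2 / (16 * d%:R ^+ 2)) / d%:R).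
    apply: ler_wpM2r; first by rewrite invr_ge0 ltW.
    by apply: ler_pM => //; rewrite divr_ge0 // ltW.
  by field; rewrite gt_eqF.
have ss : 0 < Num.sqrt sigma2 by rewrite sqrtr_gt0.
have sd : d%:R <= Num.sqrt sigma2.
  by rewrite -(@ler_pXn2r _ 2) ?nnegrE ?sqrtr_ge0 // sqr_sqrtr // ltW.
have s2 : sigma2 = Num.sqrt sigma2 ^+ 2 by rewrite sqr_sqrtr // ltW.
rewrite invf_ple ?posrE ?expR_gt0 //; last first.
  by apply: divr_gt0; [apply: mulr_gt0; [rewrite ltr0n | exact: exprn_gt0] | exact: ss].
apply: le_trans (_ : x <= _); last by apply: le_trans (expR_ge1Dx x); rewrite lerDr.
apply: le_trans hx; rewrite /err0 invf_div {2}s2.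
set t := Num.sqrt sigma2 in ss sd *; rewrite (expr2 t).
rewrite ler_pdivrMr; last by apply: mulr_gt0; [rewrite ltr0n | exact: exprn_gt0].
have -> : t * t / (4 * d%:R ^+ 3) * (1024 * d%:R ^+ 2) = t * (256 * (t / d%:R)) by field; rewrite gt_eqF.
rewrite ler_peMr // ?ltW //.
have : 1 <= t / d%:R by rewrite ler_pdivlMr // mul1r.
lra.
Qed.

End NearOrigin.

(** * From the torus to the whole space *)

Section Unfolding.
Context (R : realType) (B : finType) (d : nat) (psi : B -> 'rV[int]_d) (p : R) (lam : 'rV[int]_d).
Hypothesis gen : generating psi.
Hypothesis tr : point_transitive R psi.
Hypothesis d_gt0 : (0 < d)%N.
Hypothesis p01 : 0 < p < 1.
Context (tau : R).
Hypothesis tau_ge0 : 0 <= tau.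
Hypothesis far : forall theta : 'rV[R]_d,
  (forall z : 'rV[int]_d, radius2 R B d <= energy psi (theta - map_mx intr z)) ->
  normc (cf psi p lam theta) <= tau.

Lemma dot_int (n z : 'rV[int]_d) : exists m : int, dot (map_mx intr n) (map_mx intr z) = m%:~R :> R.
Proof.
exists (\sum_i n 0 i * z 0 i); rewrite dotE (raddf_sum (intmul 1%R)) /=.
by apply: eq_bigr => i _; rewrite !mxE intrM.
Qed.

Lemma cf_periodic theta (z : 'rV[int]_d) :
  cf psi p lam (theta + map_mx intr z) = cf psi p lam theta.
Proof.
rewrite /cf; congr (_ * _).
  apply: eq_bigr => b _; rewrite pairingD (pairing_dot psi b (map_mx _ z)).
  have [m hm] := dot_int (psi b) z; rewrite [dot _ _]hm /step_cf.
  have -> : 2 * pi * (pairing psi b theta + m%:~R) = 2 * pi * pairing psi b theta + 2 * pi * m%:~R by ring.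
  by rewrite cisD cis_2pi_int mulr1.
have [m hm] := dot_int lam z.
rewrite dotDr hm; set x := dot _ _.
have -> : - (2 * pi * (x + m%:~R)) = - (2 * pi * x) + 2 * pi * (- m)%:~R by rewrite intrN; ring.
by rewrite cisD cis_2pi_int mulr1.
Qed.

Lemma energy_small_pairing theta b : energy psi theta < radius2 R B d ->
  `|pairing psi b theta| <= 1 / 4.
Proof.
move=> small; have h := pairing_small gen tr d_gt0 b small.
rewrite -(@ler_pXn2r _ 2) ?nnegrE // real_normK ?num_real //.
apply: le_trans h _; rewrite expr_div_n expr1n !div1r lef_pV2 ?posrE ?mulr_gt0 ?ltr0n //.
by rewrite -natrM -natrX ler_nat; lia.
Qed.

(** The grid points that represent the neighbourhood of the origin in the torus. *)
Definition near_box (N : nat) : {set 'rV['I_(2 * N ^ 2).+1]_d} :=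
  [set k | energy psi (grid R k) < radius2 R B d].

Section Wrap.
Context (N : nat).
Hypothesis N_gt0 : (0 < N)%N.

Definition wrap (k : 'rV['I_(2 * N ^ 2).+1]_d) : {ffun 'I_d -> 'I_N} :=
  [ffun i => Ordinal (ltn_pmod (k 0 i) N_gt0)].

Let NR : N%:R != 0 :> R. Proof. by rewrite pnatr_eq0 -lt0n. Qed.

Lemma grid_wrap k : exists z : 'rV[int]_d, grid R k = tpt R (wrap k) + map_mx intr z.
Proof.
exists (\row_i (((k 0%R i) %/ N)%N%:Z - N%:Z)); apply/rowP => i.
rewrite !mxE ffunE /= intrB -!pmulrn natrX.
have -> : (k 0 i)%:R = (k 0%R i %/ N)%N%:R * N%:R + (k 0%R i %% N)%N%:R :> R.
  by rewrite -natrM -natrD -divn_eq.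
by field.
Qed.

(** Two representatives differ by an integral vector [z], whose pairings are integers of
    modulus at most [1 / 2], hence 0. *)
Lemma wrap_inj : {in near_box N &, injective wrap}.
Proof.
move=> k1 k2; rewrite !inE => s1 s2 e.
have [z1 h1] := grid_wrap k1; have [z2 h2] := grid_wrap k2.
have h : grid R k1 - grid R k2 = map_mx intr (z1 - z2).
  by rewrite h1 h2 e map_mxB opprD addrACA subrr add0r.
have g0 : grid R k1 - grid R k2 = 0.
  apply: (pairing_inj gen) => b.
  have : `|pairing psi b (grid R k1 - grid R k2)| <= 1 / 2.
    rewrite pairingD pairingN; apply: le_trans (ler_normB _ _) _.
    have := energy_small_pairing b s1; have := energy_small_pairing b s2; lra.
  rewrite h pairing_dot; have [m hm] := dot_int (psi b) (z1 - z2); rewrite [dot _ _]hm.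
  move=> hle; have : `|m%:~R : R| < 1 by lra.
  by rewrite -intr_norm (ltr_int R _ 1) => m1; have -> : m = 0 by lia.
apply/rowP => i; move/rowP/(_ i): g0; rewrite !mxE => /eqP; rewrite subr_eq0 => /eqP /(mulIf _).
rewrite invr_eq0 => /(_ NR) /addIr /eqP; rewrite eqr_nat => /eqP; exact: val_inj.
Qed.

Lemma wrap_near (k : {ffun 'I_d -> 'I_N}) (z : 'rV[int]_d) :
  energy psi (tpt R k - map_mx intr z) < radius2 R B d ->
  (forall i, `|(tpt R k - map_mx intr z) 0 i| <= N%:R) ->
  k \in (wrap @: near_box N).
Proof.
move=> small bnd.
have bnd' i : `|(k i)%:Z - N%:Z * z 0 i| <= (N ^ 2)%:Z.
  rewrite -(ler_int R) intr_norm intrB intrM -!pmulrn natrX.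
  have := bnd i; rewrite !mxE => h.
  rewrite (_ : (k i)%:R - N%:R * (z 0 i)%:~R = N%:R * ((k i)%:R / N%:R - (z 0 i)%:~R)); last by field.
  by rewrite normrM expr2 ger0_norm // ler_wpM2l.
(* The index of [tpt R k - z] in the grid; it is in range by [bnd']. *)
pose k' : 'rV['I_(2 * N ^ 2).+1]_d := \row_i inord (absz ((N ^ 2)%:Z + ((k i)%:Z - N%:Z * z 0 i))).
have kv i : (k' 0 i : nat)%:Z = (N ^ 2)%:Z + ((k i)%:Z - N%:Z * z 0 i).
  rewrite mxE inordK; have := bnd' i; lia.
have gk : grid R k' = tpt R k - map_mx intr z.
  apply/rowP => i; transitivity ((k i)%:R / N%:R - (z 0 i)%:~R : R); last by rewrite !mxE.
  rewrite [LHS]mxE natrX (_ : (k' 0 i)%:R = ((k' 0 i : nat)%:Z)%:~R :> R) // kv.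
  by rewrite intrD intrB intrM -!pmulrn natrX; field.
apply/imsetP; exists k'; first by rewrite inE gk.
apply/ffunP => i; apply/val_inj; rewrite ffunE /=.
have N2 : (N ^ 2)%:Z = N%:Z * N%:Z by rewrite -PoszM mulnn.
have := kv i; rewrite N2 => kvi.
have : ((k' 0%R i : nat)%:Z %% N%:Z)%Z = ((k i)%:Z %% N%:Z)%Z.
  rewrite kvi (_ : _ + _ = (N%:Z - z 0 i) * N%:Z + (k i)%:Z); last by ring.
  by rewrite modzMDl.
by rewrite !modz_nat => -[->]; rewrite modn_small.
Qed.

Hypothesis N_large : forall theta : 'rV[R]_d, energy psi theta < radius2 R B d ->
  forall i, `|theta 0 i| <= N%:R.

(** Each torsion point near the origin has exactly one representative in the box; at the
    others the characteristic function is at most [tau]. *)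
Lemma unfold_sum :
  normc (\sum_k cf psi p lam (tpt R (N := N) k) - \sum_(k in near_box N) cf psi p lam (grid R k))
    <= (N ^ d)%:R * tau.
Proof.
rewrite (bigID (mem (wrap @: near_box N))) /= big_imset /=; last exact: wrap_inj.
have -> : \sum_(k in near_box N) cf psi p lam (tpt R (wrap k)) =
          \sum_(k in near_box N) cf psi p lam (grid R k).
  by apply: eq_bigr => k _; have [z ->] := grid_wrap k; rewrite cf_periodic.
rewrite addrAC subrr add0r; apply: le_trans (normc_sum _ _) _.
apply: (@le_trans _ _ (\sum_(k : {ffun 'I_d -> 'I_N}) tau)).
  rewrite big_mkcond /=; apply: ler_sum => k _; case: ifP => // hk.
  apply: far => z; rewrite leNgt; apply: contraT; rewrite negbK => small.
  by rewrite (wrap_near small) // in hk; apply: N_large.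
by rewrite sumr_const card_ffun !card_ord mulr_natl.
Qed.

End Wrap.

Lemma box_bound : exists K : nat, forall theta : 'rV[R]_d, energy psi theta < radius2 R B d ->
  forall i, `|theta 0 i| <= K%:R.
Proof.
have [c hc] := coord_pairing R gen.
exists (\sum_i \sum_b absz (c i b))%N => theta small i.
rewrite hc; apply: le_trans (ler_norm_sum _ _ _) _.
apply: (@le_trans _ _ (\sum_b (absz (c i b))%:R)).
  apply: ler_sum => b _; rewrite normrM natr_absz intr_norm ler_piMr //.
  have := energy_small_pairing b small; lra.
rewrite natr_sum (bigD1 i) //= natr_sum lerDl; apply: sumr_ge0 => j _.
exact: ler0n.
Qed.

Lemma Re_normc (z : R[i]) : `|complex.Re z| <= normc z.
Proof.
case: z => a b; rewrite /normc /= -sqrtr_sqr ler_sqrt ?addr_ge0 ?sqr_ge0 //.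
by rewrite lerDl sqr_ge0.
Qed.

Hypothesis d2_le : d%:R ^+ 2 <= sigma2 B p.

(** The sum over the box is compared term by term with the Gaussian sum, inside the radius
    by [near_gauss] and outside by [far_gauss]. *)
Lemma law_gsum (N : nat) : (0 < N)%N ->
  (forall theta : 'rV[R]_d, energy psi theta < radius2 R B d -> forall i, `|theta 0 i| <= N%:R) ->
  (forall (J : {set B}) i, `|(\sum_(b in J) psi b - lam) 0 i| < N%:Z) ->
  `|law psi p lam - gsum (cov_psi psi p) (offset psi p lam) N| <=
    tau + err0 B d p * gsum (slack R d *: cov_psi psi p) 0 N.
Proof.
move=> N0 hN hlam.
have Nd : 0 < (N ^ d)%:R :> R by rewrite ltr0n expn_gt0 N0.
pose G := \sum_(k : 'rV['I_(2 * N ^ 2).+1]_d) gauss_cf psi p lam (grid R k).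
have diff : normc ((law psi p lam)%:C * (N ^ d)%:R - G) <=
    (N ^ d)%:R * tau + \sum_(k : 'rV['I_(2 * N ^ 2).+1]_d)
       err0 B d p * expR (- (2 * pi ^+ 2 * qf (slack R d *: cov_psi psi p) (grid R k))).
  rewrite (fourier_inversion p N0 hlam).
  have -> : \sum_k cf psi p lam (tpt R (N:=N) k) - G =
    (\sum_k cf psi p lam (tpt R (N:=N) k) - \sum_(k in near_box N) cf psi p lam (grid R k)) +
    (\sum_(k in near_box N) cf psi p lam (grid R k) - G) by ring.
  apply: le_trans (le_normcD _ _) _; apply: lerD; first exact: unfold_sum.
  rewrite /G big_mkcond -sumrB; apply: le_trans (normc_sum _ _) _.
  apply: ler_sum => k _; rewrite inE; case: ltP => hk; first exact: near_gauss.
  by rewrite sub0r normcN; apply: far_gauss.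
have ReG : complex.Re G = \sum_(k : 'rV['I_(2 * N ^ 2).+1]_d)
     expR (- (2 * pi ^+ 2 * qf (cov_psi psi p) (grid R k))) * cos (2 * pi * dot (offset psi p lam) (grid R k)).
  rewrite /G raddf_sum; apply: eq_bigr => k _.
  by rewrite /gauss_cf /cis /= mul0r subr0 cosN.
have := le_trans (Re_normc _) diff.
have -> : complex.Re ((law psi p lam)%:C * (N ^ d)%:R - G) = law psi p lam * (N ^ d)%:R - complex.Re G.
  rewrite raddfB /=; congr (_ - _).
  have -> : (N ^ d)%:R = ((N ^ d)%:R : R)%:C :> R[i] by rewrite rmorph_nat.
  by rewrite /= mulr0 subr0.
rewrite ReG => h.
rewrite -(ler_pM2l Nd) -[X in X * `|_|](ger0_norm (ltW Nd)) -normrM mulrBr.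
rewrite /gsum -natrX mulVKf ?gt_eqF // mulrC; apply: le_trans h _.
rewrite mulrDr lerD2l [X in _ <= X]mulrCA mulVKf ?gt_eqF //.
rewrite mulr_sumr le_eqVlt; apply/orP; left; apply/eqP; apply: eq_bigr => k _.
by rewrite dot0l mulr0 cos0 mulr1.
Qed.

Lemma slack_gt0 : 0 < slack R d.
Proof.
rewrite /slack subr_gt0 ltr_pdivrMr ?mulr_gt0 ?ltr0n // mul1r -natrM ltr1n.
by apply: (@leq_trans (2 * 1)); rewrite ?leq_mul2l.
Qed.

Lemma cov_posdef : posdef (cov_psi psi p).
Proof. by apply: posdefZ; [exact: var1_gt0 | exact: gram_posdef]. Qed.

Lemma law_gval :
  `|law psi p lam - gval (cov_psi psi p) (offset psi p lam)| <=
    tau + err0 B d p * gval (slack R d *: cov_psi psi p) 0.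
Proof.
have [K hK] := box_bound.
pose K2 := (\sum_(J : {set B}) \sum_i absz ((\sum_(b in J) psi b - lam)%R 0%R i))%N.
have c1 := gsum_cvg (x := offset psi p lam) cov_posdef.
have c2 := gsum_cvg (x := 0) (posdefZ slack_gt0 cov_posdef).
have c3 : `|law psi p lam - gsum (cov_psi psi p) (offset psi p lam) N| @[N --> \oo] -->
   `|law psi p lam - gval (cov_psi psi p) (offset psi p lam)|.
  by apply: cvg_norm; apply: cvgB => //; exact: cvg_cst.
have c4 : tau + err0 B d p * gsum (slack R d *: cov_psi psi p) 0 N @[N --> \oo] -->
    tau + err0 B d p * gval (slack R d *: cov_psi psi p) 0.
  by apply: cvgD; [exact: cvg_cst | apply: cvgM => //; exact: cvg_cst].
apply: (ler_cvg_to c3 c4); near=> N; apply: law_gsum.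
- by near: N; exact: nbhs_infty_gt.
- move=> theta small i; apply: le_trans (hK theta small i) _; rewrite ler_nat.
  by near: N; exact: nbhs_infty_ge.
- move=> J i; suff : (absz ((\sum_(b in J) psi b - lam)%R 0%R i) < N)%N by lia.
  apply: (@leq_ltn_trans K2); last by near: N; exact: nbhs_infty_gt.
  by rewrite /K2 (bigD1 J) //= (bigD1 i) //= -addnA leq_addr.
Unshelve. all: by end_near. Qed.

End Unfolding.

(** * The local limit theorem in lattice coordinates *)

Section Core.
Context (R : realType).

Lemma det_posdef n (S : 'M[R]_n) : posdef S -> 0 < \det S.
Proof.
elim: n S => [|n IH] S pS; first by rewrite det_mx00.
rewrite (@schur_det R n S pS) mulr_gt0 //; first exact: (@schur_a_gt0 R n S).
by apply: IH; exact: (@schur_posdef R n S).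
Qed.

Lemma fact_le_exp n : (n`! <= n ^ n)%N.
Proof.
elim: n => // n IH; rewrite factS expnS leq_mul2l /=.
by apply: leq_trans IH _; case: n => [|n] //; rewrite leq_exp2r.
Qed.

Lemma bernoulli_ineq (x : R) n : 0 <= x <= 1 -> 1 - n%:R * x <= (1 - x) ^+ n.
Proof.
move=> /andP[x0 x1]; elim: n => [|n IH]; first by rewrite mul0r subr0.
rewrite exprS; have : (1 - x) * (1 - n%:R * x) <= (1 - x) * (1 - x) ^+ n.
  by rewrite ler_wpM2l // subr_ge0.
have : 0 <= n%:R * x * x by rewrite !mulr_ge0.
by rewrite -(natr1 n); lra.
Qed.

(** A Hadamard-type bound, with the factorial of the Leibniz formula in place of the sharp
    constant. *)
Lemma det_entry_bound n (A : 'M[R]_n) (K : R) : 0 <= K -> (forall i j, `|A i j| <= K) ->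
  `|\det A| <= (n%:R * K) ^+ n.
Proof.
move=> K0 hA; rewrite /determinant; apply: le_trans (ler_norm_sum _ _ _) _.
apply: (@le_trans _ _ (\sum_(s : 'S_n) K ^+ n)).
  apply: ler_sum => s _; rewrite normrM normrX normrN1 expr1n mul1r normr_prod.
  apply: (@le_trans _ _ (\prod_(i < n) K)); last by rewrite prodr_const card_ord.
  by apply: ler_prod => i _; rewrite normr_ge0 hA.
rewrite sumr_const card_Sn -[X in X <= _]mulr_natl exprMn ler_wpM2r ?exprn_ge0 //.
by rewrite -natrX ler_nat fact_le_exp.
Qed.

Context (B : finType) (d : nat) (psi : B -> 'rV[int]_d) (p : R) (lam : 'rV[int]_d).
Context (F : 'M[int]_d) (c2 c3 k : nat).
Hypothesis gen : generating psi.
Hypothesis tr : point_transitive R psi.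
Hypothesis d_gt0 : (0 < d)%N.
Hypothesis p01 : 0 < p < 1.
Hypothesis F_nonsing : \det F != 0.
Hypothesis F_bound : forall b j, `|(psi b *m F) 0 j| <= c2%:Z.
Hypothesis dual : forall r : B -> R,
  (forall g : B -> int, \sum_b `|g b| <= c3%:Z -> \sum_b g b *: psi b = 0 ->
     \sum_b (g b)%:~R * r b = 0) ->
  exists theta, forall b, r b = pairing psi b theta.
Hypothesis c2_gt0 : (0 < c2)%N.
Hypothesis c3_gt0 : (0 < c3)%N.
Hypothesis k_gt0 : (0 < k)%N.
Hypothesis k_large : ((4 * d * c2 * c3) ^ d < 2 ^ k)%N.

Local Notation S := (cov_psi psi p).
Local Notation s := (sigma2 B p).

(** The mean over [b] of the squared distance of [<psi b, theta>] to the integers is at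
    least this large away from the origin of the torus. *)
Definition spread : R := Num.min ((1 / (4 * c3%:R * k%:R)) ^+ 2) (1 / (16 * d%:R ^+ 2)).

(** If the distances to the integers are small on average, they are the pairings of a
    representative of [theta], whose energy is large by hypothesis; otherwise Cauchy-Schwarz
    bounds the sum of their squares from below. *)
Lemma far_cf (theta : 'rV[R]_d) :
  (forall z : 'rV[int]_d, radius2 R B d <= energy psi (theta - map_mx intr z)) ->
  normc (cf psi p lam theta) <= expR (- (s / 2 * spread)).
Proof.
move=> hz; have v0 := var1_gt0 p01.
rewrite /cf normcM normc_cis mulr1.
have p01' : 0 <= p <= 1 by have /andP[p0 p1] := p01; rewrite !ltW.
apply: le_trans (normc_prod_far _ p01') _; rewrite ler_expR lerN2.
have -> : s / 2 * spread = var1 p / 2 * (#|B|%:R * spread) by rewrite /sigma2; ring.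
rewrite -/(var1 p); apply: ler_wpM2l; first by rewrite divr_ge0 // ltW.
have [small|big] := ltP (\sum_b dZ (pairing psi b theta)) (#|B|%:R / (4 * c3%:R * k%:R)).
  have [z hzz] := residues_lift gen tr F_nonsing F_bound dual d_gt0 c2_gt0 c3_gt0 k_gt0 k_large small.
  have -> : \sum_b dZ (pairing psi b theta) ^+ 2 = energy psi (theta - map_mx intr z).
    by apply: eq_bigr => b _; rewrite hzz /dZ real_normK // num_real.
  apply: le_trans (hz z); rewrite /radius2; apply: ler_wpM2l; first exact: ler0n.
  by rewrite -[X in _ <= X]div1r /spread ge_min lexx orbT.
have [B0|B0] := posnP #|B|.
  by rewrite B0 mul0r; apply: sumr_ge0 => b _; apply: sqr_ge0.
have BR : 0 < #|B|%:R :> R by rewrite ltr0n.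
set e := 1 / (4 * c3%:R * k%:R) : R.
have e0 : 0 <= e by rewrite divr_ge0 // !mulr_ge0.
have big' : #|B|%:R * e <= \sum_b dZ (pairing psi b theta) by rewrite /e mul1r.
apply: (@le_trans _ _ (#|B|%:R * e ^+ 2)).
  by rewrite ler_wpM2l // /spread ge_min lexx.
have h : 0 <= \sum_b (dZ (pairing psi b theta) - e) ^+ 2.
  by apply: sumr_ge0 => b _; apply: sqr_ge0.
have : \sum_b (dZ (pairing psi b theta) - e) ^+ 2 =
  \sum_b dZ (pairing psi b theta) ^+ 2 - 2 * e * (\sum_b dZ (pairing psi b theta)) + #|B|%:R * e ^+ 2.
  rewrite mulr_sumr -sumrB (_ : #|B|%:R * e ^+ 2 = \sum_(b : B) e ^+ 2).
    by rewrite -big_split /=; apply: eq_bigr => b _; ring.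
  by rewrite sumr_const mulr_natl.
move=> e2; rewrite e2 in h.
have : 2 * e * (#|B|%:R * e) <= 2 * e * \sum_b dZ (pairing psi b theta).
  by rewrite ler_wpM2l // mulr_ge0.
by lra.
Qed.

(** An integral nonsingular [F] has a determinant of modulus at least 1, and the matrix [F^T
    *m cov_psi *m F] has entries bounded in terms of [c2]. *)
Lemma det_cov_le : \det S <= (d%:R * (s * c2%:R ^+ 2)) ^+ d.
Proof.
have v0 := var1_gt0 p01; have s0 := @sigma2_ge0 _ B p p01.
pose FR : 'M[R]_d := map_mx intr F.
have dS := det_posdef (cov_posdef gen p01).
pose A := FR^T *m S *m FR.
have dA : \det A = (\det FR) ^+ 2 * \det S by rewrite !det_mulmx det_tr; ring.
have F1 : 1 <= (\det FR) ^+ 2.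
  rewrite det_map_mx -rmorphXn /= (ler_int R 1).
  have : `|\det F| >= 1 by have := F_nonsing; lia.
  by move=> h; rewrite -(real_normK (num_real _)) expr_ge1.
apply: (@le_trans _ _ (\det A)); first by rewrite dA ler_peMl // ltW.
apply: le_trans (ler_norm _) _; apply: det_entry_bound.
  by rewrite mulr_ge0 // sqr_ge0.
move=> i j.
have -> : A i j = var1 p * \sum_b ((psi b *m F) 0 i)%:~R * ((psi b *m F) 0 j)%:~R.
  rewrite /A -scalemxAr -scalemxAl mxE; congr (_ * _).
  rewrite /gram mulmx_sumr mulmx_suml summxE; apply: eq_bigr => b _.
  rewrite mulmxA -trmx_mul -mulmxA /rpsi -!map_mxM [LHS]mxE big_ord1 !mxE.
  by [].
rewrite normrM (ger0_norm (ltW v0)) /sigma2 -mulrA ler_wpM2l ?(ltW v0) //.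
apply: le_trans (ler_norm_sum _ _ _) _.
rewrite mulr_natl -sumr_const; apply: ler_sum => b _.
have hb l : `|((psi b *m F) 0 l)%:~R : R| <= c2%:R.
  by have := F_bound b l; rewrite -(ler_int R) intr_norm.
by rewrite normrM expr2; apply: ler_pM.
Qed.

(** The inverse of the maximum of the Gaussian density. *)
Definition peak : R := Num.sqrt ((2 * pi) ^+ d * \det S).

Hypothesis d2_le : d%:R ^+ 2 <= s.
Hypothesis spread_large : 2 * d%:R * ln (8 * d%:R * c2%:R ^+ 2 * s) <= s * spread.

(** Multiplied by [peak], the error of [near_gauss] and [far_gauss] integrates to at most
    twice its relative size, since the covariance reduced by [slack] has a peak at most
    twice as high. The characteristic function away from the origin is at most [X ^- d] with
    [X = 8 * d * c2 ^+ 2 * s], which beats [peak <= X ^ (d / 2)]. *)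
Lemma core_bound :
  `|law psi p lam * peak - expR (- (qf (invmx S) (offset psi p lam) / 2))|
    <= 2049 * d%:R ^+ 2 / Num.sqrt s.
Proof.
have dR : 1 <= d%:R :> R by rewrite ler1n.
have d2 : 1 <= d%:R ^+ 2 :> R by rewrite expr_ge1 // (le_trans ler01).
have s1 : 1 <= s by apply: le_trans d2_le.
have s0 : 0 < s by apply: lt_le_trans s1.
have c2R : 1 <= c2%:R :> R by rewrite ler1n.
have dS := det_posdef (cov_posdef gen p01).
have pi0 := pi_gt0 R.
have pi4 : (pi : R) <= 4 by have := pihalf_lt2 R; lra.
have pk2 : 0 < (2 * pi) ^+ d * \det S by rewrite mulr_gt0 // exprn_gt0 // mulr_gt0.
have pk0 : 0 < peak by rewrite sqrtr_gt0.
have ss0 : 0 < Num.sqrt s by rewrite sqrtr_gt0.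
set tau := expR (- (s / 2 * spread)).
have := law_gval gen tr d_gt0 p01 (expR_ge0 _) far_cf d2_le; rewrite -/tau.
set E0 := err0 B d p.
have E00 : 0 <= E0 by apply: err0_ge0.
have -> : gval S (offset psi p lam) = peak^-1 * expR (- (qf (invmx S) (offset psi p lam) / 2)) by [].
set ex := expR _.
(* Bernoulli's inequality for the determinant of the reduced covariance. *)
have gs : gval (slack R d *: S) 0 <= 2 * peak^-1.
  rewrite /gval qf0 mul0r oppr0 expR0 mulr1 detZ.
  have sl0 := slack_gt0 R d_gt0.
  have -> : (2 * pi) ^+ d * (slack R d ^+ d * \det S) = slack R d ^+ d * ((2 * pi) ^+ d * \det S) by ring.
  have sld : 0 <= slack R d ^+ d by apply: exprn_ge0; exact: ltW.
  rewrite sqrtrM // (_ : Num.sqrt ((2 * pi) ^+ d * \det S) = peak) // invfM.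
  apply: ler_wpM2r; first by rewrite invr_ge0 ltW.
  have h : 1 / 4 <= slack R d ^+ d.
    apply: le_trans (bernoulli_ineq d _).
      by rewrite (_ : d%:R * (1 / (2 * d%:R)) = 1 / 2); [lra | field; rewrite gt_eqF // (lt_le_trans ltr01)].
    have dd : 0 < 2 * d%:R :> R by rewrite mulr_gt0 // (lt_le_trans ltr01).
    by rewrite divr_ge0 ?(ltW dd) //= ler_pdivrMr // mul1r; lra.
  have : Num.sqrt ((1 / 2) ^+ 2) <= Num.sqrt (slack R d ^+ d).
    by rewrite ler_sqrt //; lra.
  rewrite sqrtr_sqr ger0_norm // => h2.
  have h3 : 0 < Num.sqrt (slack R d ^+ d) by apply: lt_le_trans h2; lra.
  by rewrite invf_ple ?posrE //; lra.
(* Both factors are compared through their squares, with [tau ^+ 2 <= X ^- (2 * d)] and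
   [peak ^+ 2 <= X ^+ d]; the remaining [X ^- d] is at most [1 / s]. *)
have taup : tau * peak <= 1 / Num.sqrt s.
  have hX := spread_large; set X := 8 * d%:R * c2%:R ^+ 2 * s in hX.
  have c22 : 1 <= c2%:R ^+ 2 :> R by rewrite expr_ge1 // (le_trans ler01).
  have Xs : s <= X.
    rewrite /X ler_peMl ?(ltW s0) // mulr_ege1 //; lra.
  have X1 : 1 <= X by apply: le_trans Xs.
  have X0 : 0 < X by apply: lt_le_trans X1.
  have t2 : tau ^+ 2 <= (X ^+ (2 * d))^-1.
    have lX : expR (ln X) = X by rewrite lnK ?posrE.
    rewrite /tau -expRM_natl -lX -expRM_natl -expRN ler_expR.
    by rewrite mulrN lerN2 natrM; apply: le_trans hX _; lra.
  have p2 : peak ^+ 2 <= X ^+ d.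
    rewrite sqr_sqrtr ?(ltW pk2) //.
    apply: (@le_trans _ _ ((2 * pi) ^+ d * (d%:R * (s * c2%:R ^+ 2)) ^+ d)).
      by rewrite ler_wpM2l ?det_cov_le // exprn_ge0 // mulr_ge0 // ltW.
    have y0 : 0 <= d%:R * (s * c2%:R ^+ 2).
      by apply: mulr_ge0; [lra | apply: mulr_ge0; lra].
    rewrite -exprMn; apply: lerXn2r; rewrite ?nnegrE ?(ltW X0) //.
      by apply: mulr_ge0 => //; lra.
    have -> : X = 8 * (d%:R * (s * c2%:R ^+ 2)) by rewrite /X; ring.
    by apply: ler_wpM2r => //; lra.
  rewrite -(@ler_pXn2r _ 2) ?nnegrE ?mulr_ge0 ?expR_ge0 ?(ltW pk0) ?divr_ge0 ?(ltW ss0) //.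
  rewrite exprMn expr_div_n expr1n (sqr_sqrtr (ltW s0)).
  apply: (@le_trans _ _ ((X ^+ (2 * d))^-1 * X ^+ d)).
    by exact: (ler_pM (sqr_ge0 _) (sqr_ge0 _) t2 p2).
  rewrite mul2n -addnn exprD invfM -mulrA mulVf ?mulr1 ?gt_eqF ?exprn_gt0 // div1r.
  rewrite lef_pV2 ?posrE ?exprn_gt0 //; apply: le_trans Xs _.
  by rewrite -[X in X <= _]expr1; apply: ler_weXn2l.
move=> h.
have -> : law psi p lam * peak - ex = (law psi p lam - peak^-1 * ex) * peak.
  by rewrite mulrBl mulrAC mulVf ?gt_eqF // mul1r.
rewrite normrM (ger0_norm (ltW pk0)).
apply: le_trans (ler_wpM2r (ltW pk0) h) _; rewrite mulrDl.
have e2 : E0 * gval (slack R d *: S) 0 * peak <= 2 * E0.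
  have -> : 2 * E0 = E0 * (2 * peak^-1) * peak by field; rewrite gt_eqF.
  by rewrite ler_wpM2r ?(ltW pk0) // ler_wpM2l.
apply: le_trans (lerD taup e2) _; rewrite /E0 /err0.
have -> : 2049 * d%:R ^+ 2 / Num.sqrt s = d%:R ^+ 2 / Num.sqrt s + 2 * (1024 * d%:R ^+ 2 / Num.sqrt s) by ring.
by rewrite lerD2r ler_wpM2r // invr_ge0 ltW.
Qed.

End Core.

(** * The hypothesis on the size of the set *)

Section Constants.
Context (R : realType).

Lemma ln2_ge : 1 / 2 <= ln 2 :> R.
Proof.
rewrite -ler_expR lnK ?posrE //.
have e0 := expR_gt0 (1 / 2 : R).
have := expR_ge1Dx (- (1 / 2) : R); rewrite expRN.
rewrite (_ : 1 - 1 / 2 = 2^-1 :> R); last by field.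
by rewrite lef_pV2 ?posrE.
Qed.

Lemma ln_le_sub (x : R) : 0 < x -> ln x <= x - 1.
Proof. by move=> x0; have := expR_ge1Dx (ln x); rewrite lnK ?posrE //; lra. Qed.

Lemma le_ln (x y : R) : 0 < x -> x <= y -> ln x <= ln y.
Proof. by move=> x0 xy; rewrite ler_ln ?posrE //; apply: lt_le_trans xy. Qed.

(** The threshold of the theorem, without its constant. *)
Definition main_scale (d c2 c3 : R) : R := c2 * c3 ^+ 2 * d ^+ 6 * ln (2 * c3 * d) ^+ 6.

Lemma sampling_size (d c2 c3 : nat) : (0 < d)%N -> (0 < c2)%N -> (0 < c3)%N ->
  exists k, [/\ (0 < k)%N, ((4 * d * c2 * c3) ^ d < 2 ^ k)%N &
   k%:R <= 1 + 2 * d%:R * ln (4 * d%:R * c2%:R * c3%:R) :> R].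
Proof.
move=> d0 c20 c30; set M := (4 * d * c2 * c3)%N.
have M0 : (0 < M)%N by rewrite !muln_gt0 d0 c20 c30.
exists (trunc_log 2 (M ^ d)).+1; split => //; first by apply: trunc_log_ltn.
rewrite -natr1 addrC lerD2l.
set t := trunc_log 2 (M ^ d).
have tle : (2 ^ t <= M ^ d)%N by apply: trunc_logP => //; rewrite expn_gt0 M0.
have : ln ((2 ^ t)%:R : R) <= ln ((M ^ d)%:R : R).
  by apply: le_ln; rewrite ?ler_nat // ltr0n expn_gt0.
rewrite !natrX !lnXn ?ltr0n // (_ : M%:R = 4 * d%:R * c2%:R * c3%:R :> R); last by rewrite /M !natrM.
set l := ln (4 * _ * _ * _).
rewrite -(mulr_natl (ln 2) t) -(mulr_natl l d).
have := ln2_ge; have : 0 <= t%:R :> R by exact: ler0n.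
by move=> t0 h2 h; nra.
Qed.

Lemma lnM5 (a b c e f : R) : 0 < a -> 0 < b -> 0 < c -> 0 < e -> 0 < f ->
  ln (a * b * c * e * f) = ln a + ln b + ln c + ln e + ln f.
Proof.
move=> a0 b0 c0 e0 f0; rewrite (@lnM _ (a * b * c * e)) ?posrE ?mulr_gt0 //.
rewrite (@lnM _ (a * b * c)) ?posrE ?mulr_gt0 // (@lnM _ (a * b)) ?posrE ?mulr_gt0 //.
by rewrite (@lnM _ a) ?posrE.
Qed.

(** With [h = c2 ^ (1 / 4)], [L = ln (2 * c3 * d)] and [s = w ^+ 2 * main_scale], both sides
    are compared with the monomial [d * L ^+ 4 * w * h ^+ 2]. The fourth root is there
    because [ln c2 <= 4 * (h - 1)], so that the logarithms of [c2] in [K] and in the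
    left-hand side cost only powers of [h], of which [main_scale] contains four. *)
Lemma scale_controls_spread (d c2 c3 s K : R) : 1 <= d -> 1 <= c2 -> 1 <= c3 -> 0 < K ->
  K <= 1 + 2 * d * ln (4 * d * c2 * c3) ->
  (10 ^+ 7) ^+ 2 * main_scale d c2 c3 <= s ->
  d ^+ 2 <= s /\
  2 * d * ln (8 * d * c2 ^+ 2 * s) <=
    s * Num.min ((1 / (4 * c3 * K)) ^+ 2) (1 / (16 * d ^+ 2)).
Proof.
move=> d1 c21 c31 K0 K_le s_large.
have d0 : 0 < d by lra.
have c20 : 0 < c2 by lra.
have c30 : 0 < c3 by lra.
pose L := ln (2 * c3 * d); pose h := Num.sqrt (Num.sqrt c2).
have L_ge : ln 2 <= L.
  by apply: le_ln => //; rewrite -mulrA ler_peMr // mulr_ege1.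
have L_half : 1 / 2 <= L by apply: le_trans ln2_ge L_ge.
have L0 : 0 < L by lra.
have h1 : 1 <= h.
  by rewrite -sqrtr1 ler_sqrt ?sqrtr_ge0 // -sqrtr1 ler_sqrt // ltW.
have h0 : 0 < h by lra.
have h4 : h ^+ 4 = c2.
  by rewrite -[4%N]/(2 * 2)%N exprM sqr_sqrtr ?sqrtr_ge0 // sqr_sqrtr // ltW.
have lnc2 : ln c2 <= 4 * (h - 1).
  by rewrite -h4 lnXn // -(mulr_natl (ln h) 4) ler_wpM2l // ln_le_sub.
have Lh0 : 0 <= (L - 1 / 2) * (h - 1) by rewrite mulr_ge0 // subr_ge0.
have K_bound : K <= 24 * (d * L * h).
  have e : ln (4 * d * c2 * c3) = ln 2 + L + ln c2.
    rewrite /L (_ : 4 * d * c2 * c3 = 2 * (2 * c3 * d) * c2); last by ring.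
    by rewrite (lnM (x := 2 * (2 * c3 * d))) ?posrE ?mulr_gt0 // (lnM (x := 2)) ?posrE ?mulr_gt0.
  have b1 : ln (4 * d * c2 * c3) <= 8 * L * h by rewrite e; lra.
  have b2 : d * ln (4 * d * c2 * c3) <= d * (8 * L * h) by rewrite ler_wpM2l //; lra.
  have b3 : 1 <= 2 * (d * L * h).
    have : 1 * (1 / 2) <= d * L by apply: ler_pM => //; lra.
    nra.
  lra.
have M0 : 0 < main_scale d c2 c3.
  by rewrite /main_scale -/L; apply: mulr_gt0; rewrite ?exprn_gt0 // mulr_gt0 ?exprn_gt0 // mulr_gt0 ?exprn_gt0.
have s0 : 0 < s by apply: lt_le_trans s_large; rewrite mulr_gt0 // !exprn_gt0.
pose w := Num.sqrt (s / main_scale d c2 c3).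
have wsq : w ^+ 2 = s / main_scale d c2 c3 by rewrite sqr_sqrtr // divr_ge0 // ltW.
have w_ge : 10 ^+ 7 <= w.
  by rewrite -(@ler_pXn2r _ 2) ?nnegrE ?sqrtr_ge0 ?exprn_ge0 // wsq ler_pdivlMr.
have w1 : 1 <= w by apply: le_trans w_ge; rewrite exprn_ege1 // ler1n.
have w0 : 0 < w by lra.
have sE : s = w ^+ 2 * main_scale d c2 c3 by rewrite wsq divfK // gt_eqF.
have ME : main_scale d c2 c3 = h ^+ 4 * c3 ^+ 2 * d ^+ 6 * L ^+ 6 by rewrite h4.
have L4 : L <= 8 * L ^+ 4.
  have l3 : 1 / 8 <= L ^+ 3.
    have -> : 1 / 8 = (1 / 2) ^+ 3 :> R by field.
    by rewrite ler_pXn2r // nnegrE; lra.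
  rewrite exprS; nra.
have L41 : 1 <= 16 * L ^+ 4 by lra.
set mn := Num.min _ _.
pose e1 := 1 / (96 ^+ 2 * (c3 ^+ 2 * (d ^+ 2 * (L ^+ 2 * h ^+ 2)))).
have den0 : 0 < 96 ^+ 2 * (c3 ^+ 2 * (d ^+ 2 * (L ^+ 2 * h ^+ 2))).
  by rewrite mulr_gt0 ?exprn_gt0 // mulr_gt0 ?exprn_gt0 // mulr_gt0 ?exprn_gt0 // mulr_gt0 ?exprn_gt0.
have mn_ge : e1 <= mn.
  rewrite /mn le_min; apply/andP; split.
    have -> : e1 = (1 / (4 * c3 * (24 * (d * L * h)))) ^+ 2.
      by rewrite /e1; field; rewrite !gt_eqF.
    rewrite ler_pXn2r ?nnegrE ?divr_ge0 // ?mulr_ge0 ?(ltW c30) ?(ltW d0) ?(ltW L0) ?(ltW h0) ?(ltW K0) //.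
    rewrite !div1r lef_pV2 ?posrE; first by rewrite ler_wpM2l // mulr_ge0 // ltW.
      by rewrite !mulr_gt0.
    by rewrite !mulr_gt0.
  rewrite /e1 !div1r lef_pV2 ?posrE ?mulr_gt0 ?exprn_gt0 //.
  have t1 : 1 <= c3 ^+ 2 by rewrite exprn_ege1.
  have t2 : 1 / 4 <= L ^+ 2.
    have -> : 1 / 4 = (1 / 2) ^+ 2 :> R by field.
    by rewrite ler_pXn2r // nnegrE; lra.
  have t3 : 1 <= h ^+ 2 by rewrite exprn_ege1.
  have t4 : 1 / 4 <= L ^+ 2 * h ^+ 2 by nra.
  have t5 : 0 < d ^+ 2 by rewrite exprn_gt0.
  have t6 : d ^+ 2 * (1 / 4) <= d ^+ 2 * (L ^+ 2 * h ^+ 2) by rewrite ler_wpM2l // ltW.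
  have t7 : d ^+ 2 * (L ^+ 2 * h ^+ 2) <= c3 ^+ 2 * (d ^+ 2 * (L ^+ 2 * h ^+ 2)).
    by rewrite ler_peMl // mulr_ge0 ?(ltW t5) //; lra.
  lra.
have main : s * e1 = w ^+ 2 * (h ^+ 2 * d ^+ 4 * L ^+ 4) / 96 ^+ 2.
  by rewrite sE ME /e1; field; rewrite !gt_eqF.
have lns : ln (8 * d * c2 ^+ 2 * s) <= 16 * L + 2 * w + 12 * h.
  have X0 : 0 < 8 * d * c2 ^+ 2 * s by rewrite !mulr_gt0 ?exprn_gt0.
  have le1 : 8 * d * c2 ^+ 2 * s <= 2 ^+ 3 * (2 * c3 * d) ^+ 7 * L ^+ 6 * w ^+ 2 * h ^+ 12.
    pose Y := L ^+ 6 * w ^+ 2 * h ^+ 12 * d ^+ 7.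
    have -> : 8 * d * c2 ^+ 2 * s = 8 * Y * c3 ^+ 2 by rewrite sE ME -h4 /Y; ring.
    have -> : 2 ^+ 3 * (2 * c3 * d) ^+ 7 * L ^+ 6 * w ^+ 2 * h ^+ 12 = 8 * Y * (2 ^+ 7 * c3 ^+ 7).
      by rewrite /Y; ring.
    apply: ler_wpM2l.
      apply: mulr_ge0; first exact: ler0n.
      by apply: ltW; rewrite /Y mulr_gt0 ?exprn_gt0 // mulr_gt0 ?exprn_gt0 // mulr_gt0 ?exprn_gt0.
    apply: (@le_trans _ _ (c3 ^+ 7)); first by apply: ler_weXn2l.
    by rewrite ler_peMl ?exprn_ge0 ?(ltW c30) // exprn_ege1 // ler1n.
  apply: le_trans (le_ln X0 le1) _.
  have q1 : 0 < 2 * c3 * d by rewrite !mulr_gt0.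
  rewrite lnM5 ?exprn_gt0 //.
  rewrite !lnXn // -/L -(mulr_natl (ln 2) 3) -(mulr_natl L 7) -(mulr_natl (ln L) 6).
  rewrite -(mulr_natl (ln w) 2) -(mulr_natl (ln h) 12).
  have := ln_le_sub L0; have := ln_le_sub w0; have := ln_le_sub h0; lra.
split.
  rewrite sE ME.
  have r1 : 1 <= h ^+ 4 * c3 ^+ 2 by rewrite mulr_ege1 // exprn_ege1.
  have r2 : d ^+ 2 <= d ^+ 6 by apply: ler_weXn2l.
  have r3 : 1 / 64 <= L ^+ 6.
    have -> : 1 / 64 = (1 / 2) ^+ 6 :> R by field.
    by rewrite ler_pXn2r // nnegrE; lra.
  have r4 : 64 <= w ^+ 2.
    have : 10 <= w by apply: le_trans w_ge; rewrite exprS ler_peMr // exprn_ege1 // ler1n.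
    nra.
  have r5 : d ^+ 2 * 1 <= d ^+ 6 * (L ^+ 6 * w ^+ 2).
    apply: ler_pM => //; first by rewrite exprn_ge0 // ltW.
    have : 1 / 64 * 64 <= L ^+ 6 * w ^+ 2 by apply: ler_pM => //; lra.
    lra.
  apply: (@le_trans _ _ (d ^+ 6 * (L ^+ 6 * w ^+ 2))); first by lra.
  rewrite (_ : w ^+ 2 * _ = h ^+ 4 * c3 ^+ 2 * (d ^+ 6 * (L ^+ 6 * w ^+ 2))); last by ring.
  by rewrite ler_peMl // !mulr_ge0 ?exprn_ge0 // ltW.
apply: (@le_trans _ _ (s * e1)); last by rewrite ler_wpM2l // ltW.
rewrite main.
pose T := L ^+ 4 * (w * h ^+ 2).
have T1 : 16 * L <= 128 * T.
  have : 1 * 1 <= w * h ^+ 2 by apply: ler_pM => //; rewrite exprn_ege1.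
  rewrite mulr1 => wh; have : L ^+ 4 * 1 <= T by rewrite ler_wpM2l // exprn_ge0 // ltW.
  lra.
have T2 : 2 * w <= 32 * T.
  have : w * 1 <= w * h ^+ 2 by rewrite ler_wpM2l ?(ltW w0) // exprn_ege1.
  rewrite mulr1 => wh; have : 1 * w <= 16 * L ^+ 4 * (w * h ^+ 2).
    by apply: ler_pM => //; exact: ltW.
  rewrite /T; lra.
have T3 : 12 * h <= 192 * T.
  have : 1 * h <= w * h ^+ 2.
    by apply: ler_pM => //; [exact: ltW | rewrite expr2 ler_peMr // ltW].
  rewrite mul1r => wh; have : 1 * h <= 16 * L ^+ 4 * (w * h ^+ 2).
    by apply: ler_pM => //; exact: ltW.
  rewrite /T; lra.
have T0 : 0 <= T by rewrite /T !mulr_ge0 ?exprn_ge0 // ltW.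
apply: (@le_trans _ _ (2 * d * (352 * T))).
  apply: ler_wpM2l; first by rewrite mulr_ge0 // ltW.
  by apply: le_trans lns _; lra.
rewrite ler_pdivlMr ?exprn_gt0 //.
have -> : w ^+ 2 * (h ^+ 2 * d ^+ 4 * L ^+ 4) = (d * T) * (d ^+ 3 * w) by rewrite /T; ring.
(* The constant [10 ^+ 7] of the hypothesis only has to exceed [704 * 96 ^+ 2]. *)
have -> : 2 * d * (352 * T) * 96 ^+ 2 = (d * T) * (704 * 96 ^+ 2) by ring.
apply: ler_wpM2l; first by rewrite mulr_ge0 // ltW.
apply: (@le_trans _ _ (10 ^+ 7)); first by lra.
apply: le_trans w_ge _; rewrite ler_peMl ?(ltW w0) // exprn_ege1 //.
Qed.

End Constants.

(** * A basis of the lattice *)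

Section LatticeCoordinates.

Lemma common_denominator m n (P : 'M[rat]_(m, n)) :
  exists (N : int) (M : 'M[int]_(m, n)), N != 0 /\ N%:~R *: P = map_mx intr M.
Proof.
pose N : int := \prod_i \prod_j denq (P i j).
have dv i j : exists z : int, N%:~R * P i j = z%:~R.
  have [q hq] : exists q, N = q * denq (P i j).
    exists ((\prod_(i' | i' != i) \prod_j' denq (P i' j')) * \prod_(j' | j' != j) denq (P i j')).
    by rewrite /N (bigD1 i) //= (bigD1 j) //=; ring.
  exists (q * numq (P i j)); rewrite hq !intrM -mulrA; congr (_ * _).
  by rewrite mulrC numqE.
have [f hf] := choice (fun ij : 'I_m * 'I_n => dv ij.1 ij.2).
exists N, (\matrix_(i, j) f (i, j)); split.
  by apply/prodf_neq0 => i _; apply/prodf_neq0 => j _; apply: denq_neq0.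
by apply/matrixP => i j; rewrite !mxE -(hf (i, j)).
Qed.

(** Smith normal form [M = L *m D *m U] of an integral multiple of [P]: the first [n]
    columns of [L] are the coordinates of the rows of [P] in the lattice basis [D *m U]. The
    left inverse [Li] expresses that the rows of [Psi] generate [Z^n]. *)
Lemma lattice_coords m n (P : 'M[rat]_(m, n)) : \rank P = n ->
  exists (Psi : 'M[int]_(m, n)) (Bt : 'M[rat]_n) (Li : 'M[int]_(n, m)),
    [/\ P = map_mx intr Psi *m Bt, Li *m Psi = 1%:M & Bt \in unitmx].
Proof.
move=> rP; have nm : (n <= m)%N by rewrite -rP rank_leq_row.
have [N [M [N0 eM]]] := common_denominator P.
have [L uL [U uU [s _ eS]]] := int_Smith_normal_form M.
pose w := widen_ord nm.
pose Psi : 'M[int]_(m, n) := \matrix_(i, j) L i (w j).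
pose Bz : 'M[int]_n := \matrix_(i, j) (s`_i * U i j).
have eM' : M = Psi *m Bz.
  rewrite eS; apply/matrixP => i j; rewrite !mxE; apply: eq_bigr => k _.
  rewrite !mxE (bigD1 (w k)) //= big1 => [|l lk].
    by rewrite addr0 !mxE eqxx mulr1n mulrA.
  rewrite !mxE (_ : (l == k :> nat) = false) ?mulr0n ?mulr0 //.
  by apply: contraNF lk => /eqP e; apply/eqP/val_inj.
pose Bt : 'M[rat]_n := N%:~R^-1 *: map_mx intr Bz.
have NQ : N%:~R != 0 :> rat by rewrite intr_eq0.
have eP : P = map_mx intr Psi *m Bt.
  by rewrite /Bt -scalemxAr -map_mxM -eM' -eM scalerA mulVf // scale1r.
exists Psi, Bt, (\matrix_(i, j) (invmx L) (w i) j); split => //.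
  apply/matrixP => i j; have /matrixP /(_ (w i) (w j)) := mulVmx uL.
  by rewrite !mxE => <-; apply: eq_bigr => k _; rewrite !mxE.
rewrite -row_full_unit /row_full eqn_leq rank_leq_row /= -{1}rP eP.
exact: mxrankM_maxr.
Qed.

End LatticeCoordinates.

Section Reduction.
Context (A B : finType) (V : {vspace ratvec B}) (phi : A -> ratvec B).
Hypothesis hphi : basis_of V (codom phi).

Local Notation d := #|A|.

Lemma dim_card : \dim V = d.
Proof. exact: (size_basis (hphi : basis_of V (codom_tuple phi))). Qed.

Definition pmat : 'M[rat]_(#|B|, d) := \matrix_(j, i) phi (enum_val i) (enum_val j).

Lemma memV_phi (f : ratvec B) :
  f \in V <-> exists c : 'I_d -> rat, forall b, f b = \sum_i c i * phi (enum_val i) b.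
Proof.
have nthc (i : 'I_d) : (codom phi)`_i = phi (enum_val i) by rewrite (nth_codom 0).
have /andP[/eqP sp fr] := hphi.
pose X := (codom_tuple phi).
split => [|[c hc]].
  rewrite -sp => /(@coord_span _ _ _ X) e.
  exists (fun i => coord X i f) => b.
  rewrite {1}e sum_ffunE; apply: eq_bigr => i _; rewrite ffunE nthc //.
have -> : f = \sum_i c i *: phi (enum_val i).
  by apply/ffunP => b; rewrite hc sum_ffunE; apply: eq_bigr => i _; rewrite ffunE.
rewrite -sp; apply: memv_suml => i _; apply: memvZ.
by rewrite -nthc; apply: memv_span; apply: mem_nth; rewrite size_codom.
Qed.

Lemma rank_pmat : \rank pmat = d.
Proof.
have /andP[_ fr] := hphi.
apply/eqP; rewrite -mxrank_tr -/(row_free _); apply: inj_row_free => v v0.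
have nthc (i : 'I_d) : (codom phi)`_i = phi (enum_val i) by rewrite (nth_codom 0).
have /freeP h := (fr : free (codom_tuple phi)).
apply/rowP => i; rewrite mxE.
have cE : #|A| = size (codom phi) by rewrite size_codom.
apply: (h (fun i => v 0 i)).
apply/ffunP => b; rewrite sum_ffunE ffunE.
have /matrixP /(_ 0 (enum_rank b)) := v0; rewrite !mxE => e; rewrite -[RHS]e.
by apply: eq_bigr => j _; rewrite ffunE !mxE enum_rankK nthc.
Qed.

End Reduction.

(** * Translating the hypotheses on the space into lattice coordinates *)

Section LatticeBasis.
Context (A B : finType) (V : {vspace ratvec B}) (phi : A -> ratvec B).
Hypothesis hphi : basis_of V (codom phi).

Local Notation d := #|A|.

Context (Psi : 'M[int]_(#|B|, d)) (Bt : 'M[rat]_d) (Li : 'M[int]_(d, #|B|)).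
Hypothesis pmatE : pmat phi = map_mx intr Psi *m Bt.
Hypothesis LiPsi : Li *m Psi = 1%:M.
Hypothesis uBt : Bt \in unitmx.

(** The coordinates of [eval_at phi b] in the lattice basis [Bt]. *)
Definition psi (b : B) : 'rV[int]_d := row (enum_rank b) Psi.

Lemma phi_psi b i : phi (enum_val i) b = \sum_j (psi b 0 j)%:~R * Bt j i.
Proof.
have /matrixP /(_ (enum_rank b) i) := pmatE; rewrite !mxE enum_rankK => ->.
by apply: eq_bigr => j _; rewrite !mxE.
Qed.

Lemma memV_psi (f : ratvec B) :
  f \in V <-> exists c : 'rV[rat]_d, forall b, f b = \sum_j (psi b 0 j)%:~R * c 0 j.
Proof.
rewrite (memV_phi hphi); split => [[c hc]|[c hc]].
  exists ((\row_i c i) *m Bt^T) => b; rewrite hc.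
  under eq_bigr do rewrite phi_psi mulr_sumr.
  rewrite exchange_big /=; apply: eq_bigr => j _; rewrite !mxE mulr_sumr.
  by apply: eq_bigr => i _; rewrite !mxE mulrCA.
have [c' cE] : exists c', c = c' *m Bt^T.
  by exists (c *m (invmx Bt)^T); rewrite -mulmxA -trmx_mul mulmxV // trmx1 mulmx1.
exists (fun i => c' 0 i) => b; rewrite hc cE; symmetry.
under eq_bigr do rewrite phi_psi mulr_sumr.
rewrite exchange_big /=; apply: eq_bigr => j _; rewrite !mxE mulr_sumr.
by apply: eq_bigr => i _; rewrite !mxE mulrCA.
Qed.

Lemma psi_generating : generating psi.
Proof.
move=> i; exists (fun b => Li i (enum_rank b)); apply/rowP => j.
have /matrixP /(_ i j) := LiPsi; rewrite !mxE summxE eqxx /= => e.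
rewrite [j == i]eq_sym -e.
rewrite [RHS](reindex (@enum_rank B)) /=; last by exists enum_val => k _; rewrite ?enum_rankK ?enum_valK.
by apply: eq_bigr => b _; rewrite !mxE.
Qed.

Lemma psi_coordV (j : 'I_d) : ([ffun b => (psi b 0 j)%:~R] : ratvec B) \in V.
Proof.
apply/memV_psi; exists (delta_mx 0 j) => b.
rewrite ffunE (bigD1 j) //= big1 => [|i ij]; first by rewrite [delta_mx _ _ _ _]mxE !eqxx mulr1 addr0.
by rewrite [delta_mx _ _ _ _]mxE (negPf ij) andbF mulr0.
Qed.

(** A symmetry acts on the coordinate functions of [psi] by a rational matrix; its
    transpose, over the reals, sends [theta] to the required vector. *)
Lemma psi_transitive (R : realType) :
  (forall b1 b2 : B, exists s : {perm B}, symmetry V s /\ s b1 = b2) -> point_transitive R psi.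
Proof.
move=> hsym theta b1 b2; have [s [sV sb]] := hsym b1 b2.
have hQ j : exists c : 'rV[rat]_d, forall b, ((psi (s b) 0 j)%:~R : rat) = \sum_l (psi b 0 l)%:~R * c 0 l.
  have /sV /memV_psi [c hc] := psi_coordV j; exists c => b.
  by rewrite -hc !ffunE.
have [Q hQ'] := choice hQ.
exists (\row_l \sum_j ratr (Q j 0 l) * theta 0 j), s => // b.
rewrite /pairing; under eq_bigr do rewrite [X in _ * X]mxE mulr_sumr.
rewrite exchange_big /=; apply: eq_bigr => j _.
have := congr1 (@ratr R) (hQ' j b); rewrite ratr_int => ->.
rewrite rmorph_sum /= mulr_suml; apply: eq_bigr => l _.
by rewrite rmorphM /= ratr_int mulrA.
Qed.

Lemma integer_relation (g : ratvec B) : orth_compl V g ->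
  (forall b, (g b : rat) \is a Num.int) ->
  exists z : B -> int, (forall b, g b = (z b)%:~R) /\ \sum_b z b *: psi b = 0.
Proof.
move=> og ig; exists (fun b => Num.floor (g b)).
have gz b : g b = (Num.floor (g b : rat))%:~R by rewrite floorK.
split => //; apply/rowP => j; rewrite mxE summxE; apply/eqP; rewrite -(eqr_int rat); apply/eqP.
rewrite (raddf_sum (intmul 1%R)) /= -[RHS](og _ (psi_coordV j)).
by apply: eq_bigr => b _; rewrite ffunE !mxE intrM -gz mulrC.
Qed.

Lemma span_sum_vanish (R : realType) (r : B -> R) (X : seq (ratvec B)) (f : ratvec B) :
  (forall g, g \in X -> \sum_b ratr (g b) * r b = 0) -> f \in span X ->
  \sum_b ratr (f b) * r b = 0.
Proof.
move=> hX /(@coord_span _ _ _ (in_tuple X)) ->.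
transitivity (\sum_(i < size X) ratr (coord (in_tuple X) i f) * \sum_b ratr ((X`_i) b) * r b).
  under eq_bigr => b _.
    rewrite sum_ffunE rmorph_sum /= mulr_suml.
    under eq_bigr do rewrite ffunE rmorphM /= -mulrA.
    over.
  by rewrite exchange_big /=; apply: eq_bigr => i _; rewrite mulr_sumr.
by rewrite big1 // => i _; rewrite hX ?mulr0 // mem_nth.
Qed.

(** Bounded integral elements span the orthogonal complement of [V], so a function
    satisfying the short relations is orthogonal to the left kernel of [Psi]. By a count of
    ranks, the orthogonal of this kernel over the reals is the column space of [Psi]. *)
Lemma psi_dual (R : realType) (c3 : nat) :
  bounded_integer_basis (@l1_norm B) c3 (orth_compl V) ->
  forall r : B -> R,
  (forall g : B -> int, \sum_b `|g b| <= c3%:Z -> \sum_b g b *: psi b = 0 ->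
     \sum_b (g b)%:~R * r b = 0) ->
  exists theta, forall b, r b = pairing psi b theta.
Proof.
move=> hperp r hr.
pose PQ : 'M[rat]_(#|B|, d) := map_mx intr Psi.
pose PR : 'M[R]_(#|B|, d) := map_mx ratr PQ.
have [K KE] : exists K, K = kermx PQ by exists (kermx PQ).
pose rv : 'rV[R]_#|B| := \row_j r (enum_val j).
have rK : rv *m (map_mx ratr K)^T = 0.
  apply/rowP => i; rewrite !mxE.
  pose f : ratvec B := [ffun b => K i (enum_rank b)].
  have of_ : orth_compl V f.
    move=> g /memV_psi [c hc].
    under eq_bigr => b _ do rewrite hc ffunE mulr_suml.
    rewrite exchange_big /= big1 // => j _.
    have /matrixP /(_ i j) : K *m PQ = 0 by rewrite KE mulmx_ker.
    rewrite !mxE => e; transitivity (c 0 j * (\sum_l K i l * PQ l j)); last by rewrite e mulr0.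
    rewrite [in RHS](reindex (@enum_rank B)) /=; last by exists enum_val => k _; rewrite ?enum_rankK ?enum_valK.
    by rewrite mulr_sumr; apply: eq_bigr => b _; rewrite !mxE; ring.
  move: of_; rewrite -hperp => -[X [hX fX]].
  have := @span_sum_vanish R r X f _ fX.
  rewrite (reindex (@enum_val B (mem B))) /=; last by exists enum_rank => k _; rewrite ?enum_rankK ?enum_valK.
  move=> e; rewrite -[RHS]e => [|g /hX [og ig ng]].
    by apply: eq_bigr => j _; rewrite !mxE ffunE enum_valK mulrC.
  have [z [gz z0]] := integer_relation og ig.
  rewrite -[RHS](hr z) //; first by apply: eq_bigr => b _; rewrite gz ratr_int.
  rewrite -(ler_int rat) (raddf_sum (intmul 1%R)) /=; apply: le_trans ng.
  by rewrite /l1_norm; apply: ler_sum => b _; rewrite gz intr_norm.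
have PK : PR^T *m (map_mx ratr K)^T = 0.
  by rewrite -trmx_mul -map_mxM KE mulmx_ker map_mx0 trmx0.
have rankPQ : \rank PQ = d.
  apply/eqP; rewrite eqn_leq rank_leq_col /=.
  have : (\rank (map_mx (intr : int -> rat) Li *m PQ) <= \rank PQ)%N by apply: mxrankM_maxr.
  by rewrite -map_mxM LiPsi map_mx1 mxrank1.
have sub : (PR^T <= kermx (map_mx ratr K)^T)%MS by apply/sub_kermxP.
have := mxrank_leqif_eq sub => -[_ /esym].
rewrite mxrank_tr mxrank_map rankPQ mxrank_ker mxrank_tr mxrank_map KE mxrank_ker rankPQ.
rewrite subKn; last by rewrite -rankPQ rank_leq_row.
rewrite eqxx => /eqmxP eqk.
have : (rv <= PR^T)%MS.
  rewrite eqk -KE; apply/sub_kermxP.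
  exact: rK.
move=> /submxP [D hD]; exists D => b.
have /rowP /(_ (enum_rank b)) := hD; rewrite !mxE enum_rankK => ->.
by apply: eq_bigr => i _; rewrite !mxE ratr_int mulrC.
Qed.

(** In lattice coordinates, an integral function of [V] has an integral coefficient vector,
    obtained with the left inverse [Li]. The vectors of bounded integral functions spanning
    [V] have full rank; [d] independent ones form [F]. *)
Lemma psi_bounded_basis (c2 : nat) : bounded_integer_basis (@linf_norm B) c2 [set f | f \in V] ->
  exists F : 'M[int]_d, \det F != 0 /\ forall b j, `|(psi b *m F) 0 j| <= c2%:Z.
Proof.
move=> hV.
pose good (g : ratvec B) := [/\ g \in V, forall b, (g b : rat) \is a Num.int & linf_norm g <= c2%:R].
have hX i : exists X : seq (ratvec B), (forall g, g \in X -> good g) /\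
    ([ffun b => (psi b 0 i)%:~R] : ratvec B) \in span X.
  have : [set f | f \in V] ([ffun b => (psi b 0 i)%:~R] : ratvec B) by apply: psi_coordV.
  by rewrite -hV => -[X [h1 h2]]; exists X.
have [Xs hXs] := choice hX.
pose Y := flatten [seq Xs i | i : 'I_d].
have Yg g : g \in Y -> good g.
  by move=> /flatten_mapP [i _ gi]; have [h _] := hXs i; apply: h.
have psiY i : ([ffun b => (psi b 0 i)%:~R] : ratvec B) \in span Y.
  have [_ h] := hXs i; apply: (subvP (sub_span _) _ h) => g gi.
  by apply/flatten_mapP; exists i; rewrite ?mem_enum.
pose C : 'M[int]_(size Y, d) := \matrix_(l, i) \sum_k Li i k * Num.floor ((Y`_l) (enum_val k) : rat).
have YC (l : 'I_(size Y)) b : (Y`_l) b = (\sum_i psi b 0 i * C l i)%:~R.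
  have [YV Yi _] := Yg _ (mem_nth 0 (ltn_ord l)).
  have [c hc] := (memV_psi _).1 YV.
  have cC i : c 0 i = (C l i)%:~R.
    rewrite mxE (raddf_sum (intmul 1%R)) /=.
    transitivity (\sum_k (Li i k)%:~R * \sum_j (psi (enum_val k) 0 j)%:~R * c 0 j).
      under eq_bigr do rewrite mulr_sumr.
      rewrite exchange_big /=.
      transitivity (\sum_j ((Li *m Psi) i j)%:~R * c 0 j).
        rewrite LiPsi (bigD1 i) //= big1 => [|j ji]; first by rewrite mxE eqxx mul1r addr0.
        by rewrite mxE eq_sym (negPf ji) mul0r.
      apply: eq_bigr => j _; rewrite mxE (raddf_sum (intmul 1%R)) /= mulr_suml.
      by apply: eq_bigr => k _; rewrite intrM !mxE enum_valK mulrA.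
    by apply: eq_bigr => k _; rewrite intrM floorK // hc.
  rewrite hc (raddf_sum (intmul 1%R)) /=; apply: eq_bigr => i _.
  by rewrite intrM cC.
have fullC : row_full (map_mx (intr : int -> rat) C).
  rewrite -sub1mx; apply/row_subP => i; apply/submxP.
  pose co l := coord (in_tuple Y) l ([ffun b => (psi b 0 i)%:~R] : ratvec B).
  have e b : ((psi b 0 i)%:~R : rat) = \sum_l co l * (Y`_l) b.
    have := coord_span (psiY i : _ \in span (in_tuple Y)).
    move=> /(congr1 (fun f : ratvec B => f b)); rewrite ffunE sum_ffunE => ->.
    by apply: eq_bigr => l _; rewrite ffunE.
  exists (\row_l co l).
  suff : map_mx (intr : int -> rat) Psi *m (row i 1%:M - (\row_l co l) *m map_mx intr C)^T = 0.
    move=> /(congr1 (mulmx (map_mx (intr : int -> rat) Li))).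
    rewrite mulmxA -map_mxM LiPsi map_mx1 mul1mx mulmx0 => /(congr1 trmx).
    by rewrite trmxK trmx0 => /eqP; rewrite subr_eq0 => /eqP.
  apply/matrixP => k o; rewrite !mxE.
  transitivity ((psi (enum_val k) 0 i)%:~R - \sum_l co l * (Y`_l) (enum_val k)); last by rewrite -e subrr.
  under eq_bigr do rewrite !mxE mulrBr.
  rewrite sumrB; congr (_ - _).
    rewrite (bigD1 i) //= big1 => [|j ji]; first by rewrite eqxx mulr1 addr0 mxE enum_valK.
    by rewrite eq_sym (negPf ji) mulr0.
  under eq_bigr do rewrite mulr_sumr.
  rewrite exchange_big /=; apply: eq_bigr => l _; rewrite YC (raddf_sum (intmul 1%R)) /= mulr_sumr.
  by apply: eq_bigr => j _; rewrite !mxE enum_valK intrM; ring.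
pose fr := fullrankfun fullC.
exists (rowsub fr C)^T; split.
  have := fullrowsub_unit fullC.
  by rewrite -map_mxsub unitmxE det_map_mx unitfE intr_eq0 det_tr.
move=> b j; rewrite -(ler_int rat) intr_norm.
have [_ _] := Yg _ (mem_nth 0 (ltn_ord (fr j))); apply: le_trans.
have -> : (psi b *m (rowsub fr C)^T) 0 j = \sum_i psi b 0 i * C (fr j) i.
  by rewrite mxE; apply: eq_bigr => i _; rewrite !mxE.
rewrite -YC; exact: (le_bigmax _ (fun b => `|(Y`_(fr j)) b|)).
Qed.

End LatticeBasis.

(** * The covolume of the lattice *)

Section LatticeDet.
Context (A : finType).
Local Notation d := #|A|.

Lemma lattice_det_sub (beta beta' : A -> ratvec A) : lattice beta `<=` lattice beta' ->
  exists z : int, \det (mx_of (fun a a' => beta a a' : rat)) =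
    z%:~R * \det (mx_of (fun a a' => beta' a a' : rat)).
Proof.
move=> sub.
have h a : exists n : A -> int, beta a = \sum_a' beta' a' *~ n a'.
  apply: sub; exists (fun a' => (a' == a)%:R).
  by rewrite (bigD1 a) //= eqxx mulr1z big1 ?addr0 // => i /negPf ->; rewrite mulr0z.
have [N hN] := choice h.
exists (\det (mx_of N)); rewrite -det_map_mx -det_mulmx; congr (\det _).
apply/matrixP => i j; rewrite !mxE hN sum_ffunE.
rewrite (reindex (@enum_val A (mem A))) /=; last by exists enum_rank => k _; rewrite ?enum_rankK ?enum_valK.
by apply: eq_bigr => k _; rewrite ffunMzE !mxE mulrzl.
Qed.

(** The determinants of two bases are integral multiples of each other, so the value chosen
    in [lattice_det] is that of any basis. *)
Lemma lattice_det_basis (beta : A -> ratvec A) : free (codom beta) ->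
  lattice_det (lattice beta) = `|\det (mx_of (fun a a' => beta a a' : rat))|.
Proof.
move=> fb; apply: xget_unique => [|D [beta' [_ eL ->]]]; first by exists beta.
have sub : lattice beta `<=` lattice beta' by rewrite eL.
have sub' : lattice beta' `<=` lattice beta by rewrite eL.
have [z hz] := lattice_det_sub sub; have [z' hz'] := lattice_det_sub sub'.
move: hz hz'; set x := \det _; set y := \det _ => hx hy.
have [x0|x0] := eqVneq x 0; first by rewrite hy x0 mulr0.
have zz : z * z' = 1.
  apply/eqP; rewrite -(eqr_int rat) intrM; apply/eqP/(mulIf x0).
  by rewrite mul1r -mulrA -hy -hx.
have z1 : `|z'| = 1.
  have : (`|z| * `|z'| == 1)%N by rewrite -abszM zz.
  by rewrite muln_eq1 -abszE => /andP[_ /eqP ->].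
by rewrite hy normrM -intr_norm z1 mul1r.
Qed.

End LatticeDet.

Section LatticeOfBasis.
Context (A B : finType) (V : {vspace ratvec B}) (phi : A -> ratvec B).
Local Notation d := #|A|.

Context (Psi : 'M[int]_(#|B|, d)) (Bt : 'M[rat]_d) (Li : 'M[int]_(d, #|B|)).
Hypothesis pmatE : pmat phi = map_mx intr Psi *m Bt.
Hypothesis LiPsi : Li *m Psi = 1%:M.
Hypothesis uBt : Bt \in unitmx.

(** The point with lattice coordinates [lam]. *)
Definition point_of (lam : 'rV[int]_d) : ratvec A :=
  [ffun a => \sum_j (lam 0 j)%:~R * Bt j (enum_rank a)].

Lemma point_of_inj : injective point_of.
Proof.
move=> x y e; have {}e : map_mx intr x *m Bt = map_mx intr y *m Bt.
  apply/rowP => i; move/ffunP/(_ (enum_val i)): e; rewrite !ffunE enum_valK !mxE.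
  move=> h; transitivity (\sum_j (x 0 j)%:~R * Bt j i).
    by apply: eq_bigr => j _; rewrite mxE.
  by rewrite h; apply: eq_bigr => j _; rewrite mxE.
apply/rowP => j; have /rowP /(_ j) := can_inj (mulmxK uBt) e.
by rewrite !mxE => /eqP; rewrite eqr_int => /eqP.
Qed.

Lemma point_of_sum (I : finType) (F : I -> 'rV[int]_d) (c : I -> int) :
  point_of (\sum_i c i *: F i) = \sum_i point_of (F i) *~ c i.
Proof.
apply/ffunP => a; rewrite ffunE sum_ffunE.
under [RHS]eq_bigr do rewrite ffunMzE ffunE -mulrzl mulr_sumr.
rewrite exchange_big /=; apply: eq_bigr => j _.
rewrite summxE (raddf_sum (intmul 1%R)) /= mulr_suml; apply: eq_bigr => i _.
by rewrite mxE intrM mulrA.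
Qed.

Lemma eval_at_psi b : eval_at phi b = point_of (psi Psi b).
Proof.
by apply/ffunP => a; rewrite !ffunE -{1}(enum_rankK a) (phi_psi pmatE).
Qed.

Lemma latticeE : lattice (eval_at phi) = range point_of.
Proof.
apply/seteqP; split => [x [n ->]|x [lam _ <-]].
  exists (\sum_b n b *: psi Psi b) => //; rewrite point_of_sum.
  by apply: eq_bigr => b _; rewrite eval_at_psi.
exists (fun b => \sum_i lam 0 i * Li i (enum_rank b)).
under eq_bigr do rewrite eval_at_psi.
rewrite -point_of_sum; congr point_of.
rewrite -[LHS]mulmx1 -LiPsi mulmxA; apply/rowP => j; rewrite mxE summxE.
rewrite [LHS](reindex (@enum_rank B)) /=; last by exists enum_val => k _; rewrite ?enum_rankK ?enum_valK.
by apply: eq_bigr => b _; rewrite !mxE.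
Qed.

Lemma lattice_det_eval : lattice_det (lattice (eval_at phi)) = `|\det Bt|.
Proof.
pose beta (a : A) : ratvec A := point_of (delta_mx 0 (enum_rank a)).
have betaE a a' : beta a a' = Bt (enum_rank a) (enum_rank a').
  rewrite ffunE (bigD1 (enum_rank a)) //= big1 => [|j ij].
    by rewrite mxE !eqxx mul1r addr0.
  by rewrite mxE (negPf ij) andbF mul0r.
have -> : lattice (eval_at phi) = lattice beta.
  rewrite latticeE; apply/seteqP; split => [x [lam _ <-]|x [n ->]].
    exists (fun a => lam 0 (enum_rank a)); rewrite -point_of_sum; congr point_of.
    rewrite [LHS]row_sum_delta [LHS](reindex (@enum_rank A)) //=.
    by exists enum_val => k _; rewrite ?enum_rankK ?enum_valK.
  by exists (\sum_a n a *: delta_mx 0 (enum_rank a)) => //; rewrite point_of_sum.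
rewrite lattice_det_basis.
  congr (`|\det _|); apply/matrixP => i j; rewrite mxE betaE !enum_valK //.
apply/(@freeP _ _ _ (codom_tuple beta)) => k k0 i.
pose v : 'rV[rat]_d := \row_j k j.
have nthc (j : 'I_d) : (codom_tuple beta)`_j = beta (enum_val j) by rewrite (nth_codom 0).
have v0 : v *m Bt = 0.
  apply/rowP => j; move/ffunP/(_ (enum_val j)): k0; rewrite sum_ffunE !ffunE !mxE => e.
  rewrite -[RHS]e; apply: eq_bigr => l _; rewrite ffunE nthc betaE !enum_valK mxE //.
have := congr1 (mulmx^~ (invmx Bt)) v0; rewrite mulmxK // mul0mx => /rowP /(_ i).
by rewrite !mxE.
Qed.

End LatticeOfBasis.

(** * The random subset and the moments of the sum *)

Section Patterns.
Context (R : realType) (B : finType) (p : R).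

(** The independence of the events [b \in J] for a [p]-random subset [J]. *)
Lemma wt_prod (h : B -> bool -> R) :
  \sum_(J : {set B}) wt p J * \prod_b h b (b \in J) =
  \prod_b (p * h b true + (1 - p) * h b false).
Proof.
rewrite bigA_distr; apply: eq_bigr => J _.
rewrite -big_split /=; apply: eq_bigr => b _; by case: (b \in J).
Qed.

Lemma wt_mean b : \sum_(J : {set B}) wt p J * (b \in J)%:R = p.
Proof.
transitivity (\sum_(J : {set B}) wt p J * \prod_c (if c == b then (c \in J)%:R else 1)).
  by apply: eq_bigr => J _; rewrite -big_mkcond big_pred1_eq.
rewrite (wt_prod (fun c t => if c == b then t%:R else 1)) (bigD1 b) //= eqxx big1 => [|c /negPf ->].
  by rewrite !mulr1 mulr0 addr0.
by rewrite !mulr1 addrC subrK.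
Qed.

Lemma wt_cov b b' : \sum_(J : {set B}) wt p J * (((b \in J)%:R - p) * ((b' \in J)%:R - p)) =
  if b == b' then p * (1 - p) else 0.
Proof.
pose h c (t : bool) : R := (if c == b then t%:R - p else 1) * (if c == b' then t%:R - p else 1).
transitivity (\sum_(J : {set B}) wt p J * \prod_c h c (c \in J)).
  by apply: eq_bigr => J _; rewrite big_split -!big_mkcond !big_pred1_eq.
rewrite wt_prod (bigD1 b) //= /h eqxx; have [->|bb'] := eqVneq b b'.
  rewrite big1 => [|c /negPf ->]; last by rewrite !mulr1 addrC subrK.
  by rewrite mulr1 /=; ring.
by rewrite [X in X * _](_ : _ = 0) ?mul0r //=; ring.
Qed.

End Patterns.

Section RandomSubset.
Context (R : realType) (B : finType) (p : R).
Context (d : measure_display) (Omega : measurableType d) (P : probability Omega R).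
Context (T : B -> {RV P >-> R}).
Hypothesis hT : mutually_independent T.
Hypothesis hTp : forall b, P (T b @^-1` [set 1%R]) = p%:E /\
                     (1 - P (T b @^-1` [set 0%R]) = p%:E)%E.

Definition pattern (J : {set B}) : set Omega := [set w | forall b, T b w = (b \in J)%:R].

(** The hypothesis gives the probability of the value 0 only through its complement in the
    extended reals. *)
Lemma prob_T0 b : P (T b @^-1` [set 0%R]) = (1 - p)%:E.
Proof.
have [_] := hTp b; case: (P _) => [r| |] //= [<-]; congr (_%:E); ring.
Qed.

Lemma measurable_pattern J : measurable (pattern J).
Proof.
have -> : pattern J = \bigcap_(b in [set: B]) T b @^-1` [set (b \in J)%:R].
  by apply/seteqP; split => w h b; [move=> _; exact: h | exact: (h b I)].
by apply: fin_bigcap_measurable.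
Qed.

Lemma prob_pattern J : P (pattern J) = (wt p J)%:E.
Proof.
have := @hT [set b : B | true]%SET (fun b => [set (b \in J)%:R]) (fun b _ => measurable_set1 _).
rewrite (_ : [set w | _] = pattern J); last first.
  by apply/seteqP; split => w h b => [|_]; apply: h => //; rewrite inE.
move=> ->; rewrite /wt [LHS](eq_bigl xpredT) => [|b]; last by rewrite inE.
rewrite -prodEFin; apply: eq_bigr => b _.
by case: (b \in J); [case: (hTp b)|rewrite prob_T0].
Qed.

(** The values 0 and 1 exhaust the mass of each variable. *)
Lemma ae_pattern : {ae P, forall w, exists J, pattern J w}.
Proof.
have ae01 b : {ae P, forall w, T b w = 0 \/ T b w = 1}.
  exists (~` (T b @^-1` [set 0] `|` T b @^-1` [set 1])); split.
  - apply: measurableC; apply: measurableU; exact: (measurable_funPTI (T b) (measurable_set1 _)).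
  - rewrite probability_setC; last first.
      apply: measurableU; exact: (measurable_funPTI (T b) (measurable_set1 _)).
    rewrite measureU; [|exact: (measurable_funPTI (T b) (measurable_set1 _))..|]; last first.
      by apply/seteqP; split => w //= [-> /esym/eqP]; rewrite oner_eq0.
    transitivity (1 - ((1 - p)%:E + p%:E))%E; last by rewrite -EFinD subrK subrr.
    by congr (1 - (_ + _))%E; [exact: prob_T0 | have [] := hTp b].
  - by move=> w /= h [] e; apply: h; [left|right].
have aeF : Filter (almost_everywhere P) by exact: ae_filter_ringOfSetsType.
have : {ae P, forall w, forall b, T b w = 0 \/ T b w = 1} by exact: (@filter_forall _ _ _ _ _ ae01).
apply: filterS => w h.
exists [set b | T b w == 1]%SET => b; rewrite inE.
by case: (h b) => ->; rewrite ?eqxx // eq_sym oner_eq0.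
Qed.

(** Up to a null set, a random variable that depends only on the pattern is a finite
    combination of indicators of patterns. *)
Lemma expectation_pattern (f : Omega -> R) (g : {set B} -> R) :
  measurable_fun setT f -> (forall J w, pattern J w -> f w = g J) ->
  ('E_P[f])%E = (\sum_J wt p J * g J)%:E.
Proof.
move=> mf fg; rewrite unlock.
pose G (J : {set B}) w : \bar R := ((g J)%:E * (\1_(pattern J) w)%:E)%E.
have iG J : P.-integrable setT (G J).
  by apply: integrableZl => //; apply: integrable_indic; exact: measurable_pattern.
rewrite (@ae_eq_integral _ _ _ _ _ (fun w => \sum_J G J w)%E); last 4 first.
- by [].
- exact/measurable_EFinP.
- by apply: emeasurable_sum => J; case/integrableP: (iG J).
- apply: filterS ae_pattern => w [J hJ] _.
  rewrite (bigD1 J) //= big1 => [|J' JJ'].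
    by rewrite /G indicE mem_set // mule1 adde0 (fg _ _ hJ).
  rewrite /G indicE memNset ?mule0 // => hJ'; move/eqP: JJ'; apply.
  apply/setP => b; have := hJ b; rewrite (hJ' b).
  by case: (b \in J'); case: (b \in J) => // /eqP; rewrite ?oner_eq0 // eq_sym oner_eq0.
rewrite integral_sum // -sumEFin; apply: eq_bigr => J _.
rewrite integralZl //; last by apply: integrable_indic; exact: measurable_pattern.
rewrite integral_indic //; last exact: measurable_pattern.
by rewrite setIT mulrC EFinM; congr (_ * _)%E; exact: prob_pattern.
Qed.

Lemma prob_pattern_event (D : set Omega) (g : {set B} -> bool) : measurable D ->
  (forall J w, pattern J w -> D w <-> g J) -> P D = (\sum_J wt p J * (g J)%:R)%:E.
Proof.
move=> mD Dg.
have <- : ('E_P[\1_D])%E = (\sum_J wt p J * (g J)%:R)%:E.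
  apply: expectation_pattern => [|J w hJ]; first exact: measurable_indic.
  rewrite indicE (_ : (w \in D) = g J) //; apply/idP/idP; first by rewrite inE => /(Dg _ _ hJ).
  by move=> h; rewrite inE; apply/(Dg _ _ hJ).
by rewrite unlock integral_indic // setIT.
Qed.

End RandomSubset.

Section LinearForms.
Context (R : realType) (B : finType) (p : R).

Lemma wt_mean_sum (x : B -> R) : \sum_(J : {set B}) wt p J * (\sum_b (b \in J)%:R * x b) = p * \sum_b x b.
Proof.
under eq_bigr do rewrite mulr_sumr.
rewrite exchange_big mulr_sumr /=; apply: eq_bigr => b _.
by rewrite -[in RHS](wt_mean p b) mulr_suml; apply: eq_bigr => J _; rewrite mulrA.
Qed.

Lemma wt_cov_sum (x y : B -> R) :
  \sum_(J : {set B}) wt p J * ((\sum_b (b \in J)%:R * x b - p * \sum_b x b) *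
                              (\sum_b (b \in J)%:R * y b - p * \sum_b y b)) =
  p * (1 - p) * \sum_b x b * y b.
Proof.
have cen (J : {set B}) (z : B -> R) :
    \sum_b (b \in J)%:R * z b - p * \sum_b z b = \sum_b ((b \in J)%:R - p) * z b.
  by rewrite mulr_sumr -sumrB; apply: eq_bigr => b _; rewrite mulrBl.
transitivity (\sum_b \sum_b' x b * y b' *
    \sum_(J : {set B}) wt p J * (((b \in J)%:R - p) * ((b' \in J)%:R - p))).
  under eq_bigr => J _ do rewrite !cen mulr_suml mulr_sumr.
  rewrite exchange_big /=; apply: eq_bigr => b _.
  under eq_bigr => J _ do rewrite !mulr_sumr.
  rewrite exchange_big /=; apply: eq_bigr => b' _.
  by rewrite mulr_sumr; apply: eq_bigr => J _; ring.
rewrite mulr_sumr; apply: eq_bigr => b _.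
rewrite (bigD1 b) //= wt_cov eqxx big1 ?addr0 => [|b' b'b]; first by ring.
by rewrite wt_cov eq_sym (negPf b'b) mulr0.
Qed.

End LinearForms.

Section Moments.
Context (R : realType) (A B : finType) (phi : A -> ratvec B) (p : R).
Context (dd : measure_display) (Omega : measurableType dd) (P : probability Omega R).
Context (T : B -> {RV P >-> R}).
Hypothesis hT : mutually_independent T.
Hypothesis hTp : forall b, P (T b @^-1` [set 1%R]) = p%:E /\
                     (1 - P (T b @^-1` [set 0%R]) = p%:E)%E.

Local Notation X := (random_sum phi T).
Local Notation v b a := (ratr (phi a b) : R).

Lemma random_sum_pattern a J w : pattern T J w -> X w a = \sum_b (b \in J)%:R * v b a.
Proof. by move=> h; rewrite ffunE; apply: eq_bigr => b _; rewrite h ffunE. Qed.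

Lemma measurable_coord a : measurable_fun setT (fun w => X w a).
Proof.
have -> : (fun w => X w a) = (fun w => \sum_b T b w * ratr (eval_at phi b a)).
  by apply/funext => w; rewrite ffunE.
apply: measurable_sum => b; apply: measurable_funM; first exact: measurable_funPT.
exact: measurable_cst.
Qed.

Lemma expectation_coord a : ('E_P[fun w => X w a])%E = (p * \sum_b v b a)%:E.
Proof.
rewrite (expectation_pattern hT hTp (measurable_coord a) (@random_sum_pattern a)).
by rewrite wt_mean_sum.
Qed.

Lemma mean_vecE a : mean_vec P X a = p * \sum_b v b a.
Proof. by rewrite /mean_vec expectation_coord. Qed.

Lemma cov_mxE i j : cov_mx P X i j = p * (1 - p) * \sum_b v b (enum_val i) * v b (enum_val j).
Proof.
rewrite mxE unlock !expectation_coord /=.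
rewrite (expectation_pattern hT hTp (g := fun J =>
   (\sum_b (b \in J)%:R * v b (enum_val i) - p * \sum_b v b (enum_val i)) *
   (\sum_b (b \in J)%:R * v b (enum_val j) - p * \sum_b v b (enum_val j)))).
- by rewrite /= wt_cov_sum.
- by apply: measurable_funM; apply: measurable_funB => //; exact: measurable_coord.
- by move=> J w hJ; rewrite /= !fctE /= !(random_sum_pattern _ hJ).
Qed.

End Moments.

Section LatticeCoordinatesOfSum.
Context (R : realType) (A B : finType) (phi : A -> ratvec B) (p : R).
Local Notation d := #|A|.
Context (Psi : 'M[int]_(#|B|, d)) (Bt : 'M[rat]_d) (Li : 'M[int]_(d, #|B|)).
Hypothesis pmatE : pmat phi = map_mx intr Psi *m Bt.
Hypothesis LiPsi : Li *m Psi = 1%:M.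
Hypothesis uBt : Bt \in unitmx.
Hypothesis p01 : 0 < p < 1.
Context (dd : measure_display) (Omega : measurableType dd) (P : probability Omega R).
Context (T : B -> {RV P >-> R}).
Hypothesis hT : mutually_independent T.
Hypothesis hTp : forall b, P (T b @^-1` [set 1%R]) = p%:E /\
                     (1 - P (T b @^-1` [set 0%R]) = p%:E)%E.

Local Notation X := (random_sum phi T).
Local Notation psi := (psi Psi).
Let BR : 'M[R]_d := map_mx ratr Bt.

Lemma unit_BR : BR \in unitmx.
Proof. by rewrite map_unitmx. Qed.

Lemma ratr_phi b i : (ratr (phi (enum_val i) b) : R) = (rpsi R psi b *m BR) 0 i.
Proof.
rewrite (phi_psi pmatE) rmorph_sum mxE /=; apply: eq_bigr => j _.
by rewrite rmorphM /= ratr_int /BR [map_mx ratr _ _ _]mxE [rpsi _ _ _ _ _]mxE.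
Qed.

Lemma prob_eq_law lam : prob_eq P X (point_of Bt lam) = (law psi p lam)%:E.
Proof.
apply: (prob_pattern_event hT hTp (g := fun J => \sum_(b in J) psi b == lam)).
  have -> : [set w | X w = [ffun a => ratr (point_of Bt lam a)]] =
      \bigcap_(a in [set: A]) (fun w => X w a) @^-1` [set ratr (point_of Bt lam a)].
    apply/seteqP; split => w; first by move=> h a _; have := congr1 (fun f : {ffun A -> R} => f a) h; rewrite [X in _ = X]ffunE.
    by move=> h; apply/ffunP => a; rewrite [RHS]ffunE; exact: (h a I).
  apply: fin_bigcap_measurable => // a _; rewrite -[_ @^-1` _]setTI.
  by apply: (measurable_coord phi T a).
move=> J w hJ /=.
have XE : X w = [ffun a => ratr (point_of Bt (\sum_(b in J) psi b) a)].
  apply/ffunP => a; rewrite (random_sum_pattern phi a hJ) ffunE.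
  transitivity (ratr ((\sum_b point_of Bt (psi b) *~ (b \in J)%:R) a) : R); last first.
    rewrite -point_of_sum; congr (ratr (point_of _ _ _)); rewrite [RHS]big_mkcond /=.
    by apply: eq_bigr => b _; case: (b \in J); rewrite ?scale1r ?scale0r.
  rewrite sum_ffunE rmorph_sum /=; apply: eq_bigr => b _.
  rewrite -(eval_at_psi pmatE); case: (b \in J); first by rewrite mulr1z mul1r ffunE.
  by rewrite mulr0z ffunE mul0r rmorph0.
rewrite XE; split => [e|/eqP -> //]; apply/eqP/(point_of_inj uBt)/ffunP => a.
by move/ffunP/(_ a): e; rewrite !ffunE => /fmorph_inj.
Qed.

Lemma cov_mx_psi : cov_mx P X = BR^T *m cov_psi psi p *m BR.
Proof.
apply/matrixP => i j; rewrite (cov_mxE phi hT hTp) /cov_psi -scalemxAr -scalemxAl [RHS]mxE.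
congr (_ * _); rewrite /gram mulmx_sumr mulmx_suml summxE; apply: eq_bigr => b _.
rewrite !ratr_phi mulmxA -trmx_mul -mulmxA.
by rewrite [RHS]mxE big_ord1 [in RHS]mxE.
Qed.

Lemma det_cov_mx : \det (cov_mx P X) = (\det BR) ^+ 2 * \det (cov_psi psi p).
Proof. by rewrite cov_mx_psi !det_mulmx det_tr; ring. Qed.

Lemma gauss_exponent_psi lam : cov_psi psi p \in unitmx ->
  gauss_exponent P X (point_of Bt lam) = - (qf (invmx (cov_psi psi p)) (offset psi p lam) / 2).
Proof.
move=> uS.
have xE : col_of (fun a => ratr (point_of Bt lam a) - mean_vec P X a) = (offset psi p lam *m BR)^T.
  apply/colP => i; rewrite [LHS]mxE [RHS]mxE (mean_vecE phi hT hTp) /offset /mean_psi mulmxBl [RHS]mxE; congr (_ + _).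
    rewrite ffunE enum_valK rmorph_sum [RHS]mxE /=; apply: eq_bigr => j _.
    by rewrite rmorphM /= ratr_int /BR !mxE.
  rewrite [RHS]mxE; congr (- _); rewrite -scalemxAl [RHS]mxE mulmx_suml summxE; congr (_ * _).
  by apply: eq_bigr => b _; rewrite ratr_phi.
rewrite /gauss_exponent xE trmxK mulNr mul1r mulrC; congr (- (_ / 2)).
rewrite cov_mx_psi /qf /dot trmx_mul; set o := offset _ _ _.
have uC : BR^T *m cov_psi psi p *m BR \in unitmx.
  by rewrite !unitmx_mul unitmx_tr unit_BR uS.
congr (_ 0 0); rewrite -!mulmxA; congr (_ *m _).
rewrite !mulmxA; congr (_ *m _).
apply: (can_inj (mulmxK (_ : cov_psi psi p \in unitmx))) => //.
rewrite mulVmx //.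
have : BR *m (invmx (BR^T *m cov_psi psi p *m BR) *m (BR^T *m cov_psi psi p *m BR)) *m invmx BR = 1%:M.
  by rewrite mulVmx // mulmx1 mulmxV // unit_BR.
by rewrite !mulmxA mulmxK ?unit_BR.
Qed.

End LatticeCoordinatesOfSum.

(** * Assembling the estimate *)

Section Assembly.
Context (R : realType).

(** The factor [d * ln (2 * c2 * d) `^ (3 / 2)] by which the claimed bound is weaker is at
    least [1 / 4]. *)
Lemma error_scale (C d c2 m s : R) : 2049 * 8 <= C -> 1 <= d -> 1 <= c2 -> 0 < m -> m <= 2 * s ->
  2049 * d ^+ 2 / Num.sqrt s <= C * d ^+ 3 * ln (2 * c2 * d) `^ (3 / 2) / Num.sqrt m.
Proof.
move=> K1 d1 c1 m0 ms.
have s0 : 0 < s by lra.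
have l2 : 1 / 2 <= ln (2 * c2 * d).
  apply: le_trans (ln2_ge R) _; rewrite ler_ln ?posrE; nra.
have l4 : 1 / 4 <= ln (2 * c2 * d) `^ (3 / 2).
  apply: (@le_trans _ _ ((1 / 2) `^ (3 / 2))); last by rewrite ge0_ler_powR ?nnegrE; lra.
  rewrite powRrM powR_mulrn ?divr_ge0 // powR12_sqrt ?exprn_ge0 ?divr_ge0 //.
  rewrite -[leLHS]ger0_norm ?divr_ge0 // -sqrtr_sqr ler_sqrt ?exprn_ge0 ?divr_ge0 //; lra.
have sm0 : 0 < Num.sqrt m by rewrite sqrtr_gt0.
have ss0 : 0 < Num.sqrt s by rewrite sqrtr_gt0.
have sq : Num.sqrt m <= 2 * Num.sqrt s.
  have : Num.sqrt m <= Num.sqrt (2 ^+ 2 * s) by apply: ler_wsqrtr; lra.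
  by rewrite sqrtrM ?sqr_ge0 // sqrtr_sqr ger0_norm.
set L := _ `^ _ in l4 *; move: l4 => l4.
have r2 : 1 / 2 <= Num.sqrt s / Num.sqrt m by rewrite ler_pdivlMr //; lra.
have r8 : 1 / 8 <= d * (L * (Num.sqrt s / Num.sqrt m)).
  move: (Num.sqrt s / Num.sqrt m) r2 => r r2; have : 1 / 8 <= L * r by nra.
  move: (L * r) => t ht; nra.
rewrite ler_pdivrMr //.
rewrite (_ : C * _ * _ / _ * _ = C * (d ^+ 2 * (d * (L * (Num.sqrt s / Num.sqrt m))))); last by ring.
apply: (@le_trans _ _ (C * (d ^+ 2 * (1 / 8)))); last first.
  by apply: ler_wpM2l; [lra | apply: ler_wpM2l; [exact: sqr_ge0 | exact: r8]].
have : 0 <= d ^+ 2 by exact: sqr_ge0.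
move: (d ^+ 2) => u u0; nra.
Qed.

Lemma error_constant_large : (2049 * 8 : R) <= 2 * (10 ^+ 7) ^+ 2.
Proof.
have : (10 : R) ^+ 3 <= 10 ^+ 7 by apply: ler_weXn2l => //; lra.
move: (10 ^+ 7 : R) => K hK; nra.
Qed.

(** The larger of [p] and [1 - p] is at least [1 / 2]. *)
Lemma variance_scale (B : finType) (p : R) : 0 < p -> p < 1 ->
  Num.min (p * #|B|%:R) ((1 - p) * #|B|%:R) <= 2 * sigma2 B p.
Proof.
move=> p0 p1; rewrite /sigma2 /var1; have : 0 <= (#|B|%:R : R) by [].
move: (#|B|%:R : R) => n n0; rewrite ge_min; apply/orP.
have [h|h] := leP p (1 / 2); [left|right].
  have : 0 <= p * n * (1 - 2 * p) by rewrite !mulr_ge0 //; lra.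
  by lra.
have : 0 <= (1 - p) * n * (2 * p - 1) by rewrite !mulr_ge0 //; lra.
by lra.
Qed.

End Assembly.

Section DimensionZero.
Context (R : realType) (B : finType) (d : nat) (psi : B -> 'rV[int]_d) (p : R).
Hypothesis d0 : d = 0.

Lemma qf_dim0 (S : 'M[R]_d) y : qf S y = 0.
Proof. by rewrite /qf dotE big1 // => i; have := ltn_ord i; rewrite {2}d0. Qed.

Lemma law_dim0 lam : law psi p lam = 1.
Proof.
transitivity (\sum_(J : {set B}) wt p J * \prod_(b : B) (1 : R)).
  apply: eq_bigr => J _; rewrite [X in _ = _ * X]big1 // (_ : \sum_(b in J) psi b == lam) //.
  by apply/eqP/rowP => i; have := ltn_ord i; rewrite {2}d0.
by rewrite (wt_prod p (fun _ _ => 1)) big1 // => b _; rewrite !mulr1 addrC subrK.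
Qed.

Lemma peak_dim0 : peak psi p = 1.
Proof.
rewrite /peak; move: (cov_psi psi p); rewrite d0 => S.
by rewrite det_mx00 expr0 mulr1 sqrtr1.
Qed.

End DimensionZero.

Section Prefactor.
Context (R : realType) (A B : finType) (phi : A -> ratvec B) (p : R).
Local Notation d := #|A|.
Context (Psi : 'M[int]_(#|B|, d)) (Bt : 'M[rat]_d) (Li : 'M[int]_(d, #|B|)).
Hypothesis pmatE : pmat phi = map_mx intr Psi *m Bt.
Hypothesis LiPsi : Li *m Psi = 1%:M.
Hypothesis uBt : Bt \in unitmx.
Context (dd : measure_display) (Omega : measurableType dd) (P : probability Omega R).
Context (T : B -> {RV P >-> R}).
Hypothesis hT : mutually_independent T.
Hypothesis hTp : forall b, P (T b @^-1` [set 1%R]) = p%:E /\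
                     (1 - P (T b @^-1` [set 0%R]) = p%:E)%E.

(** The determinant of [Bt] is the covolume, and its square is the factor by which the
    change of basis multiplies the determinant of the covariance. *)
Lemma prefactor_peak : posdef (cov_psi (psi Psi) p) ->
  ratr (lattice_det (lattice (eval_at phi))) /
    ((2 * pi) `^ (d%:R / 2) * Num.sqrt (\det (cov_mx P (random_sum phi T)))) =
  (peak (psi Psi) p)^-1.
Proof.
move=> pS; have dS := det_posdef pS.
rewrite (lattice_det_eval pmatE LiPsi uBt) (det_cov_mx pmatE hT hTp) ratr_norm -det_map_mx.
have dB : \det (map_mx ratr Bt : 'M[R]_d) != 0.
  by rewrite -unitfE -unitmxE unit_BR.
have tpi : 0 <= 2 * (pi : R) by rewrite mulr_ge0 // pi_ge0.
rewrite powRrM powR_mulrn // powR12_sqrt ?exprn_ge0 //.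
rewrite sqrtrM ?sqr_ge0 // sqrtr_sqr /peak sqrtrM ?exprn_ge0 //.
by rewrite [X in _ / X]mulrCA invfM mulrA divff ?mul1r ?normr_eq0.
Qed.

End Prefactor.

Theorem theorem4p1 (R : realType) :
  exists C : R, 0 < C /\
  forall (A B : finType) (V : {vspace ratvec B}) (phi : A -> ratvec B)
    (hphi : basis_of V (codom phi))
    (p : R) (hp0 : 0 < p) (hp1 : p < 1)
    (d : measure_display) (Omega : measurableType d) (P : probability Omega R)
    (T : B -> {RV P >-> R})
    (hT : mutually_independent T)
    (hTp : forall b, P (T b @^-1` [set 1%R]) = p%:E /\
                     (1 - P (T b @^-1` [set 0%R]) = p%:E)%E)
    (c2 c3 : nat) (hc2 : (1 <= c2)%N) (hc3 : (1 <= c3)%N)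
    (hV : bounded_integer_basis (@linf_norm B) c2 [set f | f \in V])
    (hVperp : bounded_integer_basis (@l1_norm B) c3 (orth_compl V))
    (hsym : forall b1 b2 : B, exists s : {perm B}, symmetry V s /\ s b1 = b2),
  let dimV : R := (\dim V)%:R in
  let X := random_sum phi T in
  let L := lattice (eval_at phi) in
  let m := Num.min (p * #|B|%:R) ((1 - p) * #|B|%:R) in
  C * c2%:R * c3%:R ^+ 2 * dimV ^+ 6 * ln (2 * c3%:R * dimV) ^+ 6 <= m ->
  forall lambda : ratvec A, L lambda ->
  exists delta : R,
    prob_eq P X lambda =
      (ratr (lattice_det L)
         / ((2 * pi) `^ (dimV / 2) * Num.sqrt (\det (cov_mx P X)))
       * (expR (gauss_exponent P X lambda) + delta))%:E
    /\ `|delta| <= C * dimV ^+ 3 * ln (2 * c2%:R * dimV) `^ (3 / 2) / Num.sqrt m.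
Proof.
have K7 : 0 < (10 ^+ 7 : R) by rewrite exprn_gt0.
(* Twice the constant of [scale_controls_spread], as the variance is only at least half of
   the minimum in the hypothesis. *)
exists (2 * (10 ^+ 7) ^+ 2); split; first by apply: mulr_gt0 => //; rewrite exprn_gt0.
move=> A B V phi hphi p hp0 hp1 dd Omega P T hT hTp c2 c3 hc2 hc3 hV hVperp hsym dimV X L m hm.
have [Psi [Bt [Li [pmatE LiPsi uBt]]]] := lattice_coords (rank_pmat hphi).
rewrite {1}/L (latticeE pmatE LiPsi) => lambda [lam _ <-].
have p01 : 0 < p < 1 by rewrite hp0 hp1.
have gen := psi_generating LiPsi.
have pS := cov_posdef gen p01.
have pk : peak (psi Psi) p != 0.
  by rewrite gt_eqF // sqrtr_gt0 mulr_gt0 ?(det_posdef pS) // exprn_gt0 // mulr_gt0 // pi_gt0.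
set g := gauss_exponent _ _ _.
have gE : g = - (qf (invmx (cov_psi (psi Psi) p)) (offset (psi Psi) p lam) / 2).
  exact: (gauss_exponent_psi pmatE uBt hT hTp lam (posdef_unit pS)).
exists (law (psi Psi) p lam * peak (psi Psi) p - expR g); split.
  rewrite /dimV (dim_card hphi) (prefactor_peak pmatE LiPsi uBt hT hTp pS).
  rewrite (prob_eq_law pmatE uBt hT hTp) [X in _ * X]addrC subrK.
  by rewrite mulrC mulfK.
(* In dimension 0 the law is a point mass and the error vanishes. *)
have [d0|d0] := posnP #|A|.
  rewrite gE (law_dim0 _ _ d0) (peak_dim0 _ _ d0) (qf_dim0 d0) mul0r oppr0 expR0.
  by rewrite mulr1 subrr normr0 /dimV (dim_card hphi) d0 expr0n /= mulr0 !mul0r.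
have sE := variance_scale B hp0 hp1.
have d1 : 1 <= (#|A|%:R : R) by rewrite ler1n.
have c21 : 1 <= (c2%:R : R) by rewrite ler1n.
have c31 : 1 <= (c3%:R : R) by rewrite ler1n.
move: hm; rewrite /dimV (dim_card hphi) => hm.
have ms : (10 ^+ 7) ^+ 2 * main_scale (#|A|%:R : R) c2%:R c3%:R <= sigma2 B p.
  rewrite -(ler_pM2l (ltr0n R 2)); apply: le_trans sE; apply: le_trans hm.
  by rewrite /main_scale !mulrA.
have m0 : 0 < m.
  apply: lt_le_trans hm; have : 0 < ln (2 * c3%:R * #|A|%:R : R).
    by apply: ln_gt0; move: d1 c31; move: (c3%:R : R) (#|A|%:R : R) => x y; nra.
  move=> l0; apply: mulr_gt0; last exact: exprn_gt0.
  apply: mulr_gt0; last by apply: exprn_gt0; lra.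
  apply: mulr_gt0; last by apply: exprn_gt0; lra.
  apply: mulr_gt0; last by lra.
  by apply: mulr_gt0 => //; apply: exprn_gt0.
have [k [k0 kL kR]] := sampling_size R d0 hc2 hc3.
have kR0 : 0 < (k%:R : R) by rewrite ltr0n.
have [d2s spr] := scale_controls_spread d1 c21 c31 kR0 kR ms.
have [F [F0 Fb]] := psi_bounded_basis hphi pmatE LiPsi uBt hV.
rewrite gE; apply: le_trans (error_scale (error_constant_large R) d1 c21 m0 sE).
apply: (core_bound lam gen (psi_transitive hphi pmatE uBt hsym) d0 p01 F0 Fb _ hc2 hc3 k0 kL d2s spr).
by move=> r; exact: (psi_dual hphi pmatE LiPsi uBt hVperp).
Qed.
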